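(* Let $n,k$ be positive integers such that $n\geq k+2$, and let $\mathcal{F}$ be a family of functions meromorphic in a domain $D\subset\mathbb{C}$. If each $f\in\mathcal{F}$ satisfies $(f^n)^{(k)}(z)\neq 1$ for all $z\in D$, then $\mathcal{F}$ is normal in $D$.
   Context: A domain is a nonempty connected open subset of $\mathbb{C}$. A family of meromorphic functions on a domain $D$ is normal in $D$ if every sequence in the family has a subsequence that converges, uniformly on compact subsets of $D$ with respect to the spherical metric, to a meromorphic function on $D$ or to the constant $\infty$. $f^n$ denotes the $n$-th power of $f$ and $(f^n)^{(k)}$ its $k$-th derivative. *)

(* Defs.v *)
From HB Require Import structures.
From mathcomp Require Import all_boot all_order all_algebra.
From mathcomp Require Import complex.
From mathcomp Require Import all_classical all_reals all_analysis.

Set Implicit Arguments.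
Unset Strict Implicit.
Unset Printing Implicit Defensive.

Import Order.TTheory GRing.Theory Num.Theory.
Import numFieldNormedType.Exports.
Import ComplexField.Normc.

Local Open Scope classical_set_scope.
Local Open Scope ring_scope.
Local Open Scope complex_scope.

(* The library puts no topology on R[i]; seen as a numClosedFieldType it gets
   the topology of its norm and is a normed module over itself, so that
   derivable f z 1 and derive1 f z are complex differentiability and the
   complex derivative. *)
Definition cplx (R : realType) : numClosedFieldType := R[i].

(* Riemann sphere: None is the point at infinity. *)
Definition sphere (R : realType) : Type := option (cplx R).

Section Meromorphic.
Variable R : realType.
Local Notation C := (cplx R).
Local Notation S := (sphere R).
Implicit Types (f : C -> S) (D : set C) (z w : C).

Definition domain D : Prop := [/\ D !=set0, open D & connected D].

(* The values of f, with the irrelevant value 0 at the poles. *)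
Definition finite_part f : C -> C := fun z => odflt 0 (f z).

Definition holomorphic_at f z : Prop :=
  f z <> None /\ derivable (finite_part f) z 1.

(* Only used at isolated singularities of f. *)
Definition pole_at f z : Prop :=
  f z = None /\ (normc (finite_part f w) @[w --> z^'] --> +oo).

(* Every singularity in D is isolated and is a pole.  The values of f outside D
   are unconstrained and, D being open, irrelevant. *)
Definition meromorphic_on D f : Prop :=
  forall z, D z ->
    (\forall w \near z^', holomorphic_at f w) /\
    (holomorphic_at f z \/ pole_at f z).

Definition mpow f (n : nat) : C -> S :=
  fun z => omap (fun a : C => a ^+ n) (f z).

(* A derivative of a meromorphic function has the same poles as the function
   itself; away from them f is finite near z, so that finite_part f and its
   derivatives are the actual ones. *)
Definition mderivn (k : nat) f : C -> S :=
  fun z => omap (fun=> derive1n k (finite_part f) z) (f z).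

(* Length of the chord between the images of p and q under stereographic
   projection onto the unit sphere. *)
Definition chordal_dist (p q : S) : R :=
  match p, q with
  | Some a, Some b =>
      2 * normc (a - b)
      / (Num.sqrt (1 + normc a ^+ 2) * Num.sqrt (1 + normc b ^+ 2))
  | Some a, None | None, Some a => 2 / Num.sqrt (1 + normc a ^+ 2)
  | None, None => 0
  end.

(* Great-circle distance: an arc of angle t has a chord of length
   2 sin (t / 2). *)
Definition spherical_dist (p q : S) : R := 2 * asin (chordal_dist p q / 2).

Definition spherical_cvg_on_compacts D (u : nat -> C -> S) (g : C -> S) : Prop :=
  forall K : set C, compact K -> K `<=` D ->
  forall e : R, 0 < e ->
  \forall j \near \oo, forall z, K z -> spherical_dist (u j z) (g z) < e.

Definition normal_in D (F : set (C -> S)) : Prop :=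
  forall u : nat -> C -> S, (forall j, F (u j)) ->
  exists (phi : nat -> nat) (g : C -> S),
    [/\ {homo phi : i j / (i < j)%N},
        meromorphic_on D g \/ (forall z, D z -> g z = None) &
        spherical_cvg_on_compacts D (u \o phi) g].

End Meromorphic.

(* Main.v *)
(* The rescaling g(x) = s^-k f(z + s^n x) leaves (f^n)^(k) invariant, so by
   Zalcman's argument a family whose spherical derivatives are not locally
   bounded yields a nonconstant u : C -> sphere with bounded spherical
   derivative and (u^n)^(k) <> 1 at all finite points.  There is no such u:
   P = 1 / ((u^n)^(k) - 1) is entire.  It is bounded where u is (translate and
   use Hurwitz), and log |P(z)| = O(|z|), because where u is large P is a
   quotient of bounded functions, to which Harnack's inequality applies.  Hence
   P'/P = O(|z|) on suitable arbitrarily large circles, and an entire function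
   that is bounded where u is and O((1 + |P'/P|)^2) elsewhere is a polynomial,
   and then constant, since otherwise u would tend to infinity at infinity and P
   to 0.  This applies to - P' / (P u), so that P' = - c u P with c <> 0.  If u
   has no pole, it applies to u itself.  If u has poles, their local expansion
   shows that c u' - c^2 u^2 / (n + k) extends to an entire function vanishing at
   them; it is constant, hence zero, which contradicts P' = - c u P at a pole.

   All limits are taken along one free ultrafilter on nat: compactness becomes
   convergence of bounded sequences, and integrals become limits of finite
   averages. *)
Require Import Defs.
From mathcomp Require Import all_boot all_order all_algebra.
From mathcomp Require Import complex.
From mathcomp Require Import all_classical all_reals all_analysis.
From mathcomp Require Import zify ring lra.

Set Implicit Arguments.
Unset Strict Implicit.
Unset Printing Implicit Defensive.

Import Order.TTheory GRing.Theory Num.Theory.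
Import numFieldNormedType.Exports.
Import ComplexField.Normc.

Local Open Scope classical_set_scope.
Local Open Scope ring_scope.
Local Open Scope complex_scope.

(** * The modulus, and limits along an ultrafilter *)

(** A bound K on the spherical derivative yields, around every point, a disc whose radius depends on
    K alone and on which [u] or 1 / u is holomorphic with modulus at most 2. Estimates for [u]
    therefore have constants independent of the centre, translates of [u] form a compact family, and
    an identity found near one point spreads over the plane in steps of fixed length. The assumption
    n >= k + 2 makes (u^n)^(k+1), a multiple of u^(n-k-1), divisible by u, so that P' / (P u) is
    regular at the zeros of u. With k >= 1 it gives n >= 3, which allows the two coefficients after
    the leading one to be computed at a pole b. Both vanish, and the resulting u = - (n + k) / (c (z
    - b)) + O((z - b)^2) is what makes c u' - c^2 u^2 / (n + k) vanish at b. The exponents of s^-k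
    and s^n in the rescaling are those of Zalcman's lemma with weight k / n, written without
    fractional powers. *)

Section ComplexNorm.
Variable R : realType.
Local Notation C := R[i].
Local Notation N := (@normc R).
Local Notation Re := (@complex.Re R).
Local Notation Im := (@complex.Im R).
Implicit Types (z w : C).

Lemma N_ge0 z : 0 <= N z. Proof. by case: z => a b; exact: sqrtr_ge0. Qed.
Lemma N0 : N 0 = 0. Proof. exact: normc0. Qed.
Lemma N1 : N 1 = 1. Proof. exact: normc1. Qed.
Lemma N_eq0 z : (N z == 0) = (z == 0).
Proof. by apply/eqP/eqP => [/eq0_normc|->] //; exact: normc0. Qed.
Lemma N_gt0 z : (0 < N z) = (z != 0).
Proof. by rewrite lt_def N_ge0 andbT N_eq0. Qed.
Lemma NM z w : N (z * w) = N z * N w. Proof. exact: normcM. Qed.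
Lemma NV z : N z^-1 = (N z)^-1. Proof. exact: normcV. Qed.
Lemma Nf z w : N (z / w) = N z / N w. Proof. by rewrite NM NV. Qed.
Lemma NN z : N (- z) = N z. Proof. exact: (normcN z). Qed.
Lemma ND z w : N (z + w) <= N z + N w. Proof. exact: (le_normcD z w). Qed.
Lemma NB z w : N (z - w) <= N z + N w. Proof. by rewrite -(NN w) ND. Qed.
Lemma NC z w : N (z - w) = N (w - z). Proof. by rewrite -NN opprB. Qed.
Lemma NX z n : N (z ^+ n) = N z ^+ n.
Proof. by elim: n => [|n IH]; rewrite ?expr0 ?N1 // !exprS NM IH. Qed.
Lemma Nr (x : R) : N x%:C = `|x|.
Proof. by rewrite /normc /= expr0n /= addr0 sqrtr_sqr. Qed.
Lemma Nnat n : N n%:R = n%:R.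
Proof. by rewrite -[n%:R](rmorph_nat (real_complex R)) Nr ger0_norm // ler0n. Qed.
Lemma NRe z : `|Re z| <= N z.
Proof.
case: z => a b /=; rewrite -sqrtr_sqr ler_sqrt ?addr_ge0 ?sqr_ge0 //.
by rewrite lerDl sqr_ge0.
Qed.
Lemma NIm z : `|Im z| <= N z.
Proof.
case: z => a b /=; rewrite -sqrtr_sqr ler_sqrt ?addr_ge0 ?sqr_ge0 //.
by rewrite lerDr sqr_ge0.
Qed.
Lemma NReIm z : N z <= `|Re z| + `|Im z|.
Proof.
rewrite {1}(complexE z); apply: le_trans (ND _ _) _.
rewrite NM !Nr (_ : N 'i = 1) ?mul1r //.
by rewrite /normc /= expr0n expr1n add0r sqrtr1.
Qed.
Lemma NJ z : N z^* = N z.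
Proof. by case: z => a b; rewrite /= sqrrN. Qed.
Lemma Nsqr z : N z ^+ 2 = Re z ^+ 2 + Im z ^+ 2.
Proof. by case: z => a b; rewrite /= sqr_sqrtr // addr_ge0 ?sqr_ge0. Qed.
Lemma ND3 a b z : N (z - b) <= N (z - a) + N (a - b).
Proof. by rewrite (_ : z - b = (z - a) + (a - b)) ?ND // addrA subrK. Qed.
Lemma ND_ge z w : N z - N w <= N (z + w).
Proof.
rewrite lerBlDr; have := ND (z + w) (- w); rewrite NN.
by rewrite -[z + w - w]addrA subrr addr0.
Qed.
Lemma NB_ge z w : N z - N w <= N (z - w).
Proof. by rewrite -{1}(NN w) ND_ge. Qed.
Lemma N_sum (I : Type) (s : seq I) (P : pred I) (F : I -> C) :
  N (\sum_(i <- s | P i) F i) <= \sum_(i <- s | P i) N (F i).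
Proof.
apply: (big_ind2 (fun z x => N z <= x)) => //; first by rewrite N0.
by move=> a x b y h k; apply: le_trans (ND _ _) _; rewrite lerD.
Qed.
Lemma N_le0 z : N z <= 0 -> z = 0.
Proof. by move=> h; apply/eqP; rewrite -N_eq0 eq_le h N_ge0. Qed.
Lemma N_small z : (forall e : R, 0 < e -> N z <= e) -> z = 0.
Proof.
move=> h; apply: N_le0; apply/ler_addgt0Pr => e e0; rewrite add0r; exact: h.
Qed.

End ComplexNorm.

(** * A free ultrafilter on the natural numbers *)

Lemma free_ultra_exists : exists U : set_system nat,
  UltraFilter U /\ \oo `<=` U.
Proof. exact: ultraFilterLemma. Qed.

(** Fixed once and for all, so that the limit of a bounded sequence is a function of the sequence.
    Subsequences appear only in [diagonal], at the very end. *)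
Definition UF : set_system nat := projT1 (cid free_ultra_exists).

Lemma UF_ultra : UltraFilter UF.
Proof. by rewrite /UF; case: cid => U []. Qed.

#[global] Instance UF_proper : ProperFilter UF.
Proof. exact: (@ultra_proper _ _ UF_ultra). Qed.

Lemma UF_oo (P : set nat) : \oo P -> UF P.
Proof. by rewrite /UF; case: cid => U [? h]; exact: h. Qed.

Lemma UF_ge (n : nat) : UF [set j | (n <= j)%N].
Proof. by apply: UF_oo; exists n. Qed.

Lemma UF_em (P : set nat) : UF P \/ UF (~` P).
Proof. exact: in_ultra_setVsetC UF_ultra. Qed.

Lemma UF_I (P Q : set nat) : UF P -> UF Q -> UF (P `&` Q).
Proof. by move=> p q; apply: filterI. Qed.

Lemma UF_S (P Q : set nat) : (forall j, P j -> Q j) -> UF P -> UF Q.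
Proof. by move=> h; apply: filterS. Qed.

Lemma UF_all (P : set nat) : (forall j, P j) -> UF P.
Proof. by move=> h; apply: UF_oo; exists 0%N. Qed.

Lemma UF_ex (P : set nat) : UF P -> exists j, P j.
Proof. by move=> h; exact: filter_ex h. Qed.

Section UltraLimit.
Variable R : realType.
Local Notation C := R[i].
Local Notation N := (@normc R).
Local Notation Re := (@complex.Re R).
Local Notation Im := (@complex.Im R).

Definition ulimR (x : nat -> R) : R := sup [set a | UF [set j | a <= x j]].

(** The ultrafilter decides on which side of each threshold almost all terms lie: thresholds below
    the supremum lie under them, and sup + e / 2, which is not in the set, lies above them. *)
Lemma ulimRP (x : nat -> R) (B : R) : UF [set j | `|x j| <= B] ->
  forall e : R, 0 < e -> UF [set j | `|x j - ulimR x| < e].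
Proof.
move=> xB e e0; rewrite /ulimR; set A := (X in sup X).
have supA : has_sup A.
  split.
    exists (- B); rewrite /A /=; apply: (UF_S _ xB) => j /=.
    by rewrite ler_norml => /andP[].
  exists B => a Aa; have /UF_ex[j [/= h1 h2]] := UF_I Aa xB.
  by apply: le_trans h1 _; apply: le_trans (ler_norm _) h2.
have [a Aa ha] := sup_adherent e0 supA.
have hb : UF [set j | x j < sup A + e / 2].
  case: (UF_em [set j | sup A + e / 2 <= x j]) => [h|h].
    have := ub_le_sup supA.2 h.
    by lra.
  by apply: (UF_S _ h) => j /=; rewrite ltNge => /negP.
apply: (UF_S _ (UF_I Aa hb)) => j [/= h1 h2]; rewrite ltr_norml.
by apply/andP; split; lra.
Qed.

Definition ucv (x : nat -> C) (l : C) :=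
  forall e : R, 0 < e -> UF [set j | N (x j - l) < e].

Definition ulim (x : nat -> C) : C :=
  ulimR (fun j => Re (x j)) +i* ulimR (fun j => Im (x j)).

Lemma ulimP (x : nat -> C) (B : R) : UF [set j | N (x j) <= B] -> ucv x (ulim x).
Proof.
move=> xB e e0; have e2 : 0 < e / 2 by rewrite divr_gt0.
have h1 : UF [set j | `|Re (x j)| <= B].
  by apply: (UF_S _ xB) => j /=; apply: le_trans (NRe _).
have h2 : UF [set j | `|Im (x j)| <= B].
  by apply: (UF_S _ xB) => j /=; apply: le_trans (NIm _).
apply: (UF_S _ (UF_I (ulimRP h1 e2) (ulimRP h2 e2))) => j [/= a b].
apply: le_lt_trans (NReIm _) _; rewrite !raddfB /=; lra.
Qed.

Lemma ucv_unique x l l' : ucv x l -> ucv x l' -> l = l'.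
Proof.
move=> h h'; apply/eqP; rewrite -subr_eq0; apply/eqP; apply: N_small => e e0.
have e2 : 0 < e / 2 by rewrite divr_gt0.
have [j [/= a b]] := UF_ex (UF_I (h _ e2) (h' _ e2)).
by apply: le_trans (ND3 (x j) _ _) _; rewrite (NC l); lra.
Qed.

Lemma ucv_ulim x l : ucv x l -> ulim x = l.
Proof.
move=> h; apply: (ucv_unique _ (h)); apply: (@ulimP _ (N l + 1)).
apply: (UF_S _ (h 1 ltr01)) => j /= a.
by apply: ltW; have := ND (x j - l) l; rewrite subrK => /le_lt_trans; apply; lra.
Qed.

Lemma ucv_bd x l : ucv x l -> UF [set j | N (x j) <= N l + 1].
Proof.
move=> h; apply: (UF_S _ (h 1 ltr01)) => j /= a.
by apply: ltW; have := ND (x j - l) l; rewrite subrK => /le_lt_trans; apply; lra.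
Qed.

Lemma ucv_ext x y l : UF [set j | x j = y j] -> ucv x l -> ucv y l.
Proof. by move=> h k e e0; apply: (UF_S _ (UF_I h (k e e0))) => j [/= ->]. Qed.

Lemma ulim_ext x y : UF [set j | x j = y j] -> ulim x = ulim y.
Proof.
move=> h; rewrite /ulim /ulimR; congr Complex; congr (sup _);
  apply/funext => a; apply/propext; split=> k; by apply: (UF_S _ (UF_I h k)) => j [/= ->].
Qed.

Lemma ucv_cst l : ucv (fun=> l) l.
Proof. by move=> e e0; apply: UF_all => j /=; rewrite subrr N0. Qed.

Lemma ucvD x y l m : ucv x l -> ucv y m -> ucv (fun j => x j + y j) (l + m).
Proof.
move=> h k e e0; have e2 : 0 < e / 2 by rewrite divr_gt0.
apply: (UF_S _ (UF_I (h _ e2) (k _ e2))) => j [/= a b].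
rewrite (_ : _ - _ = (x j - l) + (y j - m)); last by ring.
by apply: le_lt_trans (ND _ _) _; lra.
Qed.

Lemma ucvMl a x l : ucv x l -> ucv (fun j => a * x j) (a * l).
Proof.
move=> h e e0; have c0 : 0 < N a + 1 by have := N_ge0 a; lra.
apply: (UF_S _ (h _ (divr_gt0 e0 c0))) => j /=.
rewrite ltr_pdivlMr // => k; rewrite -mulrBr NM.
by apply: le_lt_trans k; rewrite mulrC ler_wpM2l ?N_ge0 //; lra.
Qed.

Lemma ucvN x l : ucv x l -> ucv (fun j => - x j) (- l).
Proof. by move=> h e e0; apply: (UF_S _ (h e e0)) => j /=; rewrite -opprD NN. Qed.

Lemma ucvB x y l m : ucv x l -> ucv y m -> ucv (fun j => x j - y j) (l - m).
Proof. by move=> h /ucvN; exact: ucvD. Qed.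

Lemma ucv0P x : ucv x 0 <-> forall e : R, 0 < e -> UF [set j | N (x j) < e].
Proof.
by split=> h e e0; apply: (UF_S _ (h e e0)) => j /=; rewrite ?subr0.
Qed.

Lemma ucv0M x y B : ucv x 0 -> UF [set j | N (y j) <= B] ->
  ucv (fun j => x j * y j) 0.
Proof.
move=> /ucv0P h k; apply/ucv0P => e e0.
have B0 : 0 <= B by have [j /=] := UF_ex k; apply: le_trans; rewrite N_ge0.
have B1 : 0 < B + 1 by lra.
apply: (UF_S _ (UF_I (h _ (divr_gt0 e0 B1)) k)) => j [/= a b].
move: a; rewrite ltr_pdivlMr // => a; rewrite NM; apply: le_lt_trans a.
by rewrite ler_wpM2l ?N_ge0 //; lra.
Qed.

Lemma ucvM x y l m : ucv x l -> ucv y m -> ucv (fun j => x j * y j) (l * m).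
Proof.
move=> h k; have h0 : ucv (fun j => x j - l) 0.
  by have := ucvB h (ucv_cst l); rewrite subrr.
have := ucvD (ucv0M h0 (ucv_bd k)) (ucvMl l k); rewrite add0r.
by apply: ucv_ext; apply: UF_all => j /=; ring.
Qed.

Lemma ucvX x l n : ucv x l -> ucv (fun j => x j ^+ n) (l ^+ n).
Proof.
move=> h; elim: n => [|n IH]; first by rewrite expr0; exact: ucv_cst.
rewrite exprS; apply: ucv_ext (ucvM h IH).
by apply: UF_all => j /=; rewrite exprS.
Qed.

Lemma ucv_le x l B : ucv x l -> UF [set j | N (x j) <= B] -> N l <= B.
Proof.
move=> h k; apply/ler_addgt0Pr => e e0.
have [j [/= a b]] := UF_ex (UF_I (h _ e0) k).
have := ND (l - x j) (x j); rewrite subrK NC => /le_trans; apply.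
by rewrite addrC lerD // ltW.
Qed.

Lemma ucvV x l : l != 0 -> ucv x l -> ucv (fun j => (x j)^-1) l^-1.
Proof.
move=> l0 h; have Nl : 0 < N l by rewrite N_gt0.
have k : UF [set j | N l / 2 <= N (x j)].
  have := h (N l / 2); rewrite divr_gt0 // => /(_ isT); apply: UF_S => j /= a.
  by have := NB_ge l (l - x j); rewrite subKr (NC l); lra.
have h0 : ucv (fun j => l - x j) 0.
  by have := ucvB (ucv_cst l) h; rewrite subrr.
have k2 : UF [set j | N ((x j)^-1 / l) <= (N l / 2)^-1 / N l].
  apply: (UF_S _ k) => j /= a; rewrite NM !NV ler_wpM2r ?invr_ge0 ?N_ge0 //.
  by rewrite lef_pV2 ?posrE //; [apply: lt_le_trans a|]; rewrite divr_gt0.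
have := ucvD (ucv0M h0 k2) (ucv_cst l^-1); rewrite add0r; apply: ucv_ext.
apply: (UF_S _ k) => j /= a; have x0 : x j != 0.
  by rewrite -N_gt0; apply: lt_le_trans a; rewrite divr_gt0.
by field; rewrite x0.
Qed.

Lemma geometric_cv (x : nat -> C) (c : R) :
  (forall i, N (x i.+1 - x i) <= c / 2 ^+ i) ->
  forall i, N (ulim x - x i) <= c *+ 2 / 2 ^+ i.
Proof.
move=> h; have c0 : 0 <= c.
  by have := h 0%N; rewrite expr0 divr1; apply: le_trans; rewrite N_ge0.
(* The bound keeps the remaining tail of the geometric series as a negative term, which is what lets
   the induction on m close. *)
have key i m : N (x (i + m)%N - x i) <= c *+ 2 / 2 ^+ i - c *+ 2 / 2 ^+ (i + m).
  elim: m => [|m IH]; first by rewrite addn0 !subrr N0.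
  rewrite addnS; apply: le_trans (ND3 (x (i + m)%N) _ _) _.
  have := h (i + m)%N; rewrite exprS invfM; set t := _^-1 in IH *; set s := _^-1 in IH *.
  have -> : c *+ 2 * (2^-1 * s) = c * s by rewrite mulr2n; field.
  by move: IH; rewrite !mulr2n !mulrDl; lra.
have bd i m : N (x (i + m)%N - x i) <= c *+ 2 / 2 ^+ i.
  apply: le_trans (key i m) _; rewrite gerBl divr_ge0 ?mulrn_wge0 //.
have cvx : ucv x (ulim x).
  apply: (@ulimP _ (N (x 0%N) + c *+ 2)); apply: UF_all => j /=.
  have := bd 0%N j; rewrite expr0 divr1 add0n => k.
  by have := ND (x j - x 0%N) (x 0%N); rewrite subrK; lra.
move=> i; apply: (@ucv_le (fun j => x j - x i)).
  exact: ucvB cvx (ucv_cst _).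
apply: (UF_S _ (UF_ge i)) => j /= ij; by have := bd i (j - i)%N; rewrite subnKC.
Qed.

End UltraLimit.

(** * The complex derivative *)

Section Differentiation.
Variable R : realType.
Local Notation C := R[i].
Local Notation N := (@normc R).
Implicit Types (f g : C -> C) (z w l a b c : C).

(** Differential calculus is done on increments h with explicit real radii. [derivableP] and
    [derive1_der] identify it with the filter notions at the end. *)
Definition near0 (P : C -> Prop) := exists2 d : R, 0 < d & forall h, N h < d -> P h.

Lemma near0T (P : C -> Prop) : (forall h, P h) -> near0 P.
Proof. by move=> h; exists 1. Qed.

Lemma near0I (P Q : C -> Prop) : near0 P -> near0 Q -> near0 (fun h => P h /\ Q h).
Proof.
move=> [d d0 h] [e e0 k]; exists (Num.min d e); first by rewrite lt_min d0.
by move=> x; rewrite lt_min => /andP[/h ? /k].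
Qed.

Lemma near0S (P Q : C -> Prop) : (forall h, P h -> Q h) -> near0 P -> near0 Q.
Proof. by move=> k [d d0 h]; exists d => // x /h /k. Qed.

Definition littleo (r : C -> C) :=
  forall e : R, 0 < e -> near0 (fun h => N (r h) <= e * N h).

Lemma littleoD r s : littleo r -> littleo s -> littleo (fun h => r h + s h).
Proof.
move=> hr hs e e0; have e2 : 0 < e / 2 by rewrite divr_gt0.
apply: near0S (near0I (hr _ e2) (hs _ e2)) => h [a b].
by apply: le_trans (ND _ _) _; have := lerD a b; rewrite -mulrDl -splitr.
Qed.

Lemma littleoM r (b : C -> C) (B : R) : near0 (fun h => N (b h) <= B) -> littleo r ->
  littleo (fun h => b h * r h).
Proof.
move=> hb hr e e0.
have B0 : 0 <= B by case: hb => d d0 /(_ 0); rewrite N0 => /(_ d0); apply: le_trans; rewrite N_ge0.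
have B1 : 0 < B + 1 by lra.
apply: near0S (near0I hb (hr _ (divr_gt0 e0 B1))) => h [x y].
rewrite NM; apply: (@le_trans _ _ (B * (e / (B + 1) * N h))).
  by apply: ler_pM => //; exact: N_ge0.
rewrite mulrA ler_wpM2r ?N_ge0 // mulrA ler_pdivrMr //; nra.
Qed.

Lemma littleoMl c r : littleo r -> littleo (fun h => c * r h).
Proof. by apply: (@littleoM _ (fun=> c) (N c)); exact: near0T. Qed.

Lemma littleo_ext r s : near0 (fun h => r h = s h) -> littleo r -> littleo s.
Proof. by move=> h k e e0; apply: near0S (near0I h (k e e0)) => x [<-]. Qed.

Lemma littleo_quad r (B : R) : near0 (fun h => N (r h) <= B * N h ^+ 2) -> littleo r.
Proof.
move=> hr e e0.
have B0 : 0 < `|B| + 1 by have := normr_ge0 B; lra.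
have h1 : near0 (fun h => N h < e / (`|B| + 1)) by exists (e / (`|B| + 1)); rewrite ?divr_gt0.
apply: near0S (near0I hr h1) => h [x]; rewrite ltr_pdivlMr // => y.
apply: le_trans x _; rewrite expr2 mulrA ler_wpM2r ?N_ge0 //.
apply: le_trans _ (ltW y); rewrite mulrC ler_wpM2l ?N_ge0 //.
by apply: le_trans (ler_norm _) _; lra.
Qed.

Definition cderiv f z l := littleo (fun h => f (z + h) - f z - l * h).
Definition cdiff f z := exists l, cderiv f z l.
Definition der f z : C := xget 0 [set l | cderiv f z l].
Definition ccont f z := forall e : R, 0 < e -> near0 (fun h => N (f (z + h) - f z) < e).

Lemma cderiv_unique f z l m : cderiv f z l -> cderiv f z m -> l = m.
Proof.
move=> hl hm; apply/eqP; rewrite -subr_eq0; apply/eqP; apply: N_small => e e0.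
have e2 : 0 < e / 2 by rewrite divr_gt0.
case: (near0I (hl _ e2) (hm _ e2)) => d d0 k.
pose h : C := (d / 2)%:C; have Nh : N h = d / 2 by rewrite Nr gtr0_norm ?divr_gt0.
have [x y] : _ /\ _ := k h ltac:(rewrite Nh; lra).
have h0 : 0 < N h by rewrite Nh divr_gt0.
rewrite -(ler_pM2r h0) -NM.
rewrite (_ : (l - m) * h = (f (z + h) - f z - m * h) - (f (z + h) - f z - l * h)); last by ring.
by apply: le_trans (NB _ _) _; have := lerD x y; rewrite -mulrDl -splitr addrC.
Qed.

Lemma derE f z l : cderiv f z l -> der f z = l.
Proof.
by move=> h; rewrite /der; case: xgetP => [y _ hy|/(_ l)] //; exact: cderiv_unique hy h.
Qed.

Lemma derP f z : cdiff f z -> cderiv f z (der f z).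
Proof. by move=> [l h]; rewrite (derE h). Qed.

Lemma cderiv_diff f z l : cderiv f z l -> cdiff f z.
Proof. by exists l. Qed.

Lemma cderiv_ext f g z l : near0 (fun h => f (z + h) = g (z + h)) ->
  cderiv f z l -> cderiv g z l.
Proof.
move=> h; apply: littleo_ext.
have fg : f z = g z by case: h => d d0 /(_ 0); rewrite N0 addr0; apply.
by apply: near0S h => x ->; rewrite fg.
Qed.

Lemma cderiv_lip f z l : cderiv f z l ->
  near0 (fun h => N (f (z + h) - f z) <= (N l + 1) * N h).
Proof.
move=> /(_ 1 ltr01); apply: near0S => h; rewrite mul1r => k.
by have := ND (f (z + h) - f z - l * h) (l * h); rewrite subrK NM; lra.
Qed.

Lemma cderiv_cont f z l : cderiv f z l -> ccont f z.
Proof.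
move=> /cderiv_lip h e e0; have l0 : 0 < N l + 1 by have := N_ge0 l; lra.
have h1 : near0 (fun h => N h < e / (N l + 1)) by exists (e / (N l + 1)); rewrite ?divr_gt0.
apply: near0S (near0I h h1) => x [k]; rewrite ltr_pdivlMr // mulrC.
exact: le_lt_trans.
Qed.

Lemma cdiff_cont f z : cdiff f z -> ccont f z.
Proof. by move=> [l]; exact: cderiv_cont. Qed.

Lemma ccont_bd f z : ccont f z -> near0 (fun h => N (f (z + h)) <= N (f z) + 1).
Proof.
move=> /(_ 1 ltr01); apply: near0S => h k.
by have := ND (f (z + h) - f z) (f z); rewrite subrK; lra.
Qed.

Lemma ccont_neq0 f z : ccont f z -> f z != 0 ->
  near0 (fun h => N (f z) / 2 <= N (f (z + h)) /\ f (z + h) != 0).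
Proof.
move=> h fz; have k : 0 < N (f z) by rewrite N_gt0.
apply: near0S (h _ (divr_gt0 k (@ltr0n _ 2))) => x /= a.
have b : N (f z) / 2 <= N (f (z + x)).
  by have := NB_ge (f z) (f z - f (z + x)); rewrite subKr (NC (f z)); lra.
by split=> //; rewrite -N_gt0; apply: lt_le_trans b; rewrite divr_gt0.
Qed.

Lemma cderiv_cst c z : cderiv (fun=> c) z 0.
Proof. by move=> e e0; apply: near0T => h; rewrite subrr mul0r subrr N0 mulr_ge0 ?N_ge0 // ltW. Qed.

Lemma cderiv_id z : cderiv (fun x => x) z 1.
Proof.
move=> e e0; apply: near0T => h; rewrite mul1r (addrC z) addrK subrr N0.
by rewrite mulr_ge0 ?N_ge0 // ltW.
Qed.

Lemma cderivD f g z l m : cderiv f z l -> cderiv g z m ->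
  cderiv (fun x => f x + g x) z (l + m).
Proof.
move=> h k; apply: littleo_ext (littleoD h k).
by apply: near0T => x; ring.
Qed.

Lemma cderivMl c f z l : cderiv f z l -> cderiv (fun x => c * f x) z (c * l).
Proof.
by move=> h; apply: littleo_ext (littleoMl c h); apply: near0T => x; ring.
Qed.

Lemma cderivN f z l : cderiv f z l -> cderiv (fun x => - f x) z (- l).
Proof.
by move=> h; apply: littleo_ext (littleoMl (-1) h); apply: near0T => x; ring.
Qed.

Lemma cderivB f g z l m : cderiv f z l -> cderiv g z m ->
  cderiv (fun x => f x - g x) z (l - m).
Proof. by move=> h /cderivN; exact: cderivD. Qed.

Lemma cderiv_eq f z l m : cderiv f z l -> l = m -> cderiv f z m.
Proof. by move=> h <-. Qed.

Lemma cderivM f g z l m : cderiv f z l -> cderiv g z m ->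
  cderiv (fun x => f x * g x) z (l * g z + f z * m).
Proof.
move=> hf hg.
have h1 := littleoM (ccont_bd (cderiv_cont hg)) hf.
have h2 := littleoMl (f z) hg.
have h3 : littleo (fun h => (l * h) * (g (z + h) - g z)).
  apply: (@littleo_quad _ (N l * (N m + 1))).
  apply: near0S (cderiv_lip hg) => h k; rewrite !NM expr2.
  rewrite (_ : _ * _ * (_ * _) = N l * N h * ((N m + 1) * N h)); last by ring.
  by rewrite ler_wpM2l ?mulr_ge0 ?N_ge0.
apply: littleo_ext (littleoD (littleoD h1 h2) h3); apply: near0T => x; ring.
Qed.

Lemma cderivX f z l n : cderiv f z l ->
  cderiv (fun x => f x ^+ n) z (n%:R * f z ^+ n.-1 * l).
Proof.
move=> h; elim: n => [|n IH].
  by apply: cderiv_eq (cderiv_cst 1 z) _; rewrite mul0r mul0r.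
have k := cderivM h IH.
apply: (@cderiv_ext (fun x => f x * f x ^+ n)); first by apply: near0T => x; rewrite exprS.
apply: cderiv_eq k _; rewrite /=; case: n {IH} => [|n] /=; rewrite ?expr0 ?mul0r ?mulr0; first by ring.
by rewrite -(@natr1 _ n.+1) exprS; ring.
Qed.

Lemma cderivV f z l : f z != 0 -> cderiv f z l ->
  cderiv (fun x => (f x)^-1) z (- l / f z ^+ 2).
Proof.
move=> fz h; have nz := ccont_neq0 (cderiv_cont h) fz.
set q : C -> C := fun x => (f x)^-1.
have a0 : 0 < N (f z) by rewrite N_gt0.
have bq : near0 (fun h => N (- (f (z + h))^-1 / f z) <= (N (f z) / 2)^-1 / N (f z)).
  apply: near0S nz => x [k1 k2]; rewrite NM NN !NV ler_wpM2r ?invr_ge0 ?N_ge0 //.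
  by rewrite lef_pV2 ?posrE ?divr_gt0 // N_gt0.
have h1 := littleoM bq h.
have h2 : littleo (fun h => (l * h) * ((f (z + h) - f z) * ((f (z + h))^-1 / f z ^+ 2))).
  set B := (N (f z) / 2)^-1 / N (f z) ^+ 2.
  apply: (@littleo_quad _ (N l * ((N l + 1) * B))).
  apply: near0S (near0I nz (cderiv_lip h)) => x [[k1 k2] k3]; rewrite !NM expr2.
  rewrite (_ : N l * (_ * B) * _ = N l * N x * (((N l + 1) * N x) * B)); last by ring.
  rewrite ler_wpM2l ?mulr_ge0 ?N_ge0 //; apply: ler_pM; rewrite ?mulr_ge0 ?N_ge0 //.
  rewrite /B !NV NM -expr2 ler_wpM2r ?invr_ge0 ?exprn_ge0 ?N_ge0 //.
  by rewrite lef_pV2 ?posrE ?divr_gt0 // N_gt0.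
apply: littleo_ext (littleoD h1 h2); apply: near0S nz => x [_ k].
by rewrite /q; field; rewrite k fz.
Qed.

Lemma cderiv_comp f g z l m : cderiv g z m -> cderiv f (g z) l ->
  cderiv (fun x => f (g x)) z (l * m).
Proof.
move=> hg hf e e0.
have m0 : 0 < N m + 1 by have := N_ge0 m; lra.
have l0 : 0 < N l + 1 by have := N_ge0 l; lra.
have e1 : 0 < e / 2 / (N m + 1) by rewrite !divr_gt0.
have e2 : 0 < e / 2 / (N l + 1) by rewrite !divr_gt0.
case: (hf _ e1) => d d0 kf.
apply: near0S (near0I (cderiv_cont hg d0) (near0I (hg _ e2) (cderiv_lip hg))) => h [h1 [h2 h3]].
have := kf _ h1; rewrite [g z + _]addrC subrK => h4.
rewrite (_ : _ - _ = (f (g (z + h)) - f (g z) - l * (g (z + h) - g z)) +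
   l * (g (z + h) - g z - m * h)); last by ring.
apply: le_trans (ND _ _) _; rewrite NM.
rewrite [e]splitr mulrDl; apply: lerD.
  apply: le_trans h4 _; rewrite -mulrA ler_pM2l ?divr_gt0 //.
  by rewrite mulrC ler_pdivrMr // mulrC.
apply: (@le_trans _ _ ((N l + 1) * (e / 2 / (N l + 1) * N h))).
  by apply: ler_pM; rewrite ?N_ge0 //; lra.
by rewrite mulrA mulrCA divff ?mulr1 // gt_eqF.
Qed.

Lemma cderiv_affine f a b z l : cderiv f (a + b * z) l ->
  cderiv (fun x => f (a + b * x)) z (l * b).
Proof.
move=> h; apply: (@cderiv_comp f (fun x => a + b * x)) => //.
have := cderivD (cderiv_cst a z) (cderivMl b (cderiv_id z)).
by rewrite add0r mulr1.
Qed.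

Lemma cderiv_sum (I : Type) (s : seq I) (F : I -> C -> C) z (L : I -> C) :
  (forall i, cderiv (F i) z (L i)) ->
  cderiv (fun x => \sum_(i <- s) F i x) z (\sum_(i <- s) L i).
Proof.
move=> h; elim: s => [|i s IH].
  rewrite big_nil; apply: cderiv_ext (cderiv_cst 0 z).
  by apply: near0T => x; rewrite big_nil.
rewrite big_cons; apply: cderiv_ext (cderivD (h i) IH).
by apply: near0T => x; rewrite big_cons.
Qed.

Lemma cdiffD f g z : cdiff f z -> cdiff g z -> cdiff (fun x => f x + g x) z.
Proof. by move=> [l h] [m k]; exists (l + m); exact: cderivD. Qed.
Lemma cdiffB f g z : cdiff f z -> cdiff g z -> cdiff (fun x => f x - g x) z.
Proof. by move=> [l h] [m k]; exists (l - m); exact: cderivB. Qed.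
Lemma cdiffM f g z : cdiff f z -> cdiff g z -> cdiff (fun x => f x * g x) z.
Proof. by move=> [l h] [m k]; exists (l * g z + f z * m); exact: cderivM. Qed.
Lemma cdiffV f z : f z != 0 -> cdiff f z -> cdiff (fun x => (f x)^-1) z.
Proof. by move=> k [l h]; exists (- l / f z ^+ 2); exact: cderivV. Qed.
Lemma cdiffX f z n : cdiff f z -> cdiff (fun x => f x ^+ n) z.
Proof. by move=> [l h]; eexists; exact: cderivX h. Qed.
Lemma cdiff_cst c z : cdiff (fun=> c) z.
Proof. by exists 0; exact: cderiv_cst. Qed.
Lemma cdiff_id z : cdiff (fun x => x) z.
Proof. by exists 1; exact: cderiv_id. Qed.
Lemma cdiff_ext f g z : near0 (fun h => f (z + h) = g (z + h)) -> cdiff f z -> cdiff g z.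
Proof. by move=> h [l k]; exists l; exact: cderiv_ext h k. Qed.
Lemma der_ext f g z : near0 (fun h => f (z + h) = g (z + h)) -> der f z = der g z.
Proof.
move=> h; rewrite /der; congr xget; apply/seteqP; split => l /=.
  exact: cderiv_ext h.
by apply: cderiv_ext; apply: near0S h.
Qed.

Lemma near0_ball (P : C -> Prop) a z (r : R) : N (z - a) < r ->
  (forall w, N (w - a) < r -> P w) -> near0 (fun h => P (z + h)).
Proof.
move=> za h; exists (r - N (z - a)); first by rewrite subr_gt0.
move=> x xl; apply: h; rewrite (_ : z + x - a = (z - a) + x); last by ring.
by apply: le_lt_trans (ND _ _) _; lra.
Qed.

(** The left ends s i increase and the right ends s i + 2^-i decrease, so each left end is below
    each right end and the supremum of the left ends lies in all intervals. *)
Lemma nested_intervals (s : nat -> R) :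
  (forall i, s i <= s i.+1 <= s i + (2 ^+ i.+1)^-1) ->
  exists p, forall i, s i <= p <= s i + (2 ^+ i)^-1.
Proof.
move=> h.
have key i m : s i <= s (i + m)%N <= s i + ((2 ^+ i)^-1 - (2 ^+ (i + m))^-1).
  elim: m => [|m IH]; first by rewrite addn0 subrr addr0 lexx.
  rewrite addnS; have := h (i + m)%N; rewrite exprS invfM.
  by move: IH; set t := (2 ^+ (i + m))^-1; lra.
have key2 i j : s j <= s i + (2 ^+ i)^-1.
  have p2 k : (0 : R) <= (2 ^+ k)^-1 by rewrite invr_ge0 exprn_ge0.
  have [ij|/ltnW ji] := leqP i j.
    have := key i (j - i)%N; rewrite subnKC // => /andP[_ k].
    by apply: le_trans k _; rewrite lerD2l gerBl.
  have := key j (i - j)%N; rewrite subnKC // => /andP[k _].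
  by apply: le_trans k _; rewrite lerDl.
have bs : has_sup (range s).
  split; first by exists (s 0%N), 0%N.
  by exists (s 0%N + (2 ^+ 0)^-1) => _ [j _ <-].
exists (sup (range s)) => i; apply/andP; split.
  by apply: (ub_le_sup bs.2); exists i.
by apply: ge_sup => [|_ [j _ <-] //]; exact: bs.1.
Qed.

(* Bisection: if the increment is too large on a segment, it is on one half. *)
Lemma mean_value f a b (K : R) :
  (forall t : R, 0 <= t <= 1 ->
     exists2 l, cderiv f (a + t%:C * (b - a)) l & N l <= K) ->
  N (f b - f a) <= K * N (b - a).
Proof.
move=> hd; rewrite leNgt; apply/negP => bad.
have ab : 0 < N (b - a).
  rewrite N_gt0 subr_eq0; apply/eqP => e; move: bad; rewrite e !subrr N0 mulr0 ltxx //.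
(* A slope strictly above K, so that differentiability at the limit point of the bisection, used
   with error (K' - K) / 2, contradicts it. *)
have [K' [KK' bad']] : exists K' : R, K < K' /\ K' * N (b - a) <= N (f b - f a).
  exists (N (f b - f a) / N (b - a)); split; first by rewrite ltr_pdivlMr.
  by rewrite divfK // gt_eqF.
pose ga (t : R) : C := a + t%:C * (b - a).
pose P s i := K' * N (b - a) / 2 ^+ i <= N (f (ga (s + (2 ^+ i)^-1)) - f (ga s)).
have half s i : P s i -> P s i.+1 \/ P (s + (2 ^+ i.+1)^-1) i.+1.
  move=> p; case: (pselect (P s i.+1)) => [|np]; first by left.
  right; move: np p; rewrite /P; set m := s + (2 ^+ i.+1)^-1.
  have -> : s + (2 ^+ i)^-1 = m + (2 ^+ i.+1)^-1.
    by rewrite /m exprS invfM; field.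
  move=> /negP; rewrite -ltNge => h1 h2.
  have := ND3 (f (ga m)) (f (ga s)) (f (ga (m + (2 ^+ i.+1)^-1))).
  move: h1 h2; rewrite exprS invfM; set t := (2 ^+ i)^-1; lra.
pose s := fix s i : R := if i is j.+1 then
  (if `[< P (s j) j.+1 >] then s j else s j + (2 ^+ j.+1)^-1) else 0.
have p2 k : (0 : R) < (2 ^+ k)^-1 by rewrite invr_gt0 exprn_gt0.
have Ps i : P (s i) i.
  elim: i => [|i IH] /=.
    by rewrite /P expr0 invr1 mulr1 add0r /ga rmorph1 mul1r rmorph0 mul0r addr0 [a + _]addrC subrK.
  by case: asboolP => // np; case: (half _ _ IH).
have [i|p hp] := @nested_intervals s.
  rewrite /=; case: asboolP => _; first by rewrite lexx lerDl ltW.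
  by rewrite lexx lerDl ltW.
have p01 : 0 <= p <= 1 by have := hp 0%N; rewrite /= expr0 invr1 add0r.
have [l hl lK] := hd _ p01.
have e0 : 0 < (K' - K) / 2 by rewrite divr_gt0 // subr_gt0.
case: (hl _ e0) => d d0 kd.
have [i hi] : exists i : nat, (2 ^+ i)^-1 * N (b - a) < d.
  have [i hi] : exists i : nat, N (b - a) / d < i%:R.
    by exists (Num.bound (N (b - a) / d)); apply: archi_boundP; rewrite divr_ge0 ?N_ge0 // ltW.
  exists i; rewrite mulrC ltr_pdivrMr ?exprn_gt0 //; move: hi; rewrite ltr_pdivrMr // => hi.
  apply: lt_le_trans hi _; rewrite mulrC ler_pM2l //.
  by rewrite -natrX ler_nat ltnW // ltn_expl.
have gap (t : R) : ga t = ga p + (t - p)%:C * (b - a).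
  by rewrite /ga rmorphB; ring.
have step (t : R) : `|t - p| <= (2 ^+ i)^-1 ->
    N (f (ga t) - f (ga p) - l * ((t - p)%:C * (b - a))) <= (K' - K) / 2 * (`|t - p| * N (b - a)).
  move=> ht; rewrite gap -Nr -NM; apply: kd.
  by rewrite NM Nr; apply: le_lt_trans hi; rewrite ler_wpM2r ?N_ge0.
have /andP[hp1 hp2] := hp i.
have a1 : `|s i - p| = p - s i by rewrite distrC ger0_norm // subr_ge0.
have a2 : `|s i + (2 ^+ i)^-1 - p| = s i + (2 ^+ i)^-1 - p by rewrite ger0_norm // subr_ge0.
have s1 := step (s i) ltac:(rewrite a1; lra).
have s2 := step (s i + (2 ^+ i)^-1) ltac:(rewrite a2; lra).
have := Ps i; rewrite /P => s3.
set x1 := f (ga (s i)) in s1 s3; set x2 := f (ga (s i + _)) in s2 s3; set x := f (ga p) in s1 s2.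
have := ND (x2 - x1 - l * ((2 ^+ i)^-1%:C * (b - a))) (l * ((2 ^+ i)^-1%:C * (b - a))).
rewrite subrK [N (l * _)]NM NM Nr (gtr0_norm (p2 i)).
(* The two ends of the i-th interval lie on opposite sides of p, so their distances to p add up to
   2^-i and so do the weights of the two errors. *)
have : N (x2 - x1 - l * ((2 ^+ i)^-1%:C * (b - a))) <= (K' - K) / 2 * ((2 ^+ i)^-1 * N (b - a)).
  rewrite (_ : x2 - x1 - _ = (x2 - x - l * ((s i + (2 ^+ i)^-1 - p)%:C * (b - a)))
    - (x1 - x - l * ((s i - p)%:C * (b - a)))); last by rewrite !rmorphB !rmorphD; ring.
  apply: le_trans (NB _ _) _; apply: le_trans (lerD s2 s1) _.
  by rewrite a1 a2 -mulrDr -mulrDl (_ : s i + _ - p + _ = (2 ^+ i)^-1) //; ring.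
have : N l * ((2 ^+ i)^-1 * N (b - a)) <= K * ((2 ^+ i)^-1 * N (b - a)).
  by rewrite ler_wpM2r // mulr_ge0 ?N_ge0 // ltW.
have : 0 < (K' - K) * ((2 ^+ i)^-1 * N (b - a)) by rewrite !mulr_gt0 // subr_gt0.
move: s3; rewrite (_ : K' * N (b - a) / 2 ^+ i = K' * ((2 ^+ i)^-1 * N (b - a))); last by ring.
by set u := (2 ^+ i)^-1 * N (b - a); lra.
Qed.

End Differentiation.

(** * Goursat's theorem *)

Arguments normc : simpl never.

Section Goursat.
Variable R : realType.
Local Notation C := R[i].
Local Notation N := (@normc R).
Implicit Types (f g : C -> C) (z w l a b c x y p h : C).

Definition mid a b : C := (a + b) / 2.

(** Midpoint convexity is enough because trapezoidal sums evaluate f only at points reached from the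
    ends by repeated midpoints. *)
Definition mconvex (Q : C -> Prop) := forall a b, Q a -> Q b -> Q (mid a b).

Lemma mconvex_ball c (r : R) : mconvex (fun z => N (z - c) <= r).
Proof.
move=> a b ha hb; rewrite (_ : mid a b - c = ((a - c) + (b - c)) / 2); last first.
  by rewrite /mid; field.
rewrite Nf Nnat ler_pdivrMr //; apply: le_trans (ND _ _) _; lra.
Qed.

Lemma mid_l a b : N (mid a b - a) = N (b - a) / 2.
Proof. by rewrite (_ : mid a b - a = (b - a) / 2) ?Nf ?Nnat // /mid; field. Qed.
Lemma mid_r a b : N (b - mid a b) = N (b - a) / 2.
Proof. by rewrite (_ : b - mid a b = (b - a) / 2) ?Nf ?Nnat // /mid; field. Qed.
Lemma midC a b : mid a b = mid b a.
Proof. by rewrite /mid addrC. Qed.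

(* Trapezoidal sums of f dz along the segment from a to b: they are
   antisymmetric in the end points and exact for affine functions. *)
Fixpoint trap f i a b : C :=
  if i is j.+1 then trap f j a (mid a b) + trap f j (mid a b) b
  else (b - a) * ((f a + f b) / 2).

Definition lint f a b : C := ulim (fun i => trap f i a b).
Arguments lint : simpl never.

Lemma trap_anti f i a b : trap f i b a = - trap f i a b.
Proof.
elim: i a b => [|i IH] a b /=; first by field.
by rewrite (midC b a) (IH (mid a b) a) (IH b (mid a b)); ring.
Qed.

Lemma trapB f g i a b :
  trap (fun z => f z - g z) i a b = trap f i a b - trap g i a b.
Proof. by elim: i a b => [|i IH] a b /=; [field|rewrite !IH; ring]. Qed.

Lemma trap_affine (al be : C) i a b :
  trap (fun z => al * z + be) i a b = al * (b ^+ 2 - a ^+ 2) / 2 + be * (b - a).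
Proof. by elim: i a b => [|i IH] a b /=; [field|rewrite !IH /mid; field]. Qed.

Lemma trap_bd f (Q : C -> Prop) (M : R) i a b : mconvex Q ->
  (forall z, Q z -> N (f z) <= M) -> Q a -> Q b -> N (trap f i a b) <= M * N (b - a).
Proof.
move=> cQ hM; elim: i a b => [|i IH] a b qa qb /=.
  rewrite NM mulrC ler_wpM2r ?N_ge0 // Nf Nnat ler_pdivrMr //.
  by apply: le_trans (ND _ _) _; have := hM _ qa; have := hM _ qb; lra.
have qm := cQ _ _ qa qb; apply: le_trans (ND _ _) _.
have := lerD (IH _ _ qa qm) (IH _ _ qm qb).
by rewrite mid_l mid_r -mulrDr -splitr.
Qed.

(** Inserting the midpoint m in an elementary trapezoid changes it by a combination of f m - f a and
    f m - f b, so a refinement costs the oscillation of f at the current mesh. *)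
Lemma trap_step f (Q : C -> Prop) (e : R) i a b : mconvex Q -> Q a -> Q b ->
  (forall x y, Q x -> Q y -> N (x - y) <= N (b - a) / 2 ^+ i -> N (f x - f y) <= e) ->
  N (trap f i.+1 a b - trap f i a b) <= e * N (b - a).
Proof.
move=> cQ; elim: i a b => [|i IH] a b qa qb hf; have qm := cQ _ _ qa qb.
  rewrite /= (_ : _ - _ = (b - a) * ((f (mid a b) - f a) / 2 / 2 + (f (mid a b) - f b) / 2 / 2)).
    rewrite NM mulrC ler_wpM2r ?N_ge0 //; apply: le_trans (ND _ _) _; rewrite !Nf !Nnat.
    have h1 : N (f (mid a b) - f a) <= e.
      by apply: hf => //; rewrite expr0 divr1 mid_l ler_piMr ?N_ge0 //; lra.
    have h2 : N (f (mid a b) - f b) <= e.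
      by apply: hf => //; rewrite expr0 divr1 NC mid_r ler_piMr ?N_ge0 //; lra.
    have : 0 <= e by apply: le_trans h1; exact: N_ge0.
    lra.
  by rewrite /mid; field.
rewrite (_ : _ - _ = (trap f i.+1 a (mid a b) - trap f i a (mid a b)) +
   (trap f i.+1 (mid a b) b - trap f i (mid a b) b)); last by rewrite /=; ring.
apply: le_trans (ND _ _) _.
have h1 := IH _ _ qa qm; have h2 := IH _ _ qm qb.
rewrite [e * _](_ : _ = e * N (mid a b - a) + e * N (b - mid a b)); last first.
  by rewrite mid_l mid_r -mulrDr -splitr.
have E : N (b - a) / 2 ^+ i.+1 = N (b - a) / 2 / 2 ^+ i by rewrite exprS invfM mulrA.
by apply: lerD; [apply: h1|apply: h2] => x y qx qy; rewrite ?mid_l ?mid_r -E; exact: hf.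
Qed.

Lemma UF_inv (d : R) : 0 < d -> UF [set j : nat | (j.+1%:R)^-1 < d].
Proof.
move=> d0; apply: UF_S (UF_ge (Num.bound d^-1)) => j /= hj.
rewrite -[d]invrK ltf_pV2 ?posrE ?invr_gt0 //.
have h : d^-1 < (Num.bound d^-1)%:R by apply: archi_boundP; rewrite invr_ge0 ltW.
by apply: lt_le_trans h _; rewrite ler_nat ltnW.
Qed.

(** By contradiction: bad pairs at distance below 1 / (j + 1) have one common ultralimit p in the
    closed disc, and continuity at p separates their values by less than e. *)
Lemma heine f c (r : R) : (forall z, N (z - c) <= r -> ccont f z) ->
  forall e : R, 0 < e -> exists2 d : R, 0 < d &
    forall x y, N (x - c) <= r -> N (y - c) <= r -> N (x - y) < d -> N (f x - f y) < e.
Proof.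
move=> hf e e0; apply: contrapT => H.
have /choice[xy hxy] : forall j : nat, exists xy : C * C,
    [/\ N (xy.1 - c) <= r, N (xy.2 - c) <= r, N (xy.1 - xy.2) < j.+1%:R^-1
      & e <= N (f xy.1 - f xy.2)].
  move=> j; apply: contrapT => K; apply: H; exists (j.+1%:R^-1); first by rewrite invr_gt0.
  move=> x y hx hy xy; rewrite ltNge; apply/negP => h; apply: K.
  by exists (x, y).
pose x j := (xy j).1; pose y j := (xy j).2.
have cx : ucv x (ulim x).
  apply: (@ulimP _ _ (r + N c)); apply: UF_all => j /=; have [h _ _ _] := hxy j.
  by have := ND (x j - c) c; rewrite subrK; rewrite /x; lra.
set p := ulim x in cx.
have pr : N (p - c) <= r.
  apply: (@ucv_le _ (fun j => x j - c)); first exact: ucvB cx (@ucv_cst _ c).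
  by apply: UF_all => j /=; have [] := hxy j.
have e2 : 0 < e / 2 by rewrite divr_gt0.
have [d d0 hd] := hf _ pr _ e2.
have d2 : 0 < d / 2 by rewrite divr_gt0.
have [j [/= h1 h2]] := UF_ex (UF_I (cx _ d2) (UF_inv d2)).
have [_ _ h3 h4] := hxy j; rewrite -/(x j) -/(y j) in h3 h4.
have h5 : N (y j - p) < d.
  by apply: le_lt_trans (ND3 (x j) _ _) _; rewrite (NC (y j)); have := lt_trans h3 h2; lra.
have h6 := hd (x j - p) ltac:(lra); have h7 := hd _ h5.
rewrite subrKC in h6; rewrite subrKC in h7.
by have := ND3 (f p) (f (x j)) (f (y j)); rewrite (NC (f p)); have := h4; have := NC (f (x j)) (f (y j)); lra.
Qed.

Lemma lint_anti f a b : ucv (fun i => trap f i a b) (lint f a b) -> lint f b a = - lint f a b.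
Proof.
move=> h; apply: ucv_ulim; apply: ucv_ext (ucvN h).
by apply: UF_all => i /=; rewrite (trap_anti f i a b).
Qed.

(** The trapezoidal rule is exact for al z + be, so the integral sees only the deviation of f from
    that function. Goursat's argument uses it with the first-order expansion of f. *)
Lemma lint_near_affine f (Q : C -> Prop) (al be : C) (M : R) a b : mconvex Q -> Q a -> Q b ->
  (forall z, Q z -> N (f z - (al * z + be)) <= M) ->
  ucv (fun i => trap f i a b) (lint f a b) /\
  N (lint f a b - (al * (b ^+ 2 - a ^+ 2) / 2 + be * (b - a))) <= M * N (b - a).
Proof.
move=> cQ qa qb hM; set A := _ / 2 + _.
have h i : N (trap f i a b - A) <= M * N (b - a).
  by rewrite /A -(trap_affine al be i) -trapB; exact: (trap_bd _ cQ hM qa qb).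
have cv : ucv (fun i => trap f i a b) (lint f a b).
  apply: (@ulimP _ _ (M * N (b - a) + N A)); apply: UF_all => i /=.
  by have := ND (trap f i a b - A) A; rewrite subrK; have := h i; lra.
split=> //; apply: (@ucv_le _ (fun i => trap f i a b - A)).
  exact: ucvB cv (@ucv_cst _ _).
exact: UF_all.
Qed.

Section Ball.
Variables (f : C -> C) (c0 : C) (r : R).
Hypothesis fcont : forall z, N (z - c0) <= r -> ccont f z.
Let Q z := N (z - c0) <= r.
Let cQ : mconvex Q. Proof. exact: mconvex_ball. Qed.

Lemma cont_ball_bd : exists B : R, forall z, Q z -> N (f z) <= B.
Proof.
apply: contrapT => H.
have /choice[x hx] : forall j : nat, exists z, Q z /\ j%:R < N (f z).
  move=> j; apply: contrapT => K; apply: H; exists j%:R => z qz.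
  by rewrite leNgt; apply/negP => h; apply: K; exists z.
have cx : ucv x (ulim x).
  apply: (@ulimP _ _ (r + N c0)); apply: UF_all => j /=; have [h _] := hx j.
  by have := ND (x j - c0) c0; rewrite subrK; rewrite /Q in h; lra.
set p := ulim x in cx.
have pr : N (p - c0) <= r.
  apply: (@ucv_le _ (fun j => x j - c0)); first exact: ucvB cx (@ucv_cst _ c0).
  by apply: UF_all => j /=; have [] := hx j.
have [d d0 hd] := ccont_bd (fcont pr).
have hb : 0 <= N (f p) + 1 by have := N_ge0 (f p); lra.
have [j [/= h1 h2]] := UF_ex (UF_I (cx _ d0) (UF_ge (Num.bound (N (f p) + 1)))).
have := hd _ h1; rewrite subrKC => h3.
have h4 : N (f p) + 1 < j%:R by apply: lt_le_trans (archi_boundP hb) _; rewrite ler_nat.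
by have [_ h5] := hx j; lra.
Qed.

Lemma lint_cv a b : Q a -> Q b -> ucv (fun i => trap f i a b) (lint f a b).
Proof.
move=> qa qb; have [B hB] := cont_ball_bd.
apply: (@ulimP _ _ (B * N (b - a))); apply: UF_all => i /=; exact: trap_bd hB qa qb.
Qed.

Lemma lintC a b : Q a -> Q b -> lint f b a = - lint f a b.
Proof. by move=> qa qb; apply: lint_anti; exact: lint_cv. Qed.

(** Level i + 1 on the whole segment is the sum of levels i on the halves, and by uniform continuity
    consecutive levels have the same limit. Goursat's subdivision needs additivity at midpoints
    only. *)
Lemma lint_mid a b : Q a -> Q b ->
  lint f a b = lint f a (mid a b) + lint f (mid a b) b.
Proof.
move=> qa qb; have qm := cQ qa qb.
apply: ucv_unique (lint_cv qa qb) _.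
have h := ucvD (lint_cv qa qm) (lint_cv qm qb).
have k : ucv (fun i => trap f i.+1 a b - trap f i a b) 0.
  apply/ucv0P => e e0; set L := N (b - a) + 1.
  have L0 : 0 < L by rewrite /L; have := N_ge0 (b - a); lra.
  have [d d0 hd] := heine fcont (divr_gt0 e0 L0).
  apply: UF_S (UF_inv (divr_gt0 d0 L0)) => j /= hj.
  apply: (@le_lt_trans _ _ (e / L * N (b - a))); last first.
    rewrite mulrAC ltr_pdivrMr // ltr_pM2l // /L; lra.
  apply: (trap_step cQ qa qb) => x y qx qy xy; apply: ltW; apply: hd => //; apply: le_lt_trans xy _.
  move: hj; rewrite ltr_pdivlMr // mulrC => hj; apply: le_lt_trans hj.
  apply: ler_pM; rewrite ?N_ge0 ?invr_ge0 ?exprn_ge0 //; first by rewrite /L; lra.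
  by rewrite lef_pV2 ?posrE ?exprn_gt0 // -natrX ler_nat ltn_expl.
have := ucvB h k; rewrite subr0; apply: ucv_ext; apply: UF_all => i /=; ring.
Qed.

Lemma lint_near a b (l : C) (M : R) : Q a -> Q b ->
  (forall z, N (z - a) <= N (b - a) -> N (f z - l) <= M) ->
  N (lint f a b - l * (b - a)) <= M * N (b - a).
Proof.
move=> qa qb h.
have [||z hz|_ k] := @lint_near_affine f (fun z => N (z - a) <= N (b - a)) 0 l M a b
  (@mconvex_ball _ _) => //.
- by rewrite subrr N0 N_ge0.
- by rewrite mul0r add0r; exact: h.
by move: k; rewrite mul0r mul0r add0r.
Qed.

Definition tri (t : C * C * C) : C :=
  lint f t.1.1 t.1.2 + lint f t.1.2 t.2 + lint f t.2 t.1.1.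
Definition perim (t : C * C * C) : R :=
  N (t.1.2 - t.1.1) + N (t.2 - t.1.2) + N (t.1.1 - t.2).
Definition tin (t : C * C * C) := [/\ Q t.1.1, Q t.1.2 & Q t.2].

(** The integrals over the four half-size triangles add up to that over t, the inner edges
    cancelling, so one of them carries at least a quarter of the modulus. The bound on the first
    vertices will make the chain of triangles converge. *)
Lemma tri_half t : tin t -> exists s, [/\ tin s, perim s = perim t / 2,
  N (s.1.1 - t.1.1) <= perim t & N (tri t) / 4 <= N (tri s)].
Proof.
case: t => [[a b] c] [/= qa qb qc].
have qx := cQ qa qb; have qy := cQ qb qc; have qz := cQ qc qa.
set x := mid a b in qx *; set y := mid b c in qy *; set z := mid c a in qz *.
have E : tri (a, b, c) = tri (a, x, z) + tri (x, b, y) + tri (z, y, c) + tri (y, z, x).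
  rewrite /tri /= (lint_mid qa qb) (lint_mid qb qc) (lint_mid qc qa) -/x -/y -/z.
  by rewrite (lintC qx qz) (lintC qx qy) (lintC qy qz); ring.
have hxz : N (z - x) = N (c - b) / 2.
  by rewrite (_ : z - x = (c - b) / 2) ?Nf ?Nnat // /z /x /mid; field.
have hxy : N (y - x) = N (a - c) / 2.
  by rewrite NC (_ : x - y = (a - c) / 2) ?Nf ?Nnat // /x /y /mid; field.
have hyz : N (z - y) = N (b - a) / 2.
  by rewrite NC (_ : y - z = (b - a) / 2) ?Nf ?Nnat // /y /z /mid; field.
have e1 : N (x - a) = N (b - a) / 2 := mid_l _ _.
have e2 : N (b - x) = N (b - a) / 2 := mid_r _ _.
have e3 : N (y - b) = N (c - b) / 2 := mid_l _ _.
have e4 : N (c - y) = N (c - b) / 2 := mid_r _ _.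
have e5 : N (z - c) = N (a - c) / 2 := mid_l _ _.
have e6 : N (a - z) = N (a - c) / 2 := mid_r _ _.
have ge1 := N_ge0 (b - a); have ge2 := N_ge0 (c - b); have ge3 := N_ge0 (a - c).
have : exists s, [/\ tin s, perim s = perim (a, b, c) / 2,
    N (s.1.1 - a) <= perim (a, b, c) & N (tri (a, b, c)) / 4 <= N (tri s)]; last first.
  by case=> s [? ? ? ?]; exists s.
have [h|h1] := leP (N (tri (a, b, c)) / 4) (N (tri (a, x, z))).
  exists (a, x, z); split=> //; rewrite /perim /= ?subrr ?N0.
  - by rewrite e1 hxz e6; lra.
  - by rewrite !addr_ge0.
have [h|h2] := leP (N (tri (a, b, c)) / 4) (N (tri (x, b, y))).
  exists (x, b, y); split=> //; rewrite /perim /=.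
  - by rewrite e2 e3 (NC x) hxy; lra.
  - by rewrite e1; lra.
have [h|h3] := leP (N (tri (a, b, c)) / 4) (N (tri (z, y, c))).
  exists (z, y, c); split=> //; rewrite /perim /=.
  - by rewrite (NC y) hyz e4 e5; lra.
  - by rewrite NC e6; lra.
exists (y, z, x); split=> //; rewrite /perim /=.
- by rewrite hyz (NC x z) hxz hxy; lra.
- apply: le_trans (ND3 x _ _) _; rewrite hxy e1; lra.
rewrite leNgt; apply/negP => h4; have : N (tri (a, b, c)) < N (tri (a, b, c)); last by rewrite ltxx.
rewrite {1}E; apply: le_lt_trans (ND _ _) _.
have := ND (tri (a, x, z) + tri (x, b, y)) (tri (z, y, c)).
have := ND (tri (a, x, z)) (tri (x, b, y)); lra.
Qed.

Hypothesis fdiff : forall z, N (z - c0) <= r -> cdiff f z.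

Lemma goursat a b c : Q a -> Q b -> Q c ->
  lint f a b + lint f b c + lint f c a = 0.
Proof.
move=> qa qb qc; set t0 := (a, b, c).
have -> : lint f a b + lint f b c + lint f c a = tri t0 by [].
apply/eqP/negPn/negP => nz; have eta0 : 0 < N (tri t0) by rewrite N_gt0.
have /choice[st hst] : forall t, exists s, tin t -> [/\ tin s, perim s = perim t / 2,
    N (s.1.1 - t.1.1) <= perim t & N (tri t) / 4 <= N (tri s)].
  move=> t; case: (pselect (tin t)) => h; last by exists t.
  by have [s hs] := tri_half h; exists s.
pose t i := iter i st t0.
have tt i : tin (t i).
  by elim: i => [|i IH] //; rewrite /t iterS; have [] := hst _ IH.
have pt i : perim (t i) = perim t0 / 2 ^+ i.
  elim: i => [|i IH]; first by rewrite expr0 divr1.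
  by rewrite {1}/t iterS; have [_ -> _ _] := hst _ (tt i); rewrite -/(t i) IH exprS invfM; field.
have nt i : N (tri t0) / 4 ^+ i <= N (tri (t i)).
  elim: i => [|i IH]; first by rewrite expr0 divr1.
  rewrite {1}/t iterS; have [_ _ _ h] := hst _ (tt i); apply: le_trans h.
  by rewrite -/(t i) exprS invfM; lra.
pose x i := (t i).1.1.
have := @geometric_cv _ x (perim t0) _; set p := ulim x => hp.
have {}hp i : N (p - x i) <= perim t0 *+ 2 / 2 ^+ i.
  by apply: hp => j; rewrite -pt /x {1}/t iterS; have [] := hst _ (tt j).
have P0 : 0 <= perim t0 by rewrite /perim !addr_ge0 ?N_ge0.
have p2 k : (0 : R) < (2 ^+ k)^-1 by rewrite invr_gt0 exprn_gt0.
have small (d : R) : 0 < d -> exists i : nat, perim t0 *+ 3 / 2 ^+ i < d.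
  move=> d0; have [i hi] : exists i : nat, perim t0 *+ 3 / d < i%:R.
    exists (Num.bound (perim t0 *+ 3 / d)); apply: archi_boundP.
    by rewrite divr_ge0 ?mulrn_wge0 // ltW.
  exists i; rewrite ltr_pdivrMr ?exprn_gt0 //; move: hi; rewrite ltr_pdivrMr // => hi.
  apply: lt_le_trans hi _; rewrite mulrC ler_pM2l //.
  by rewrite -natrX ler_nat ltnW // ltn_expl.
have Qp : Q p.
  apply/ler_addgt0Pr => e e0; have [i hi] := small _ e0.
  apply: le_trans (ND3 (x i) _ _) _; have [h _ _] := tt i; rewrite -/(x i) in h.
  move: (hp i) h; rewrite /Q.
  have : perim t0 *+ 2 / 2 ^+ i <= perim t0 *+ 3 / 2 ^+ i.
    by rewrite ler_pM2r // [in leRHS]mulrSr lerDl.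
  lra.
have [l hl] := fdiff Qp.
(* After i halvings the triangle lies within 3 perim / 2^i of p: 2 from the geometric series leading
   to p, 1 from its own size. Its integral is then at most 3 e perim^2 / 4^i, against the lower
   bound |tri t0| / 4^i; the + 1 makes the contradiction strict. *)
set e := N (tri t0) / (perim t0 * perim t0 *+ 3 + 1).
have D0 : 0 < perim t0 * perim t0 *+ 3 + 1.
  by have := mulr_ge0 P0 P0; rewrite mulrS mulr2n; lra.
have e0 : 0 < e by rewrite /e divr_gt0.
have [d d0 hd] := hl _ e0.
have [i hi] := small _ d0.
set s := t i in nt pt hp *.
set rho := perim t0 *+ 3 / 2 ^+ i in hi.
have near z : N (z - p) <= rho -> N (f z - (l * z + (f p - l * p))) <= e * rho.
  move=> hz; have := hd (z - p) ltac:(lra); rewrite subrKC => k.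
  rewrite (_ : f z - _ = f z - f p - l * (z - p)); last by ring.
  by apply: le_trans k _; rewrite ler_pM2l.
have E3 : rho = perim t0 *+ 2 / 2 ^+ i + perim s by rewrite /s pt /rho mulrSr mulrDl.
have ps : N (s.1.2 - s.1.1) + N (s.2 - s.1.2) + N (s.1.1 - s.2) = perim s by [].
have q1 : N (s.1.1 - p) <= rho by rewrite NC E3; have := hp i; rewrite -/(x i) /x -/s; have := N_ge0 (s.1.2 - s.1.1); have := N_ge0 (s.2 - s.1.2); have := N_ge0 (s.1.1 - s.2); lra.
have q2 : N (s.1.2 - p) <= rho.
  apply: le_trans (ND3 s.1.1 _ _) _; rewrite (NC _ p) E3; have := hp i; rewrite /x -/s.
  by have := N_ge0 (s.2 - s.1.2); have := N_ge0 (s.1.1 - s.2); lra.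
have q3 : N (s.2 - p) <= rho.
  apply: le_trans (ND3 s.1.1 _ _) _; rewrite (NC s.2) (NC _ p) E3; have := hp i; rewrite /x -/s.
  by have := N_ge0 (s.2 - s.1.2); have := N_ge0 (s.1.2 - s.1.1); lra.
have cB := @mconvex_ball p rho.
have [_ k1] := lint_near_affine cB q1 q2 near.
have [_ k2] := lint_near_affine cB q2 q3 near.
have [_ k3] := lint_near_affine cB q3 q1 near.
have : N (tri s) <= e * rho * perim s.
  rewrite -ps !mulrDr /tri; set A1 := _ / 2 + _ in k1; set A2 := _ / 2 + _ in k2.
  set A3 := _ / 2 + _ in k3.
  rewrite (_ : lint f s.1.1 s.1.2 + _ + _ = (lint f s.1.1 s.1.2 - A1) +
     (lint f s.1.2 s.2 - A2) + (lint f s.2 s.1.1 - A3)); last first.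
    by rewrite /A1 /A2 /A3; field.
  apply: le_trans (ND _ _) _; apply: lerD => //.
  by apply: le_trans (ND _ _) _; apply: lerD.
have := nt i; rewrite -/s pt /rho.
have -> : (4 : R) ^+ i = 2 ^+ i * 2 ^+ i by rewrite -exprMn -natrM.
rewrite invfM; set u := (2 ^+ i)^-1 => h1 h2.
have u1 : 0 < u := p2 i.
have u0 : 0 < u * u by rewrite mulr_gt0.
have : N (tri t0) * (u * u) <= e * (perim t0 * perim t0 *+ 3) * (u * u).
  have E : forall e' P v : R, e' * (P *+ 3 * v) * (P * v) = e' * (P * P *+ 3) * (v * v).
    by move=> *; ring.
  by rewrite -E; exact: le_trans h1 h2.
rewrite ler_pM2r // /e mulrAC ler_pdivlMr // ler_pM2l //; lra.
Qed.

Lemma primitive z : N (z - c0) < r -> cderiv (lint f c0) z (f z).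
Proof.
move=> zr.
have r0 : 0 < r by apply: le_lt_trans zr; exact: N_ge0.
have qc : Q c0 by rewrite /Q subrr N0 ltW.
move=> e e0; have e2 : 0 < e by [].
have [d d0 hd] := fcont (ltW zr) e2.
have nb := @near0_ball _ (fun w => N (w - c0) < r) _ _ _ zr (fun w k => k).
have [d' d'0 hd'] := nb.
exists (Num.min d d'); first by rewrite lt_min d0.
move=> h; rewrite lt_min => /andP[h1 h2].
have qz : Q z := ltW zr; have qzh : Q (z + h) := ltW (hd' _ h2).
have := goursat qc qz qzh; rewrite (lintC qc qzh) => /eqP; rewrite subr_eq0 => /eqP <-.
rewrite [lint f c0 z + _]addrC addrK.
have := @lint_near z (z + h) (f z) e qz qzh; rewrite (addrC z) addrK; apply => w hw.
have := hd (w - z) ltac:(lra); rewrite subrKC; exact: ltW.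
Qed.

End Ball.

Lemma primitive_exists f a (r : R) : (forall z, N (z - a) <= r -> cdiff f z) ->
  exists F, forall z, N (z - a) < r -> cderiv F z (f z).
Proof.
move=> h; exists (lint f a) => z; apply: primitive => // w /h; exact: cdiff_cont.
Qed.

End Goursat.

(** * Cauchy's formula *)

Section CircleAverage.
Variable R : realType.
Local Notation C := R[i].
Local Notation N := (@normc R).
Local Notation Re := (@complex.Re R).
Implicit Types (f q u v : C -> C) (z w l a b c x y p h zt : C).

Definition sqrt_half_plane z : C := if 0 <= Re (sqrtc z) then sqrtc z else - sqrtc z.

Lemma sqrt_half_plane_sqr z : sqrt_half_plane z ^+ 2 = z.
Proof. by rewrite /sqrt_half_plane; case: ifP => _; rewrite ?sqrrN sqr_sqrtc. Qed.

Lemma Re_sqrt_half_plane z : 0 <= Re (sqrt_half_plane z).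
Proof.
rewrite /sqrt_half_plane; case: ifPn => //; rewrite -ltNge => h.
by rewrite raddfN oppr_ge0 ltW.
Qed.

(* Square roots are taken in the right half-plane, so that root2 i, of order
   2^(i+1), tends to 1. *)
Fixpoint root2 i : C := if i is j.+1 then sqrt_half_plane (root2 j) else -1.

Lemma root2_pow i : root2 i ^+ (2 ^ i) = -1.
Proof. by elim: i => [|i IH]; rewrite ?expr1 // expnS exprM /= sqrt_half_plane_sqr. Qed.

Lemma root2_pow2 i : root2 i ^+ (2 ^ i.+1) = 1.
Proof. by rewrite expnS mulnC exprM root2_pow sqrrN expr1n. Qed.

Lemma N_root2 i : N (root2 i) = 1.
Proof.
elim: i => [|i IH] /=; first by rewrite NN N1.
have : N (sqrt_half_plane (root2 i)) ^+ 2 = 1 by rewrite -NX sqrt_half_plane_sqr.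
by move/eqP; rewrite sqrp_eq1 ?N_ge0 // => /eqP.
Qed.

Lemma N_root2X i j : N (root2 i ^+ j) = 1.
Proof. by rewrite NX N_root2 expr1n. Qed.

Lemma root2_neq1 i : root2 i != 1.
Proof.
apply/eqP => h; have := root2_pow i; rewrite h expr1n => e.
have : (2%:R : C) == 0; last by rewrite pnatr_eq0.
have -> : (2%:R : C) = 1 + 1 by ring.
by rewrite {1}e addNr.
Qed.

(** If w is the square root of [root2 i], then w^2 - 1 = (w - 1)(w + 1), and |w + 1|^2 >= 2 since
    |w| = 1 and Re w >= 0. Hence each root at least halves |w - 1|^2. *)
Lemma root2_close i : N (root2 i - 1) ^+ 2 <= 4 / 2 ^+ i.
Proof.
elim: i => [|i IH].
  by rewrite expr0 divr1 /= (_ : -1 - 1 = - 2%:R) ?NN ?Nnat; [lra|ring].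
have E : root2 i - 1 = (root2 i.+1 - 1) * (root2 i.+1 + 1).
  by rewrite -[in LHS](sqrt_half_plane_sqr (root2 i)) /=; ring.
have h : 2 <= N (root2 i.+1 + 1) ^+ 2.
  have := Nsqr (root2 i.+1); rewrite N_root2 expr1n Nsqr !raddfD /= => e.
  by have := Re_sqrt_half_plane (root2 i); move: e; set s := sqrt_half_plane (root2 i); nra.
have k : 0 <= N (root2 i.+1 - 1) ^+ 2 by rewrite exprn_ge0 ?N_ge0.
move: IH; rewrite E NM exprMn => IH.
rewrite [2 ^+ i.+1]exprS invfM mulrCA; set t := 4 / _ in IH *; nra.
Qed.

Lemma root2_near (d : R) : 0 < d -> UF [set i | N (root2 i - 1) < d].
Proof.
move=> d0; have d2 : 0 < d ^+ 2 / 4 by rewrite divr_gt0 ?exprn_gt0.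
apply: UF_S (UF_inv d2) => i /= hi.
rewrite -(@ltr_pXn2r _ 2) ?nnegrE ?N_ge0 ?(ltW d0) //.
apply: le_lt_trans (root2_close i) _.
have : (2 ^+ i)^-1 <= i.+1%:R^-1 :> R.
  by rewrite lef_pV2 ?posrE ?exprn_gt0 // -natrX ler_nat ltn_expl.
by move: hi; rewrite ltr_pdivlMr //; set u := _^-1; set v := _^-1; lra.
Qed.

Definition circ i q : C := (\sum_(0 <= j < 2 ^ i.+1) q (root2 i ^+ j)) / (2 ^ i.+1)%:R.

(* The normalised integral of q over the unit circle. *)
Definition circ_mean q : C := ulim (fun i => circ i q).

Let p2 i : (2 ^ i.+1)%:R != 0 :> C.
Proof. by rewrite pnatr_eq0 -lt0n expn_gt0. Qed.

Lemma circ_split i q : \sum_(0 <= j < 2 ^ i.+1) q (root2 i ^+ j) =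
  \sum_(0 <= j < 2 ^ i) (q (root2 i ^+ j) + q (- root2 i ^+ j)).
Proof.
rewrite expnS mul2n -addnn (@big_cat_nat _ _ _ (2 ^ i)%N) ?leq_addr //= big_split /=.
congr (_ + _); rewrite -{1}[(2 ^ i)%N]add0n big_addn addnK.
by apply: eq_bigr => j _; rewrite exprD root2_pow mulrN1.
Qed.

(** Pairing zt with - zt gives zt / (zt - z) + zt / (zt + z) = 2 zt^2 / (zt^2 - z^2), which reduces
    the average for z to the coarser one for z^2. *)
Lemma circ_kernel i z : N z < 1 ->
  circ i (fun zt => zt / (zt - z)) = (1 - z ^+ (2 ^ i.+1))^-1.
Proof.
have neq zt y : N zt = 1 -> N y < 1 -> zt - y != 0.
  by move=> h k; rewrite subr_eq0; apply/eqP => e; move: k; rewrite -e h ltxx.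
elim: i z => [|i IH] z z1.
  rewrite /circ !big_nat_recr // big_geq //= add0r expr0 expr1.
  have h1 := neq 1 z (@N1 R) z1; have h2 := neq (-1) z ltac:(by rewrite NN N1) z1.
  have h3 : 1 - z ^+ 2 != 0 by rewrite (_ : 1 - z ^+ 2 = - ((1 - z) * (-1 - z))) ?oppr_eq0 ?mulf_neq0 //; ring.
  by field; rewrite h1 h2 h3.
have z2 : N (z ^+ 2) < 1 by rewrite NX expr_lt1 ?N_ge0.
have -> : (1 - z ^+ (2 ^ i.+2)) = (1 - (z ^+ 2) ^+ (2 ^ i.+1)).
  by rewrite -exprM -expnS.
rewrite -IH // /circ (circ_split i.+1 (fun zt => zt / (zt - z))).
transitivity ((\sum_(0 <= j < 2 ^ i.+1) 2%:R * (root2 i ^+ j / (root2 i ^+ j - z ^+ 2))) / (2 ^ i.+2)%:R).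
  congr (_ / _); apply: eq_bigr => j _.
  have <- : (root2 i.+1 ^+ j) ^+ 2 = root2 i ^+ j by rewrite -exprM mulnC exprM /= sqrt_half_plane_sqr.
  set y := root2 i.+1 ^+ j; have Ny : N y = 1 by rewrite N_root2X.
  have k1 := neq y z Ny z1; have k2 := neq (- y) z ltac:(by rewrite NN) z1.
  have k3 : y ^+ 2 - z ^+ 2 != 0.
    by rewrite (_ : _ - _ = - ((y - z) * (- y - z))) ?oppr_eq0 ?mulf_neq0 //; ring.
  by field; rewrite k1 k2 k3.
rewrite -mulr_sumr [(2 ^ i.+2)%N]expnS natrM.
by have k := p2 i; field; rewrite k.
Qed.

Lemma circ_bd i q (B : R) : (forall zt, N zt = 1 -> N (q zt) <= B) -> N (circ i q) <= B.
Proof.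
move=> h; rewrite /circ Nf Nnat ler_pdivrMr ?ltr0n ?expn_gt0 //.
apply: le_trans (N_sum _ _ _) _.
apply: le_trans (_ : \sum_(0 <= j < 2 ^ i.+1) B <= _).
  by apply: ler_sum => j _; apply: h; exact: N_root2X.
by rewrite sumr_const_nat subn0 mulr_natr.
Qed.

Lemma circ_ext i u v : (forall zt, N zt = 1 -> u zt = v zt) -> circ i u = circ i v.
Proof. by move=> h; rewrite /circ; congr (_ / _); apply: eq_bigr => j _; apply: h; exact: N_root2X. Qed.

Lemma circD i u v : circ i (fun zt => u zt + v zt) = circ i u + circ i v.
Proof. by rewrite /circ big_split mulrDl. Qed.

Lemma circMl i c u : circ i (fun zt => c * u zt) = c * circ i u.
Proof. by rewrite /circ -mulr_sumr mulrA. Qed.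

Lemma circ_mean_cv q (B : R) : (forall zt, N zt = 1 -> N (q zt) <= B) ->
  ucv (fun i => circ i q) (circ_mean q).
Proof. by move=> h; apply: (@ulimP _ _ B); apply: UF_all => i /=; exact: circ_bd. Qed.

Lemma circ_mean_bd q (B : R) : (forall zt, N zt = 1 -> N (q zt) <= B) -> N (circ_mean q) <= B.
Proof. by move=> h; apply: (ucv_le (circ_mean_cv h)); apply: UF_all => i /=; exact: circ_bd. Qed.

Lemma circ_mean_ext u v : (forall zt, N zt = 1 -> u zt = v zt) -> circ_mean u = circ_mean v.
Proof. by move=> h; apply: ulim_ext; apply: UF_all => i /=; exact: circ_ext. Qed.

Lemma circ_meanD u v (A B : R) : (forall zt, N zt = 1 -> N (u zt) <= A) ->
  (forall zt, N zt = 1 -> N (v zt) <= B) ->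
  circ_mean (fun zt => u zt + v zt) = circ_mean u + circ_mean v.
Proof.
move=> h k; apply: ucv_ulim; apply: ucv_ext (ucvD (circ_mean_cv h) (circ_mean_cv k)).
by apply: UF_all => i /=; rewrite circD.
Qed.

Lemma circ_meanMl c u (A : R) : (forall zt, N zt = 1 -> N (u zt) <= A) ->
  circ_mean (fun zt => c * u zt) = c * circ_mean u.
Proof.
move=> h; apply: ucv_ulim; apply: ucv_ext (ucvMl c (circ_mean_cv h)).
by apply: UF_all => i /=; rewrite circMl.
Qed.

Lemma pow_cv0 z : N z < 1 -> ucv (fun i => z ^+ (2 ^ i.+1)) 0.
Proof.
move=> z1; apply/ucv0P => e e0; have [z0|z0] := eqVneq z 0.
  by apply: UF_all => i /=; rewrite z0 expr0n expn_eq0 /= N0.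
have zp : 0 < N z by rewrite N_gt0.
(* Bernoulli's inequality multiplied out: |z|^m <= 1 / (1 + m (1 - |z|)). *)
have key m : N z ^+ m * (1 + m%:R * (1 - N z)) <= 1.
  elim: m => [|m IH]; first by rewrite expr0 mul0r addr0 mulr1.
  apply: le_trans IH; rewrite exprS [N z * _]mulrC -mulrA ler_wpM2l ?exprn_ge0 ?N_ge0 //.
  rewrite -subr_ge0 (_ : _ - _ = (1 - N z) ^+ 2 * (1 + m%:R)).
    by rewrite mulr_ge0 ?sqr_ge0 // addr_ge0.
  by rewrite -(@natr1 _ m); ring.
have d0 : 0 < e * (1 - N z) by rewrite mulr_gt0 // subr_gt0.
apply: UF_S (UF_inv d0) => i /= hi; rewrite NX.
set m := (2 ^ i.+1)%N.
have im : (i.+1%:R : R) <= m%:R by rewrite ler_nat ltnW // ltn_expl.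
have h1 : 1 < e * (1 - N z) * m%:R.
  apply: lt_le_trans (_ : e * (1 - N z) * i.+1%:R <= _); last by rewrite ler_pM2l.
  by move: hi; rewrite -[_^-1]mul1r ltr_pdivrMr.
have h2 := key m; have h3 : 0 <= N z ^+ m by rewrite exprn_ge0 ?N_ge0.
rewrite ltNge; apply/negP => h4.
have h5 : 0 < (1 - N z) * m%:R by rewrite -(pmulr_rgt0 _ e0) mulrA; lra.
have : e * (1 + m%:R * (1 - N z)) <= N z ^+ m * (1 + m%:R * (1 - N z)).
  by rewrite ler_wpM2r // mulrC; lra.
nra.
Qed.

Lemma N_kernel z zt : N z < 1 -> N zt = 1 -> zt - z != 0 /\ N (zt - z)^-1 <= (1 - N z)^-1.
Proof.
move=> z1 h; have k : 1 - N z <= N (zt - z) by rewrite -h NB_ge.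
have k0 : 0 < N (zt - z) by apply: lt_le_trans k; rewrite subr_gt0.
by split; [rewrite -N_gt0|rewrite NV lef_pV2 ?posrE ?subr_gt0].
Qed.

Section C1.
Variables (F f : C -> C).
Hypothesis dF : forall z, N z <= 1 -> cderiv F z (f z).
Hypothesis cf : forall z, N z <= 1 -> ccont f z.

(** Mean value inequality for F z - f y z, whose derivative f z - f y is small by uniform continuity
    of f. *)
Lemma unif_deriv (e : R) : 0 < e -> exists2 d : R, 0 < d &
  forall x y, N x <= 1 -> N y <= 1 -> N (x - y) < d ->
  N (F x - F y - f y * (x - y)) <= e * N (x - y).
Proof.
move=> e0; have [|d d0 hd] := @heine _ f 0 1 _ e e0.
  by move=> z; rewrite subr0; exact: cf.
exists d => // x y hx hy xy.
have := @mean_value _ (fun z => F z - f y * z) y x e.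
rewrite (_ : F x - f y * x - _ = F x - F y - f y * (x - y)); last by ring.
apply => t /andP[t0 t1]; set z := y + _.
have Nz : N z <= 1.
  rewrite (_ : z = (1 - t)%:C * y + t%:C * x); last by rewrite /z rmorphB rmorph1; ring.
  apply: le_trans (ND _ _) _; rewrite !NM !Nr ger0_norm ?subr_ge0 // ger0_norm //.
  have := N_ge0 x; have := N_ge0 y; nra.
exists (f z - f y).
  apply: cderivB; first exact: dF.
  by apply: cderiv_eq (cderivMl (f y) (cderiv_id z)) _; rewrite mulr1.
apply: ltW; apply: hd; rewrite ?subr0 //.
rewrite (_ : z - y = t%:C * (x - y)); last by rewrite /z; ring.
rewrite NM Nr ger0_norm //; apply: le_lt_trans xy.
by rewrite ler_piMl ?N_ge0.
Qed.

Let pt z zt (t : R) : C := z + (zt - z) * t%:C.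

Lemma pt_in z zt (t : R) : N z < 1 -> N zt = 1 -> 0 <= t <= 1 -> N (pt z zt t) <= 1.
Proof.
move=> z1 h /andP[t0 t1].
rewrite (_ : pt z zt t = (1 - t)%:C * z + t%:C * zt); last by rewrite /pt rmorphB rmorph1; ring.
apply: le_trans (ND _ _) _; rewrite !NM !Nr h ger0_norm ?subr_ge0 // ger0_norm //.
have := N_ge0 z; nra.
Qed.

(** The points [pt z zt t] over consecutive roots of unity differ by t (w - 1) w^j with w =
    [root2 i]. Multiplied by t (w - 1), the sum is a Riemann sum of F' along a closed polygon, so
    the increments of F telescope to 0 and only first-order errors remain. These carry the same
    factor t |w - 1|, whence an estimate uniform in t. *)
Lemma circ_deriv_small z (e : R) : N z < 1 -> 0 < e ->
  UF [set i | forall t : R, 0 <= t <= 1 -> N (circ i (fun zt => f (pt z zt t) * zt)) <= e].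
Proof.
move=> z1 e0; have [d d0 hd] := unif_deriv e0.
apply: UF_S (root2_near d0) => i /= hi t t01; have /andP[t0 t1] := t01.
have w1 : 0 < N (root2 i - 1) by rewrite N_gt0 subr_eq0 root2_neq1.
rewrite /circ Nf Nnat ler_pdivrMr ?ltr0n ?expn_gt0 //.
set n := (2 ^ i.+1)%N; set S := \sum_(_ <= j < _) _.
(* For t = 0 the polygon degenerates to z, and the sum is f z times the sum of all roots of unity of
   order 2^(i+1), which is 0. *)
move: t0; rewrite le_eqVlt => /orP[/eqP t0|t0].
  have -> : S = 0; last by rewrite N0 mulr_ge0 // ltW.
  rewrite /S -t0; under eq_bigr => j _ do rewrite /pt rmorph0 mulr0 addr0.
  rewrite -mulr_sumr; have : (root2 i - 1) * (\sum_(0 <= j < n) root2 i ^+ j) = 0.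
    by rewrite big_mkord -subrX1 root2_pow2 subrr.
  by move/eqP; rewrite mulf_eq0 -N_eq0 gt_eqF //= => /eqP ->; rewrite mulr0.
pose P j := pt z (root2 i ^+ j) t.
have Pin j : N (P j) <= 1 by apply: pt_in; rewrite ?N_root2X.
have dP j : P j.+1 - P j = t%:C * (root2 i - 1) * root2 i ^+ j.
  by rewrite /P /pt exprS; ring.
have NdP j : N (P j.+1 - P j) = t * N (root2 i - 1).
  by rewrite dP !NM N_root2X Nr gtr0_norm // mulr1.
have tel : \sum_(0 <= j < n) (F (P j.+1) - F (P j)) = 0.
  by rewrite telescope_sumr // /P root2_pow2 expr0 subrr.
have E : t%:C * (root2 i - 1) * S = - \sum_(0 <= j < n) (F (P j.+1) - F (P j) - f (P j) * (P j.+1 - P j)).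
  rewrite sumrB tel sub0r opprK /S mulr_sumr; apply: eq_bigr => j _.
  by rewrite dP /P; ring.
have := congr1 N E; rewrite !NM Nr gtr0_norm // NN => E2.
have w2 : 0 < t * N (root2 i - 1) by rewrite mulr_gt0.
rewrite -(ler_pM2l w2) E2; apply: le_trans (N_sum _ _ _) _.
apply: le_trans (_ : \sum_(0 <= j < n) e * (t * N (root2 i - 1)) <= _).
  apply: ler_sum => j _; rewrite -(NdP j); apply: hd => //.
  by rewrite NdP; apply: le_lt_trans hi; rewrite ler_piMl ?N_ge0.
by rewrite sumr_const_nat subn0 -mulr_natr le_eqVlt; apply/orP; left; apply/eqP; ring.
Qed.

(** The circle is contracted to z. The finite average of [q s] has an s-derivative that tends to 0
    uniformly, and for s = 0 it is F z times [circ_kernel], which tends to F z. *)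
Lemma cauchy_C1 z : N z < 1 -> circ_mean (fun zt => F zt * (zt / (zt - z))) = F z.
Proof.
move=> z1; pose q (s : C) zt := F (z + (zt - z) * s) * (zt / (zt - z)).
have h0 : ucv (fun i => circ i (q 0)) (F z).
  have h : ucv (fun i => (1 - z ^+ (2 ^ i.+1))^-1) 1.
    rewrite -[X in ucv _ X]invr1; apply: ucvV; first exact: oner_neq0.
    by have := ucvB (ucv_cst 1) (pow_cv0 z1); rewrite subr0.
  have := ucvMl (F z) h; rewrite mulr1; apply: ucv_ext; apply: UF_all => i /=.
  by rewrite -circ_kernel // -circMl; apply: circ_ext => zt _; rewrite /q mulr0 addr0.
have h1 : ucv (fun i => circ i (q 1) - circ i (q 0)) 0.
  apply/ucv0P => e e0; have e2 : 0 < e / 2 by rewrite divr_gt0.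
  apply: UF_S (circ_deriv_small z1 e2) => i /= hi.
  have := @mean_value _ (fun s => circ i (q s)) 0 1 (e / 2).
  rewrite subr0 N1 mulr1 => k; apply: le_lt_trans (k _) _; last by lra.
  move=> t t01; rewrite add0r mulr1.
  exists (circ i (fun zt => f (pt z zt t) * zt)); last exact: hi.
  rewrite /circ [X in cderiv _ _ X]mulrC.
  apply: (@cderiv_ext _ (fun s => (2 ^ i.+1)%:R^-1 * \sum_(0 <= j < 2 ^ i.+1) q s (root2 i ^+ j))).
    by apply: near0T => x; rewrite mulrC.
  apply: cderivMl; apply: cderiv_sum => j.
  set zt := root2 i ^+ j; have Nzt : N zt = 1 by rewrite N_root2X.
  have [nz _] := N_kernel z1 Nzt.
  have d1 := dF (pt_in z1 Nzt t01).
  have := cderivMl (zt / (zt - z)) (cderiv_affine d1).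
  rewrite (_ : zt / (zt - z) * _ = f (pt z zt t) * zt); last by field.
  by apply: cderiv_ext; apply: near0T => x; rewrite /q mulrC.
apply: ucv_ulim; have := ucvD h1 h0; rewrite add0r.
apply: ucv_ext; apply: UF_all => i /=; rewrite subrK.
by apply: circ_ext => zt _; rewrite /q mulr1 subrKC.
Qed.

End C1.
End CircleAverage.

(** * Consequences of Cauchy's formula: Taylor expansion, maximum principle, zeros *)

Section Analyticity.
Variable R : realType.
Local Notation C := R[i].
Local Notation N := (@normc R).
Implicit Types (f g q u v : C -> C) (z w l a b c x y p h zt : C).

Definition holo f a (r : R) := forall z, N (z - a) < r -> cdiff f z.

Lemma holoW f a (r s : R) : s <= r -> holo f a r -> holo f a s.
Proof. by move=> sr h z zs; apply: h; apply: lt_le_trans sr. Qed.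

Lemma holo_sub f a (r s : R) b : N (b - a) + s <= r -> holo f a r -> holo f b s.
Proof. by move=> h k z zb; apply: k; apply: le_lt_trans (ND3 b _ _) _; lra. Qed.

(* Remainder in the expansion of (zt - x - h)^-m to first order in h, where
   b = (zt - x)^-1 and a = (zt - x - h)^-1 = b + h a b. *)
Lemma inv_pow_remainder (eta : R) (m : nat) : 0 < eta -> exists2 K : R, 0 <= K &
  forall a b h, N a <= eta -> N b <= eta -> a = b + h * a * b ->
  N (a ^+ m - b ^+ m - m%:R * h * b ^+ m.+1) <= K * N h ^+ 2.
Proof.
move=> e0; elim: m => [|m [K K0 IH]].
  by exists 0 => // a b h _ _ _; rewrite !expr0 subrr !mul0r subrr N0.
exists (m.+1%:R * eta * eta ^+ m.+2 + eta * K).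
  by have e0' := ltW e0; apply: addr_ge0; last exact: mulr_ge0; apply: mulr_ge0; [exact: mulr_ge0|exact: exprn_ge0].
move=> a b h ha hb E.
rewrite (_ : _ - _ - _ = m.+1%:R * h ^+ 2 * a * b ^+ m.+2 + a * (a ^+ m - b ^+ m - m%:R * h * b ^+ m.+1)).
  apply: le_trans (ND _ _) _; rewrite mulrDl; apply: lerD.
    rewrite (NM _ (b ^+ m.+2)) (NX b) (NM _ a) (NM _ (h ^+ 2)) (NX h) Nnat.
    rewrite [leLHS](_ : _ = m.+1%:R * N a * N b ^+ m.+2 * N h ^+ 2); last by ring.
    apply: ler_wpM2r; first by rewrite exprn_ge0 ?N_ge0.
    apply: ler_pM; [exact: mulr_ge0 (N_ge0 _)|exact: exprn_ge0 (N_ge0 _)| |].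
      by rewrite ler_wpM2l.
    by rewrite lerXn2r ?nnegrE ?N_ge0 // ltW.
  by rewrite NM -(mulrA eta); apply: ler_pM; rewrite ?N_ge0 //; exact: IH.
have E1 : a * b ^+ m = b ^+ m.+1 + h * a * b ^+ m.+1.
  by rewrite {1}E exprS; ring.
have E2 : h * a * b ^+ m.+1 = h * b ^+ m.+2 + h ^+ 2 * a * b ^+ m.+2.
  by rewrite {1}E !exprS; ring.
rewrite !mulrBr [a ^+ m.+1]exprS E1 (_ : a * (m%:R * h * b ^+ m.+1) = m%:R * (h * a * b ^+ m.+1)); last by ring.
by rewrite E2 -(@natr1 _ m); ring.
Qed.

Definition cauchy_kernel q (m : nat) x : C := circ_mean (fun zt => q zt * zt * (zt - x)^-1 ^+ m).

Lemma cauchy_kernel_bd q (B : R) m x : N x < 1 -> (forall zt, N zt = 1 -> N (q zt) <= B) ->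
  forall zt, N zt = 1 -> N (q zt * zt * (zt - x)^-1 ^+ m) <= B * (1 - N x)^-1 ^+ m.
Proof.
move=> x1 hq zt h; have [_ k] := N_kernel x1 h.
rewrite !NM h mulr1 NX; apply: ler_pM; rewrite ?exprn_ge0 ?N_ge0 ?hq //.
by rewrite lerXn2r ?nnegrE ?N_ge0 // (le_trans _ k) ?N_ge0.
Qed.

Lemma cauchy_kernel_deriv q (B : R) m x : N x < 1 -> (forall zt, N zt = 1 -> N (q zt) <= B) ->
  cderiv (cauchy_kernel q m) x (m%:R * cauchy_kernel q m.+1 x).
Proof.
move=> x1 hq.
have B0 : 0 <= B by apply: le_trans (hq 1 (@N1 R)); exact: N_ge0.
set s := (1 - N x) / 2; have s0 : 0 < s by rewrite divr_gt0 // subr_gt0.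
have [K K0 hK] := @inv_pow_remainder s^-1 m ltac:(by rewrite invr_gt0).
apply: (@littleo_quad _ _ (B * K)); exists s => // h hs.
have xh : N (x + h) <= 1 - s by apply: le_trans (ND _ _) _; rewrite /s in hs *; lra.
have xh1 : N (x + h) < 1 by lra.
have b1 := cauchy_kernel_bd m xh1 hq; have b2 := cauchy_kernel_bd m x1 hq; have b3 := cauchy_kernel_bd m.+1 x1 hq.
have E : cauchy_kernel q m (x + h) - cauchy_kernel q m x - m%:R * cauchy_kernel q m.+1 x * h =
   circ_mean (fun zt => q zt * zt * ((zt - (x + h))^-1 ^+ m - (zt - x)^-1 ^+ m
       - m%:R * h * (zt - x)^-1 ^+ m.+1)).
  symmetry; transitivity (circ_mean (fun zt => q zt * zt * (zt - (x + h))^-1 ^+ m +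
     ((-1) * (q zt * zt * (zt - x)^-1 ^+ m) + (- (m%:R * h)) * (q zt * zt * (zt - x)^-1 ^+ m.+1)))).
    by apply: circ_mean_ext => zt _; ring.
  have b2' : forall zt, N zt = 1 -> N (-1 * (q zt * zt * (zt - x)^-1 ^+ m)) <= B * (1 - N x)^-1 ^+ m.
    by move=> zt k; rewrite NM NN N1 mul1r; exact: b2.
  have b3' : forall zt, N zt = 1 -> N (- (m%:R * h) * (q zt * zt * (zt - x)^-1 ^+ m.+1)) <= N (m%:R * h) * (B * (1 - N x)^-1 ^+ m.+1).
    by move=> zt k; rewrite NM NN ler_wpM2l ?N_ge0 //; exact: b3.
  have b4 : forall zt, N zt = 1 -> N (-1 * (q zt * zt * (zt - x)^-1 ^+ m) + - (m%:R * h) * (q zt * zt * (zt - x)^-1 ^+ m.+1)) <= B * (1 - N x)^-1 ^+ m + N (m%:R * h) * (B * (1 - N x)^-1 ^+ m.+1).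
    by move=> zt k; apply: le_trans (ND _ _) _; apply: lerD; [exact: b2'|exact: b3'].
  transitivity (cauchy_kernel q m (x + h) + (-1 * cauchy_kernel q m x + - (m%:R * h) * cauchy_kernel q m.+1 x)).
    by rewrite (circ_meanD b1 b4) (circ_meanD b2' b3') (circ_meanMl _ b2) (circ_meanMl _ b3).
  by move: (cauchy_kernel q m (x + h)) (cauchy_kernel q m x) (cauchy_kernel q m.+1 x) => X Y Z; ring.
rewrite E; apply: circ_mean_bd => zt k; rewrite NM NM k mulr1 -(mulrA B).
apply: ler_pM; rewrite ?N_ge0 ?hq //.
have [n1 k1] := N_kernel xh1 k; have [n2 k2] := N_kernel x1 k.
apply: hK.
- by apply: le_trans k1 _; rewrite lef_pV2 ?posrE //; lra.
- by apply: le_trans k2 _; rewrite lef_pV2 ?posrE /s //; have := N_ge0 x; lra.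
by field; rewrite opprD addrA in n1 *; rewrite n1 n2.
Qed.

Section Disc.
Variables (f : C -> C) (a : C) (r0 : R).
Hypothesis hf : holo f a r0.

Lemma Nscale (r : R) x : 0 <= r -> N (a + r%:C * x - a) = r * N x.
Proof. by move=> h; rewrite addrC addKr NM Nr ger0_norm. Qed.

Lemma unscale (r : R) z : 0 < r -> z = a + r%:C * ((z - a) / r%:C).
Proof.
move=> h; have r0' : r%:C != 0 :> C by rewrite -N_gt0 Nr normr_gt0 gt_eqF.
by field.
Qed.

Lemma Nunscale (r : R) z : 0 < r -> N ((z - a) / r%:C) = N (z - a) / r.
Proof. by move=> h; rewrite Nf Nr gtr0_norm. Qed.

Lemma cdiff_scale g (r : R) x : cdiff g (a + r%:C * x) -> cdiff (fun y => g (a + r%:C * y)) x.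
Proof. by move=> [l h]; eexists; exact: cderiv_affine h. Qed.

Lemma cont_scale_bd g (r : R) : (forall x, N x <= 1 -> ccont g x) ->
  exists B : R, forall zt, N zt = 1 -> N (g zt) <= B.
Proof.
move=> h; have [|B hB] := @cont_ball_bd _ g 0 1; first by move=> z; rewrite subr0; exact: h.
by exists B => zt k; apply: hB; rewrite subr0 k.
Qed.

(** Cauchy's formula is available so far only for functions with a continuous derivative. It is
    applied to a primitive F of f, given by Goursat's theorem: differentiating the kernel shows that
    f = F' and then f' = F'' are Cauchy integrals of F, hence differentiable. *)
Lemma holo_der : holo (der f) a r0.
Proof.
move=> z zr.
pose r1 := (N (z - a) + r0) / 2; pose r := (N (z - a) + r1) / 2.
have hz := N_ge0 (z - a).
have zr' : N (z - a) < r by rewrite /r /r1; lra.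
have rr1 : r < r1 by rewrite /r /r1; lra.
have r10 : r1 < r0 by rewrite /r1; lra.
have r_gt0 : 0 < r by lra.
have [F hF] := @primitive_exists _ f a r1 (fun w k => hf (le_lt_trans k r10)).
pose G x := F (a + r%:C * x).
have inr x : N x <= 1 -> N (a + r%:C * x - a) < r1.
  by move=> k; rewrite Nscale ?ltW //; nra.
have dG x : N x <= 1 -> cderiv G x (f (a + r%:C * x) * r%:C).
  by move=> k; apply: cderiv_affine; apply: hF; exact: inr.
have cf x : N x <= 1 -> ccont (fun x => f (a + r%:C * x) * r%:C) x.
  move=> k; apply: cdiff_cont; apply: cdiffM; last exact: cdiff_cst.
  by apply: cdiff_scale; apply: hf; apply: lt_trans r10; exact: inr.
have [B hB] := @cont_scale_bd G 1 (fun x k => cderiv_cont (dG x k)).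
have E1 x : N x < 1 -> G x = cauchy_kernel G 1 x.
  move=> k; rewrite -(cauchy_C1 dG cf k) /cauchy_kernel; apply: circ_mean_ext => zt _.
  by rewrite expr1 mulrA.
have nr x : N x < 1 -> near0 (fun h => N (x + h) < 1).
  by move=> k; apply: (@near0_ball _ (fun w => N w < 1) 0 x 1); rewrite ?subr0 // => w; rewrite subr0.
have E2 x : N x < 1 -> f (a + r%:C * x) = r%:C^-1 * cauchy_kernel G 2 x.
  move=> k; have := cauchy_kernel_deriv 1 k hB; rewrite mul1r => d.
  have d' : cderiv G x (cauchy_kernel G 2 x).
    by apply: cderiv_ext d; apply: near0S (nr x k) => h kh; rewrite E1.
  have := cderiv_unique (dG x (ltW k)) d' => <-.
  by rewrite mulrCA mulVf ?mulr1 // -N_gt0 Nr normr_gt0 gt_eqF.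
have lift (u v : C -> C) : (forall x, N x < 1 -> u (a + r%:C * x) = v x) ->
   forall w, N (w - a) < r -> u w = v ((w - a) / r%:C).
  move=> k w hw; rewrite {1}(unscale w r_gt0) k // Nunscale // ltr_pdivrMr // mul1r //.
have nb w : N (w - a) < r -> near0 (fun h => N (w + h - a) < r).
  by move=> k; exact: (@near0_ball _ (fun w => N (w - a) < r) _ _ _ k (fun w k => k)).
have E3 w : N (w - a) < r -> f w = r%:C^-1 * cauchy_kernel G 2 ((w - a) / r%:C).
  exact: (lift f (fun x => r%:C^-1 * cauchy_kernel G 2 x)).
have dK m w : N (w - a) < r -> cderiv (fun w => r%:C^-1 * cauchy_kernel G m ((w - a) / r%:C)) w
    (r%:C^-1 * (m%:R * cauchy_kernel G m.+1 ((w - a) / r%:C) * r%:C^-1)).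
  move=> k; apply: cderivMl.
  have k1 : N ((w - a) / r%:C) < 1 by rewrite Nunscale // ltr_pdivrMr // mul1r.
  have e x : - (a / r%:C) + r%:C^-1 * x = (x - a) / r%:C by ring.
  have := @cderiv_affine _ (cauchy_kernel G m) (- (a / r%:C)) (r%:C^-1) w; rewrite e => d.
  have := d _ (cauchy_kernel_deriv m k1 hB); apply: cderiv_ext; apply: near0T => h; by rewrite e.
have E4 w : N (w - a) < r -> der f w = r%:C^-1 * (2%:R * cauchy_kernel G 3 ((w - a) / r%:C) * r%:C^-1).
  move=> k; apply: derE; apply: cderiv_ext (dK 2%N w k).
  by apply: near0S (nb w k) => h kh; rewrite E3.
have := cderivMl (2%:R * r%:C^-1) (dK 3%N z zr') => d.
eexists; apply: cderiv_ext d; apply: near0S (nb z zr') => h kh; rewrite E4 //; ring.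
Qed.

Lemma cauchy_formula (r : R) x : 0 < r -> r < r0 -> N x < 1 ->
  f (a + r%:C * x) = circ_mean (fun zt => f (a + r%:C * zt) * (zt / (zt - x))).
Proof.
move=> rp rr x1; symmetry.
apply: (@cauchy_C1 _ (fun x => f (a + r%:C * x)) (fun x => der f (a + r%:C * x) * r%:C)) => // z z1.
  apply: cderiv_affine; apply: derP; apply: hf; rewrite Nscale ?ltW //; nra.
apply: cdiff_cont; apply: cdiffM; last exact: cdiff_cst.
by apply: cdiff_scale; apply: holo_der; rewrite Nscale ?ltW //; nra.
Qed.

(** The i-th Taylor coefficient at a multiplied by r^i: the expansion is in the variable x = (z - a)
    / r. *)
Definition tcoef (r : R) i : C := circ_mean (fun zt => f (a + r%:C * zt) * zt^-1 ^+ i).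

Section Taylor.
Variables (r B : R).
Hypotheses (rp : 0 < r) (rr : r < r0).
Hypothesis hB : forall w, N (w - a) = r -> N (f w) <= B.

Let hB1 zt : N zt = 1 -> N (f (a + r%:C * zt)) <= B.
Proof. by move=> h; apply: hB; rewrite Nscale ?ltW // h mulr1. Qed.
Let B0 : 0 <= B.
Proof. by apply: le_trans (hB1 (@N1 R)); exact: N_ge0. Qed.

Lemma tcoef_bd i : N (tcoef r i) <= B.
Proof.
by apply: circ_mean_bd => zt h; rewrite NM NX NV h invr1 expr1n mulr1; exact: hB1.
Qed.

(** zt / (zt - x) is expanded as a finite geometric sum in x / zt; [K m] below is the integral of
    the remainder divided by x^m. *)
Lemma taylor m x : N x < 1 ->
  N (f (a + r%:C * x) - \sum_(i < m) tcoef r i * x ^+ i) <= B * N x ^+ m / (1 - N x).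
Proof.
move=> x1; set K := fun m => circ_mean (fun zt => f (a + r%:C * zt) * (zt * zt^-1 ^+ m / (zt - x))).
have bdK k zt : N zt = 1 -> N (f (a + r%:C * zt) * (zt * zt^-1 ^+ k / (zt - x))) <= B * (1 - N x)^-1.
  move=> h; have [_ kk] := N_kernel x1 h.
  rewrite NM Nf NM NX NV h invr1 expr1n mul1r mul1r -NV.
  by apply: ler_pM; rewrite ?N_ge0 ?hB1.
have E k : f (a + r%:C * x) = \sum_(i < k) tcoef r i * x ^+ i + x ^+ k * K k.
  elim: k => [|k IH].
    rewrite big_ord0 add0r mul1r cauchy_formula //; apply: circ_mean_ext => zt _.
    by rewrite expr0 mulr1.
  rewrite IH big_ord_recr /= -addrA; congr (_ + _).
  have -> : K k = tcoef r k + x * K k.+1; last by rewrite exprS; ring.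
  have b1 zt : N zt = 1 -> N (f (a + r%:C * zt) * zt^-1 ^+ k) <= B.
    by move=> h; rewrite NM NX NV h invr1 expr1n mulr1 hB1.
  have b2 zt : N zt = 1 -> N (x * (f (a + r%:C * zt) * (zt * zt^-1 ^+ k.+1 / (zt - x)))) <= N x * (B * (1 - N x)^-1).
    by move=> h; rewrite NM ler_wpM2l ?N_ge0 //; exact: bdK.
  rewrite /tcoef -(circ_meanMl x (bdK k.+1)) -(circ_meanD b1 b2); apply: circ_mean_ext => zt h.
  have [n1 _] := N_kernel x1 h; have n2 : zt != 0 by rewrite -N_gt0 h.
  rewrite exprS; set t := zt^-1 ^+ k; field; by rewrite n1 n2.
rewrite {1}(E m) addrAC subrr add0r NM NX -mulrA mulrCA.
by apply: ler_pM; rewrite ?exprn_ge0 ?N_ge0 //; apply: circ_mean_bd => zt h; exact: bdK.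
Qed.

Lemma tcoef0 : tcoef r 0 = f a.
Proof.
have h := @taylor 1 0 ltac:(by rewrite N0).
move: h; rewrite N0 expr1 !mulr0 mul0r big_ord1 expr0 mulr1 addr0 => /N_le0.
by move/eqP; rewrite subr_eq0 => /eqP.
Qed.

Lemma taylor2 h : N h <= r / 2 ->
  N (f (a + h) - f a - tcoef r 1 / r%:C * h) <= 2 * B / r ^+ 2 * N h ^+ 2.
Proof.
move=> hh; have rn0 : r%:C != 0 :> C by rewrite -N_gt0 Nr normr_gt0 gt_eqF.
pose x := h / r%:C; have Nx : N x = N h / r by rewrite Nf Nr gtr0_norm.
have x2 : N x <= 1 / 2 by rewrite Nx ler_pdivrMr //; lra.
have x1 : N x < 1 by lra.
have := @taylor 2 x x1; rewrite !big_ord_recl big_ord0 /= tcoef0 expr0 mulr1 addr0 expr1.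
rewrite (_ : r%:C * x = h); last by rewrite /x; field.
rewrite (_ : _ - _ = f (a + h) - f a - tcoef r 1 / r%:C * h); last by rewrite /x; field.
move=> k; apply: le_trans k _.
have -> : 2 * B / r ^+ 2 * N h ^+ 2 = B * N x ^+ 2 * 2.
  by rewrite Nx; field; rewrite gt_eqF.
rewrite ler_wpM2l ?mulr_ge0 ?exprn_ge0 ?N_ge0 //.
by rewrite -[leRHS]invrK lef_pV2 ?posrE //; lra.
Qed.

Lemma der_tcoef : der f a = tcoef r 1 / r%:C.
Proof.
apply: derE; apply: (@littleo_quad _ _ (2 * B / r ^+ 2)); exists (r / 2).
  by rewrite divr_gt0.
by move=> h /ltW; exact: taylor2.
Qed.

Lemma cauchy_est : N (der f a) <= B / r.
Proof.
by rewrite der_tcoef Nf Nr gtr0_norm // ler_wpM2r ?invr_ge0 ?tcoef_bd // ltW.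
Qed.

Lemma second_order h : N h <= r / 2 ->
  N (f (a + h) - f a - der f a * h) <= 2 * B / r ^+ 2 * N h ^+ 2.
Proof. by rewrite der_tcoef; exact: taylor2. Qed.

Lemma max_bernoulli (t K : R) : 0 <= t -> (forall m : nat, t ^+ m <= K) -> t <= 1.
Proof.
move=> t0 h; rewrite leNgt; apply/negP => t1.
have key m : 1 + m%:R * (t - 1) <= t ^+ m.
  elim: m => [|m IH]; first by rewrite mul0r addr0.
  rewrite exprS; apply: le_trans (_ : t * (1 + m%:R * (t - 1)) <= _); last by rewrite ler_wpM2l.
  rewrite -subr_ge0 (_ : _ - _ = m%:R * (t - 1) ^+ 2).
    by rewrite mulr_ge0 ?sqr_ge0.
  by rewrite -(@natr1 _ m); ring.
have K0 : 0 <= K / (t - 1).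
  by rewrite divr_ge0 ?subr_ge0 ?(ltW t1) //; apply: le_trans (h 0%N); rewrite expr0.
have := archi_boundP K0; rewrite ltr_pdivrMr ?subr_gt0 // => k.
by have := le_trans (key _) (h (Num.bound (K / (t - 1)))); lra.
Qed.

End Taylor.

End Disc.

(** The Taylor estimate of order 0, applied to the powers f^m, gives |f w|^m <= (B + e)^m / (1 -
    |x|) for every m. Powers of a number above 1 are unbounded, so the constant disappears. *)
Lemma max_principle f a (r0 r B : R) : holo f a r0 -> 0 < r -> r < r0 ->
  (forall w, N (w - a) = r -> N (f w) <= B) ->
  forall w, N (w - a) <= r -> N (f w) <= B.
Proof.
move=> hf rp rr hB w; rewrite le_eqVlt => /orP[/eqP/hB //|wr].
have B0 : 0 <= B.
  apply: le_trans (hB (a + r%:C) _); first exact: N_ge0.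
  by rewrite addrAC subrr add0r Nr gtr0_norm.
apply/ler_addgt0Pr => e e0; have Be : 0 < B + e by lra.
rewrite -[leRHS]mul1r -ler_pdivrMr //.
have x1 : N ((w - a) / r%:C) < 1 by rewrite Nunscale // ltr_pdivrMr // mul1r.
apply: (@max_bernoulli _ (1 - N ((w - a) / r%:C))^-1).
  by rewrite divr_ge0 ?N_ge0 // ltW.
move=> m.
have hm : holo (fun z => f z ^+ m) a r0 by move=> z /hf; exact: cdiffX.
have hBm z : N (z - a) = r -> N (f z ^+ m) <= (B + e) ^+ m.
  move=> /hB h; rewrite NX lerXn2r ?nnegrE ?N_ge0 ?(ltW Be) //.
  by apply: le_trans h _; lra.
have := @taylor _ _ _ hm r ((B + e) ^+ m) rp rr hBm 0 ((w - a) / r%:C) x1.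
rewrite big_ord0 subr0 expr0 mulr1 -unscale // NX => k.
by rewrite expr_div_n ler_pdivrMr ?exprn_gt0 // mulrC.
Qed.

Definition dquot f a z : C := if z == a then der f a else (f z - f a) / (z - a).

Lemma dquotP f a z : f z = f a + (z - a) * dquot f a z.
Proof.
rewrite /dquot; case: eqVneq => [->|za]; first by rewrite subrr mul0r addr0.
by rewrite mulrC divfK ?subr_eq0 // subrKC.
Qed.

(** Only z = a is at stake: there the Taylor estimate of order 3 exhibits the second coefficient as
    the derivative of the quotient. *)
Lemma dquot_holo f a (r : R) : holo f a r -> holo (dquot f a) a r.
Proof.
move=> hf z zr; have [->|za] := eqVneq z a; last first.
  have za0 : z - a != 0 by rewrite subr_eq0.
  apply: (@cdiff_ext _ (fun z => (f z - f a) / (z - a))).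
    exists (N (z - a)); first by rewrite N_gt0.
    move=> h hh; rewrite /dquot; case: eqVneq => // e.
    by move: hh; rewrite -e opprD addNKr NN ltxx || (rewrite -NN (_ : - h = z - a) ?ltxx // -e; ring).
  apply: cdiffM; first by apply: cdiffB; [exact: hf|exact: cdiff_cst].
  by apply: cdiffV => //; apply: cdiffB; [exact: cdiff_id|exact: cdiff_cst].
have r0 : 0 < r by apply: le_lt_trans zr; exact: N_ge0.
pose s := r / 2; have s0 : 0 < s by rewrite divr_gt0.
have sr : s < r by rewrite /s; lra.
have [B hB'] : exists B : R, forall w, N (w - a) <= s -> N (f w) <= B.
  by apply: (@cont_ball_bd _ f a s) => w hw; apply: cdiff_cont; apply: hf; lra.
have hB w : N (w - a) = s -> N (f w) <= B by move=> h; apply: hB'; rewrite h.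
have sn0 : s%:C != 0 :> C by rewrite -N_gt0 Nr normr_gt0 gt_eqF.
have B0 : 0 <= B by apply: le_trans (hB' a _); rewrite ?N_ge0 // subrr N0 ltW.
exists (tcoef f a s 2 / s%:C ^+ 2).
apply: (@littleo_quad _ _ (2 * B / s ^+ 3)); exists (s / 2); first by rewrite divr_gt0.
move=> h hs; rewrite /dquot eqxx; case: eqVneq => [e|ne].
  have -> : h = 0 by rewrite -(addKr a h) e addNr.
  by rewrite subrr mulr0 subrr N0 mulr_ge0 ?divr_ge0 ?mulr_ge0 ?exprn_ge0 // ltW.
have h0 : h != 0 by apply: contraNneq ne => ->; rewrite addr0.
have Nh : 0 < N h by rewrite N_gt0.
rewrite (_ : a + h - a = h); last by rewrite addrAC subrr add0r.
pose x := h / s%:C; have Nx : N x = N h / s by rewrite Nf Nr gtr0_norm.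
have x2 : N x <= 1 / 2 by rewrite Nx ler_pdivrMr //; lra.
have := @taylor _ _ _ hf s B s0 sr hB 3 x ltac:(lra).
rewrite !big_ord_recl big_ord0 /= (tcoef0 hf s0 sr hB) expr0 mulr1 addr0 expr1.
rewrite (_ : s%:C * x = h); last by rewrite /x; field.
rewrite (der_tcoef hf s0 sr hB) => k.
rewrite (_ : _ / h - _ - _ = (f (a + h) - (f a + (tcoef f a s 1 * x + tcoef f a s 2 * x ^+ 2))) / h); last first.
  by rewrite /x; field; rewrite sn0 h0.
rewrite Nf ler_pdivrMr //; apply: le_trans k _.
have -> : 2 * B / s ^+ 3 * N h ^+ 2 * N h = B * N x ^+ 3 * 2.
  by rewrite Nx; field; rewrite gt_eqF.
rewrite ler_wpM2l ?mulr_ge0 ?exprn_ge0 ?N_ge0 //.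
by rewrite -[leRHS]invrK lef_pV2 ?posrE //; lra.
Qed.

Lemma holo_bd f a (r s : R) : holo f a r -> s < r ->
  exists2 B : R, 0 < B & forall w, N (w - a) <= s -> N (f w) <= B.
Proof.
move=> hf sr; have [|B hB] := @cont_ball_bd _ f a s.
  by move=> w hw; apply: cdiff_cont; apply: hf; apply: le_lt_trans sr.
exists (`|B| + 1); first by have := normr_ge0 B; lra.
by move=> w /hB; have := ler_norm B; lra.
Qed.

(** If z - a could be divided out for ever, the maximum principle for f / (z - a)^m on |z - a| = s
    would give |f z| <= B (|z - a| / s)^m for all m, hence f z = 0. *)
Lemma holo_prod_factor f a (r : R) : holo f a r ->
  (forall z, N (z - a) < r -> f z = 0) \/
  exists (m : nat) k, [/\ holo k a r, k a != 0 & forall z, f z = (z - a) ^+ m * k z].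
Proof.
move=> hf; have [r0|r0] := leP r 0.
  by left => z zr; exfalso; have := N_ge0 (z - a); lra.
case: (pselect (exists (m : nat) k, [/\ holo k a r, k a != 0 & forall z, f z = (z - a) ^+ m * k z])); first by right.
move=> nex; left.
have key m : exists2 k, holo k a r & forall z, f z = (z - a) ^+ m * k z.
  elim: m => [|m [k hk E]]; first by exists f => // z; rewrite mul1r.
  have k0 : k a = 0.
    by apply/eqP/negPn/negP => ka; apply: nex; exists m, k.
  exists (dquot k a); first exact: dquot_holo.
  by move=> z; rewrite E (dquotP k a z) k0 add0r exprSr mulrA.
move=> z zr; apply: N_small => e e0.
pose s := (N (z - a) + r) / 2; have hz := N_ge0 (z - a).
have zs : N (z - a) < s by rewrite /s; lra.
have sr : s < r by rewrite /s; lra.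
have s0 : 0 < s by lra.
have [B B0 hB] := holo_bd hf sr.
have bd m : N (f z) <= B * (N (z - a) / s) ^+ m.
  have [k hk E] := key m.
  have hkB w : N (w - a) = s -> N (k w) <= B / s ^+ m.
    move=> hw; rewrite ler_pdivlMr ?exprn_gt0 // -hw -NX mulrC -NM -E.
    by apply: hB; rewrite hw.
  have := max_principle hk s0 sr hkB (ltW zs) => h.
  rewrite E NM NX expr_div_n mulrA mulrAC mulrC.
  by rewrite ler_wpM2r ?exprn_ge0.
have q1 : N (((N (z - a)) / s)%:C : C) < 1.
  have q0 : 0 <= N (z - a) / s by rewrite divr_ge0 // ltW.
  by rewrite Nr ger0_norm // ltr_pdivrMr // mul1r.
have [i /= hi] := UF_ex ((ucv0P _).1 (pow_cv0 q1) _ (divr_gt0 e0 B0)).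
apply: le_trans (bd (2 ^ i.+1)%N) _; apply: ltW.
have q0 : 0 <= N (z - a) / s by rewrite divr_ge0 // ltW.
move: hi; rewrite NX Nr ger0_norm //.
by rewrite ltr_pdivlMr // mulrC.
Qed.

Lemma identity_disc f a (r : R) : holo f a r -> near0 (fun h => f (a + h) = 0) ->
  forall z, N (z - a) < r -> f z = 0.
Proof.
move=> hf [d d0 hd]; have [//|[m [k [hk ka E]]]] := holo_prod_factor hf.
move=> z zr; have r0 : 0 < r by apply: le_lt_trans zr; exact: N_ge0.
have := hk a; rewrite subrr N0 => /(_ r0) /cdiff_cont /ccont_neq0 /(_ ka) [d' d'0 hd'].
pose t := Num.min d d' / 2; have t0 : 0 < t by rewrite divr_gt0 // lt_min d0.
have Nt : N (t%:C : C) = t by rewrite Nr gtr0_norm.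
have : t < Num.min d d' by rewrite /t; have : 0 < Num.min d d' by [rewrite lt_min d0]; lra.
rewrite lt_min -Nt => /andP[/hd h1 /hd' [_ h2]].
move: h1; rewrite E => /eqP; rewrite mulf_eq0 (negbTE h2) orbF expf_eq0 addrAC subrr add0r.
by rewrite -N_eq0 Nt (gt_eqF t0) andbF.
Qed.

Lemma isolated_zero f a (r : R) : 0 < r -> holo f a r ->
  ~ (forall z, N (z - a) < r -> f z = 0) ->
  exists2 d : R, 0 < d & forall z, N (z - a) < d -> z != a -> f z != 0.
Proof.
move=> r0 hf nz; have [//|[m [k [hk ka E]]]] := holo_prod_factor hf.
have := hk a; rewrite subrr N0 => /(_ r0) /cdiff_cont /ccont_neq0 /(_ ka) [d d0 hd].
exists d => // z zd za; rewrite E mulf_neq0 ?expf_neq0 ?subr_eq0 //.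
by have [] := hd _ zd; rewrite subrKC.
Qed.

Definition entire f := forall z, cdiff f z.

Lemma entire_holo f a (r : R) : entire f -> holo f a r.
Proof. by move=> h z _. Qed.

Lemma zero_der_const f a (r : R) : (forall z, N (z - a) < r -> cderiv f z 0) ->
  forall z, N (z - a) < r -> f z = f a.
Proof.
move=> h z zr; apply/eqP; rewrite -subr_eq0; apply/eqP; apply: N_le0.
rewrite -(mul0r (N (z - a))); apply: mean_value => t /andP[t0 t1].
exists 0; last by rewrite N0.
apply: h; rewrite addrAC subrr add0r NM Nr ger0_norm //.
by apply: le_lt_trans zr; rewrite ler_piMl ?N_ge0.
Qed.

End Analyticity.

(** * The logarithm and Harnack's inequality *)

Section ExpLog.
Variable R : realType.
Local Notation C := R[i].
Local Notation N := (@normc R).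
Local Notation Re := (@complex.Re R).
Local Notation Im := (@complex.Im R).
Implicit Types (f g : C -> C) (z w l a b h y p : C).

Lemma sin_mean (x : R) : 0 <= x -> exists2 c : R, 0 <= c <= x & sin x = cos c * x.
Proof.
move=> x0; have [|c cx] := @MVT_segment R sin cos 0 x x0 (fun c _ => is_derive_sin c).
  by apply: continuous_subspaceT; exact: continuous_sin.
by rewrite sin0 !subr0 => ->; exists c => //; move: cx; rewrite in_itv.
Qed.

Lemma abs_sin_le (x : R) : `|sin x| <= `|x|.
Proof.
wlog x0 : x / 0 <= x.
  by move=> h; have [/h//|/ltW x0] := leP 0 x; rewrite -normrN -sinN -[leRHS]normrN h // oppr_ge0.
have [c _ ->] := sin_mean x0.
by rewrite normrM ler_piMl // ler_norml cos_geN1 cos_le1.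
Qed.

Lemma abs_cosB1_le (x : R) : `|cos x - 1| <= x ^+ 2.
Proof.
wlog x0 : x / 0 <= x.
  by move=> h; have [/h//|/ltW x0] := leP 0 x; rewrite -cosN -sqrrN h // oppr_ge0.
have [|c cx] := @MVT_segment R cos (fun x => - sin x) 0 x x0 (fun c _ => is_derive_cos c).
  by apply: continuous_subspaceT; exact: continuous_cos.
rewrite cos0 !subr0 => ->; move: cx; rewrite in_itv /= => /andP[c0 cx].
rewrite normrM normrN (ger0_norm x0) expr2 ler_wpM2r //.
by apply: le_trans (abs_sin_le _) _; rewrite ger0_norm.
Qed.

Lemma abs_sinBid_le (x : R) : `|x| <= 1 -> `|sin x - x| <= x ^+ 2.
Proof.
wlog x0 : x / 0 <= x.
  move=> h; have [/h//|/ltW x0] := leP 0 x => x1.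
  by rewrite -normrN opprB addrC -sinN -sqrrN -[X in _ + X]opprK h ?normrN ?oppr_ge0.
rewrite ger0_norm // => x1; have [c /andP[c0 cx] ->] := sin_mean x0.
rewrite (_ : cos c * x - x = (cos c - 1) * x); last by ring.
rewrite normrM (ger0_norm x0) expr2 ler_wpM2r //.
by apply: le_trans (abs_cosB1_le _) _; nra.
Qed.

Lemma expR_quad (x : R) : x <= 1 / 2 -> 1 + x <= expR x <= 1 + x + 2 * x ^+ 2.
Proof.
move=> x2; rewrite expR_ge1Dx /=.
have h1 := expR_ge1Dx (- x); have h2 := expRxMexpNx_1 x.
have h3 := expR_gt0 x; have h4 := expR_gt0 (- x).
have h5 : expR x * (1 - x) <= 1 by rewrite -[leRHS]h2; apply: ler_wpM2l => //; exact: ltW.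
have h6 : 0 <= x ^+ 2 * (1 - 2 * x) by rewrite mulr_ge0 ?sqr_ge0 //; lra.
have h7 : 0 < 1 - x by lra.
rewrite -(ler_pM2r h7); apply: le_trans h5 _; rewrite -subr_ge0.
by rewrite (_ : _ - 1 = x ^+ 2 * (1 - 2 * x)) //; ring.
Qed.

Definition cexp z : C := (expR (Re z) * cos (Im z)) +i* (expR (Re z) * sin (Im z)).

Lemma cexpD z w : cexp (z + w) = cexp z * cexp w.
Proof.
case: z w => [a b] [a' b']; rewrite /cexp /= expRD cosD sinD.
by apply/eqP; rewrite eq_complex /=; apply/andP; split; apply/eqP; ring.
Qed.

Lemma N_cexp z : N (cexp z) = expR (Re z).
Proof.
have h : N (cexp z) ^+ 2 = expR (Re z) ^+ 2.
  rewrite Nsqr /= !exprMn -mulrDr cos2sin2 subrK mulr1 //.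
by apply/eqP; rewrite -(@eqrXn2 _ 2) ?N_ge0 ?expR_ge0 // h.
Qed.

Lemma cderiv_cexp z : cderiv cexp z (cexp z).
Proof.
(* The real and imaginary parts of exp h - 1 - h are at most 4 |h|^2 and 5 |h|^2. *)
apply: (@littleo_quad _ _ (N (cexp z) * 10)); exists (1 / 2); first by rewrite divr_gt0.
move=> h hh; rewrite cexpD (_ : _ - _ = cexp z * (cexp h - 1 - h)); last by ring.
rewrite NM -mulrA ler_wpM2l ?N_ge0 //.
have hu := NRe h; have hv := NIm h.
apply: le_trans (NReIm _) _; rewrite !raddfB /=.
set u := Re h in hu *; set v := Im h in hv *; rewrite oppr0 addr0.
have su : u ^+ 2 <= N h ^+ 2 by rewrite Nsqr lerDl sqr_ge0.
have sv : v ^+ 2 <= N h ^+ 2 by rewrite Nsqr lerDr sqr_ge0.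
have u1 : u <= 1 / 2 by have := ler_norm u; lra.
have un : - u <= 1 / 2 by have := ler_norm (- u); rewrite normrN; lra.
have /andP[e1 e2] := expR_quad u1.
have c1 := abs_cosB1_le v; have s1 := @abs_sinBid_le v ltac:(lra); have s2 := abs_sin_le v.
have e3 : expR u <= 2.
  apply: le_trans e2 _; have : u ^+ 2 <= 1 / 4; last by lra.
  by rewrite expr2; nra.
have k1 : `|expR u * cos v - 1 - u| <= 4 * N h ^+ 2.
  rewrite (_ : _ - _ - _ = expR u * (cos v - 1) + (expR u - 1 - u)); last by ring.
  apply: le_trans (ler_normD _ _) _; rewrite normrM (gtr0_norm (expR_gt0 u)).
  have : `|expR u - 1 - u| <= 2 * N h ^+ 2 by rewrite ger0_norm; lra.
  have : expR u * `|cos v - 1| <= 2 * N h ^+ 2.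
    by apply: ler_pM => //; exact: le_trans sv.
  lra.
have k2 : `|expR u * sin v - v| <= 5 * N h ^+ 2.
  rewrite (_ : _ - _ = (expR u - 1) * sin v + (sin v - v)); last by ring.
  apply: le_trans (ler_normD _ _) _; rewrite normrM.
  have e4 : `|expR u - 1| <= 2 * `|u|.
    have uu : u ^+ 2 <= `|u| / 2.
      rewrite -real_normK ?num_real // expr2; have := normr_ge0 u; nra.
    have := ler_norm u; have := ler_norm (- u); rewrite normrN ler_norml => a1 a2.
    by apply/andP; split; lra.
  have : `|expR u - 1| * `|sin v| <= 2 * N h * N h.
    by apply: ler_pM => //; [apply: le_trans e4 _; lra|apply: le_trans s2 _].
  by have := le_trans s1 sv; rewrite expr2; lra.
by have : 0 <= N h ^+ 2 by [rewrite exprn_ge0 ?N_ge0]; lra.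
Qed.

(** With psi a primitive of f' / f, the function f exp (- psi) has derivative 0. Moduli in this
    identity give Re psi up to an additive constant, which the definition of phi corrects. *)
Lemma log_exists f a (r s : R) : holo f a r -> s < r -> 0 < s ->
  (forall z, N (z - a) < r -> f z != 0) ->
  exists phi, forall z, N (z - a) < s ->
    cderiv phi z (der f z / f z) /\ Re (phi z) = ln (N (f z)).
Proof.
move=> hf sr s0 nz.
have [psi hpsi] := @primitive_exists _ (fun z => der f z / f z) a s
  (fun z zs => cdiffM (holo_der hf (le_lt_trans zs sr))
      (cdiffV (nz _ (le_lt_trans zs sr)) (hf _ (le_lt_trans zs sr)))).
have hg z : N (z - a) < s -> f z * cexp (- psi z) = f a * cexp (- psi a).
  apply: (@zero_der_const _ (fun z => f z * cexp (- psi z)) a s) => w ws.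
  have wr := lt_trans ws sr.
  have d := cderivM (derP (hf _ wr)) (cderiv_comp (cderivN (hpsi _ ws)) (cderiv_cexp (- psi w))).
  by apply: cderiv_eq d _; have := nz _ wr => k; field.
have aa : N (a - a) < s by rewrite subrr N0.
have fa : 0 < N (f a) by rewrite N_gt0; apply: nz; exact: lt_trans sr.
exists (fun z => psi z + (ln (N (f a)) - Re (psi a))%:C) => z zs; split.
  by rewrite -[X in cderiv _ _ X]addr0; apply: cderivD; [exact: hpsi|exact: cderiv_cst].
have fz : 0 < N (f z) by rewrite N_gt0; apply: nz; exact: lt_trans sr.
have := congr1 N (hg _ zs); rewrite !NM !N_cexp !raddfN => /(congr1 (@ln R)).
rewrite !lnM ?posrE ?expR_gt0 // !expRK raddfD /=; lra.
Qed.

(** Schwarz's lemma for the Cayley transform (f - f a) / (f + conj (f a)), which sends the left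
    half-plane into the unit disc and f a to 0. *)
Lemma schwarz_half_plane f a (r s : R) : holo f a r -> 0 < s -> s < r ->
  (forall z, N (z - a) < r -> Re (f z) < 0) ->
  (forall z, N (z - a) <= s -> N (f z - f a) * s <= N (z - a) * N (f z + (conjc (f a)))) /\
  N (der f a) * s <= - Re (f a) *+ 2.
Proof.
move=> hf s0 sr hneg; have r0 := lt_trans s0 sr.
have aa : N (a - a) < r by rewrite subrr N0.
have fa := hneg a aa.
have den z : N (z - a) < r -> f z + (conjc (f a)) != 0.
  move=> zr; apply/eqP => /(congr1 Re); rewrite raddfD /=.
  have := hneg z zr; case: (f z) fa => x y; case: (f a) => x' y' /=; lra.
pose w z := (f z - f a) / (f z + (conjc (f a))).
have hw : holo w a r.
  move=> z zr; apply: cdiffM; first by apply: cdiffB; [exact: hf|exact: cdiff_cst].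
  by apply: cdiffV; [exact: den|apply: cdiffD; [exact: hf|exact: cdiff_cst]].
have w1 z : N (z - a) < r -> N (w z) <= 1.
  move=> zr; rewrite Nf ler_pdivrMr ?N_gt0 ?den // mul1r.
  rewrite -(@ler_pXn2r _ 2) ?nnegrE ?N_ge0 // !Nsqr.
  have := hneg z zr; move: fa; case: (f z) => x y; case: (f a) => x' y' /= h1 h2; nra.
have wa : w a = 0 by rewrite /w subrr mul0r.
have hq := dquot_holo hw.
have wq z : w z = (z - a) * dquot w a z by rewrite (dquotP w a z) {1}wa add0r.
have qb z : N (z - a) <= s -> N (dquot w a z) <= s^-1.
  apply: (max_principle hq s0 sr) => x xs.
  have : N (w x) <= 1 by apply: w1; rewrite xs.
  by rewrite wq NM xs -ler_pdivlMl // mulr1.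
split=> [z zs|].
  have zr := le_lt_trans zs sr; have dz := den _ zr.
  have -> : f z - f a = w z * (f z + (conjc (f a))) by rewrite /w divfK.
  rewrite NM mulrAC ler_wpM2r ?N_ge0 // wq NM -mulrA ler_piMr ?N_ge0 //.
  by rewrite -ler_pdivlMr // mul1r qb.
have := qb a; rewrite subrr N0 => /(_ (ltW s0)); rewrite /dquot eqxx.
have dz := den _ aa.
have dw : cderiv w a (der f a / (f a + (conjc (f a)))).
  have d1 := cderivB (derP (hf _ aa)) (cderiv_cst (f a) a).
  have d2 := @cderivV _ (fun x => f x + conjc (f a)) _ _ dz (cderivD (derP (hf _ aa)) (cderiv_cst (conjc (f a)) a)).
  apply: cderiv_eq (cderivM d1 d2) _; by rewrite subr0 addr0 subrr mul0r addr0.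
rewrite (derE dw) Nf.
have -> : N (f a + (conjc (f a))) = - Re (f a) *+ 2.
  rewrite (_ : f a + (conjc (f a)) = (Re (f a) *+ 2)%:C).
    by rewrite Nr ltr0_norm ?mulNrn // mulrn_wlt0.
  by case: (f a) => x y; apply/eqP; rewrite eq_complex /= addrN mulr2n !eqxx.
by rewrite ler_pdivrMr ?mulNrn ?oppr_gt0 ?mulrn_wlt0 // mulrC ler_pdivlMr.
Qed.

(** * Harnack's inequality for zero-free functions of modulus below 1 *)

Section Harnack.
Variables (f : C -> C) (a : C) (r s : R).
Hypotheses (hf : holo f a r) (s0 : 0 < s) (sr : s < r).
Hypothesis nz : forall z, N (z - a) < r -> f z != 0.
Hypothesis f1 : forall z, N (z - a) < r -> N (f z) < 1.

Let logf : exists phi, [/\ holo phi a ((s + r) / 2),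
  (forall z, N (z - a) < (s + r) / 2 -> Re (phi z) = ln (N (f z))),
  (forall z, N (z - a) < (s + r) / 2 -> Re (phi z) < 0) &
  der phi a = der f a / f a].
Proof.
have s0' := s0; have sr' := sr.
have m1 : (s + r) / 2 < r by lra.
have m2 : 0 < (s + r) / 2 by lra.
have [phi hphi] := @log_exists f a r ((s + r) / 2) hf m1 m2 nz.
exists phi; split.
- by move=> z /hphi [h _]; eexists; exact: h.
- by move=> z /hphi [].
- move=> z zs; have [_ ->] := hphi z zs; have zr : N (z - a) < r by lra.
  by apply: ln_lt0; rewrite N_gt0 nz // f1.
- have := hphi a; rewrite subrr N0 => -[|h _]; first by lra.
  exact: derE.
Qed.

(** Here - ln |f| is positive and is minus the real part of a logarithm of f, to which the
    half-plane form of Schwarz's lemma applies. *)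
Lemma harnack z (t : R) : N (z - a) <= t -> t < s ->
  (ln (N (f a)) * (s + t) <= ln (N (f z)) * (s - t)) /\
  (ln (N (f z)) * (s + t) <= ln (N (f a)) * (s - t)).
Proof.
move=> zt ts; have [phi [hphi ref neg _]] := logf.
have s0' := s0; have sr' := sr; have m1 : s < (s + r) / 2 by lra.
have [h _] := @schwarz_half_plane phi a ((s + r) / 2) s hphi s0 m1 neg.
have zs : N (z - a) <= s by lra.
rewrite -!ref ?subrr ?N0; [|lra|lra].
have := h z zs; have := neg z ltac:(lra); have := neg a ltac:(rewrite subrr N0; lra).
set u := phi z; set v := phi a => v0 u0 k.
have k2 : N (u - v) * s <= t * N (u + conjc v).
  by apply: le_trans k _; rewrite ler_wpM2r ?N_ge0.
have t0 : 0 <= t by apply: le_trans zt; exact: N_ge0.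
have k3 : (N (u - v) * s) ^+ 2 <= (t * N (u + conjc v)) ^+ 2.
  by rewrite lerXn2r ?nnegrE ?mulr_ge0 ?N_ge0 // ltW.
(* The imaginary parts contribute (Im u - Im v)^2 to both sides, with the larger weight s^2 >= t^2
   on the left, and drop out. *)
have k4 : (Re u - Re v) ^+ 2 * s ^+ 2 <= (Re u + Re v) ^+ 2 * t ^+ 2.
  move: k3; rewrite !exprMn !Nsqr !raddfB !raddfD /=.
  have -> : Re (conjc v) = Re v by case: (v).
  have -> : Im (conjc v) = - Im v by case: (v).
  have : t ^+ 2 <= s ^+ 2 by rewrite lerXn2r ?nnegrE //; lra.
  have := sqr_ge0 (Im u - Im v); nra.
have k5 : `|(Re u - Re v) * s| <= `|(Re u + Re v) * t|.
  by rewrite -(@ler_pXn2r _ 2) ?nnegrE // !real_normK ?num_real // !exprMn.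
move: k5; rewrite [X in _ <= X]ler0_norm; last by nra.
by rewrite ler_norml => /andP[m3 m4]; split; lra.
Qed.

Lemma harnack_der : N (der f a / f a) * s <= - ln (N (f a)) *+ 2.
Proof.
have [phi [hphi ref neg <-]] := logf.
have s0' := s0; have sr' := sr; have m1 : s < (s + r) / 2 by lra.
have [_ h] := @schwarz_half_plane phi a ((s + r) / 2) s hphi s0 m1 neg.
by rewrite -ref ?subrr ?N0 //; lra.
Qed.

End Harnack.
End ExpLog.

(** * Growth of entire functions *)

Section Quotients.
Variable R : realType.
Local Notation C := R[i].
Local Notation N := (@normc R).
Local Notation Re := (@complex.Re R).
Local Notation Im := (@complex.Im R).
Implicit Types (f g P L E : C -> C) (z w l a b h y x : C).

Lemma dquot_holo_at f a (r : R) b : holo f a r -> N (b - a) < r -> holo (dquot f b) a r.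
Proof.
move=> hf br z zr; have [->|zb] := eqVneq z b.
  apply: (@dquot_holo _ f b (r - N (b - a))); last by rewrite subrr N0 subr_gt0.
  by apply: holo_sub hf; lra.
have zb0 : z - b != 0 by rewrite subr_eq0.
apply: (@cdiff_ext _ (fun z => (f z - f b) / (z - b))).
  exists (N (z - b)); first by rewrite N_gt0.
  move=> h hh; rewrite /dquot; case: eqVneq => // e.
  by move: hh; rewrite -NN (_ : - h = z - b) ?ltxx // -e; ring.
apply: cdiffM; first by apply: cdiffB; [exact: hf|exact: cdiff_cst].
by apply: cdiffV => //; apply: cdiffB; [exact: cdiff_id|exact: cdiff_cst].
Qed.

Lemma blaschke_identity (rho : R) (be zt : C) :
  N ((rho ^+ 2)%:C - conjc be * zt) ^+ 2 - rho ^+ 2 * N (zt - be) ^+ 2 =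
  (rho ^+ 2 - N be ^+ 2) * (rho ^+ 2 - N zt ^+ 2).
Proof. by rewrite !Nsqr; case: be zt => [x y] [x' y'] /=; ring. Qed.

Lemma pow_unbounded (t K : R) : 1 < t -> exists n : nat, K < t ^+ n.
Proof.
move=> t1; apply: contrapT => h; have : t <= 1.
  apply: (@max_bernoulli _ t K) => [|n]; first by lra.
  by rewrite leNgt; apply/negP => k; apply: h; exists n.
by rewrite leNgt t1.
Qed.

(* P = (P L) / L is estimated at the centre: dividing L by Blaschke factors
   makes it zero-free without destroying |L| <= 1 and |P L| <= 1, and then
   Harnack's inequality bounds L from below. *)
Lemma quotient_bound P L a (r0 rho rho' r s c : R) y :
  holo P a r0 -> holo L a r0 -> rho < r0 -> rho' < rho -> r < rho' -> s < r -> 0 <= s ->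
  (forall z, N (z - a) <= rho -> N (L z) <= 1) ->
  (forall z, N (z - a) <= rho -> N (P z * L z) <= 1) ->
  N (y - a) <= s -> 0 < c -> c <= N (L y) ->
  N (P a) <= expR (ln (2 / c) * ((r + s) / (r - s))).
Proof.
move=> hP hL h1 h2 h3 h4 s0 L1 PL1 ys c0 cy.
(* Each division by a Blaschke factor multiplies |L y|^2 by at least 1 + eta, while |L y| starts at
   c or more and never exceeds 1. This bounds the number of divisions by n, on which the induction
   runs, without counting zeros. *)
set eta := (rho ^+ 2 - rho' ^+ 2) ^+ 2 / (4 * rho ^+ 4).
have rho0 : 0 < rho by lra.
have kap : 0 < rho ^+ 2 - rho' ^+ 2 by rewrite !expr2; nra.
have eta0 : 0 < eta by rewrite divr_gt0 ?mulr_gt0 ?exprn_gt0.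
have [n hn] : exists n, (c ^+ 2)^-1 < (1 + eta) ^+ n by apply: pow_unbounded; lra.
have {hn} hn : 1 < N (L y) ^+ 2 * (1 + eta) ^+ n.
  apply: (@lt_le_trans _ _ (c ^+ 2 * (1 + eta) ^+ n)).
    by rewrite mulrC -ltr_pdivrMr ?exprn_gt0 // mul1r.
  by rewrite ler_wpM2r ?exprn_ge0 ?lerXn2r ?nnegrE ?N_ge0 ?(ltW c0) //; lra.
elim: n L hL L1 PL1 cy hn => [|n IH] L hL L1 PL1 cy hn.
  have : N (L y) <= 1 by apply: L1; lra.
  by move: hn; rewrite expr0 mulr1 expr2; have := N_ge0 (L y); nra.
case: (pselect (exists2 b, N (b - a) < rho' & L b = 0)) => [[b br Lb]|nz].
  pose D z := (rho ^+ 2)%:C - conjc (b - a) * (z - a).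
  have br0 : N (b - a) < r0 by lra.
  have rn : rho%:C != 0 :> C by rewrite -N_gt0 Nr normr_gt0 gt_eqF.
  pose L' z := dquot L b z * (D z / rho%:C).
  have LE z : L z = (z - b) * dquot L b z by rewrite (dquotP L b z) {1}Lb add0r.
  have hD z : cdiff D z.
    apply: cdiffB; first exact: cdiff_cst.
    by apply: cdiffM; [exact: cdiff_cst|apply: cdiffB; [exact: cdiff_id|exact: cdiff_cst]].
  have hL' : holo L' a r0.
    move=> z zr; apply: cdiffM; first exact: (dquot_holo_at hL br0).
    by apply: cdiffM; [exact: hD|exact: cdiff_cst].
  have idD z : N (D z) ^+ 2 = rho ^+ 2 * N (z - b) ^+ 2 +
      (rho ^+ 2 - N (b - a) ^+ 2) * (rho ^+ 2 - N (z - a) ^+ 2).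
    rewrite -blaschke_identity (_ : z - a - (b - a) = z - b); last by ring.
    by rewrite /D; ring.
  have circ z : N (z - a) = rho -> N (L' z) = N (L z).
    move=> zr; have : N (D z) ^+ 2 = (rho * N (z - b)) ^+ 2.
      by rewrite idD zr subrr mulr0 addr0 exprMn.
    move/eqP; rewrite eqrXn2 ?mulr_ge0 ?N_ge0 ?(ltW rho0) // => /eqP e.
    by rewrite /L' NM Nf e Nr (gtr0_norm rho0) LE NM mulrC [rho * _]mulrC mulfK // gt_eqF.
  have key : N (L y) ^+ 2 * (1 + eta) <= N (L' y) ^+ 2.
    set X := N (D y) ^+ 2; set T := N (L y) ^+ 2; set A := N (L' y) ^+ 2.
    set kp := rho ^+ 2 - rho' ^+ 2.
    have T0 : 0 < T by rewrite exprn_gt0 //; lra.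
    have e1 : A * (rho ^+ 2 * N (y - b) ^+ 2) = T * X.
      rewrite /A /T /X /L' LE !NM NV Nr (gtr0_norm rho0); field; by rewrite gt_eqF.
    have e2 : rho ^+ 2 * N (y - b) ^+ 2 <= X - kp ^+ 2.
      rewrite /X idD /kp.
      have u1 : rho ^+ 2 - rho' ^+ 2 <= rho ^+ 2 - N (b - a) ^+ 2.
        by rewrite lerD2l lerN2 lerXn2r ?nnegrE ?N_ge0 //; have := N_ge0 (b - a); lra.
      have u2 : rho ^+ 2 - rho' ^+ 2 <= rho ^+ 2 - N (y - a) ^+ 2.
        by rewrite lerD2l lerN2 lerXn2r ?nnegrE ?N_ge0 //; lra.
      have := ler_pM (ltW kap) (ltW kap) u1 u2; rewrite expr2; lra.
    have e3 : X <= 4 * rho ^+ 4.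
      have : N (D y) <= 2 * rho ^+ 2.
        apply: le_trans (NB _ _) _; rewrite Nr ger0_norm ?sqr_ge0 // NM NJ.
        have : N (b - a) * N (y - a) <= rho * rho by apply: ler_pM; rewrite ?N_ge0 //; lra.
        by rewrite expr2; lra.
      have k : 0 <= N (D y) by exact: N_ge0.
      move=> k2; rewrite /X; have := ler_pM k k k2 k2; rewrite -!expr2 exprMn -exprM; lra.
    have A0 : 0 <= A by rewrite exprn_ge0 ?N_ge0.
    have X0 : 0 <= X by rewrite exprn_ge0 ?N_ge0.
    have e4 : T * X <= A * (X - kp ^+ 2) by rewrite -e1 ler_wpM2l.
    have Xp : 0 < X.
      have u1 : 0 <= rho ^+ 2 * N (y - b) ^+ 2 by rewrite mulr_ge0 ?exprn_ge0 ?N_ge0 // ltW.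
      have u2 : 0 < kp ^+ 2 by rewrite exprn_gt0.
      lra.
    have Y0 : 0 < X - kp ^+ 2.
      rewrite ltNge; apply/negP => Y0; have : 0 < T * X by rewrite mulr_gt0.
      by have := mulr_ge0_le0 A0 Y0; lra.
    rewrite -(ler_pM2r Y0); apply: le_trans e4; rewrite -mulrA ler_pM2l //.
    have e5 : eta * X <= kp ^+ 2.
      by rewrite /eta mulrAC ler_pdivrMr ?mulr_gt0 ?exprn_gt0 // ler_pM2l ?exprn_gt0.
    have : 0 <= eta * kp ^+ 2 by rewrite mulr_ge0 ?exprn_ge0 // ltW.
    lra.
  apply: (IH L' hL').
  - apply: (max_principle hL' rho0 h1) => z zr; rewrite circ //; apply: L1; lra.
  - have hPL : holo (fun z => P z * L' z) a r0 by move=> z zr; apply: cdiffM; [exact: hP|exact: hL'].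
    by apply: (max_principle hPL rho0 h1) => z zr; rewrite NM circ // -NM; apply: PL1; lra.
  - apply: le_trans cy _; rewrite -(@ler_pXn2r _ 2) ?nnegrE ?N_ge0 //; apply: le_trans key.
    by rewrite ler_peMr ?exprn_ge0 ?N_ge0 //; lra.
  move: hn; rewrite [(1 + eta) ^+ n.+1]exprS mulrA => hn; apply: lt_le_trans hn _.
  by rewrite ler_wpM2r // exprn_ge0 //; lra.
(* L is halved to get the strict bound by 1 in Harnack's inequality; this is the 2 in ln (2 / c). *)
have hf : holo (fun z => 1 / 2 * L z) a rho'.
  by apply: (holoW (r := r0)); [lra|move=> z zr; apply: cdiffM; [exact: cdiff_cst|exact: hL]].
have N2 z : N (1 / 2 * L z) = N (L z) / 2.
  by rewrite NM Nf N1 Nnat mulrC mul1r.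
have f1 z : N (z - a) < rho' -> N (1 / 2 * L z) < 1.
  by move=> zr; rewrite N2; have := L1 z ltac:(lra); lra.
have fnz z : N (z - a) < rho' -> 1 / 2 * L z != 0.
  move=> zr; rewrite mulf_neq0 // ?mul1r ?invr_eq0 ?pnatr_eq0 //.
  by apply/eqP => e; apply: nz; exists z.
have [|_ k] := harnack hf _ h3 fnz f1 ys h4; first by lra.
have aa : N (a - a) < rho' by rewrite subrr N0; lra.
have fa : 0 < N (1 / 2 * L a) by rewrite N_gt0 fnz.
have p1 : N (P a) <= (N (1 / 2 * L a))^-1.
  have := PL1 a ltac:(rewrite subrr N0; lra); rewrite NM => q.
  rewrite -[leRHS]mul1r ler_pdivlMr // N2; have := N_ge0 (P a); have := N_ge0 (L a); nra.
apply: le_trans p1 _; rewrite -[X in X^-1](@lnK _ (N (1 / 2 * L a))) ?posrE // -expRN ler_expR.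
have k1 : ln (c / 2) <= ln (N (1 / 2 * L y)).
  by rewrite ler_ln ?posrE ?N2 ?divr_gt0 //; lra.
have k2 : ln (2 / c) = - ln (c / 2) by rewrite -invf_div lnV ?posrE ?divr_gt0.
have rs : 0 < r - s by lra.
rewrite k2 mulrA ler_pdivlMr // !mulNr lerN2; apply: le_trans k; rewrite ler_wpM2r //; lra.
Qed.

(** A substitute for Jensen's formula. For a zero b within 2 rho of a, the factor (z - b) / (6 rho)
    has modulus at least 1 on |z - a| = 8 rho, so dividing by it keeps the bound A, and modulus at
    most 1/3 at a, so it gains a factor 3 there. Since c 3^m cannot exceed A, the divisions stop. *)
Lemma zeros_factor P a (r0 rho A c : R) :
  holo P a r0 -> 0 < rho -> 8 * rho < r0 ->
  (forall z, N (z - a) <= 8 * rho -> N (P z) <= A) -> 0 < c -> c <= N (P a) ->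
  exists (s : seq C) E, [/\ holo E a r0, forall z, N (z - a) < 2 * rho -> E z != 0,
    forall z, P z = (\prod_(b <- s) ((z - b) / (6 * rho)%:C)) * E z,
    forall z, N (z - a) <= 8 * rho -> N (E z) <= A
    & c * 3 ^+ size s <= N (E a)].
Proof.
move=> hP rho0 rr PA c0 ca.
have [n hn] : exists n : nat, A / c < 3 ^+ n by apply: pow_unbounded; lra.
move: hn; rewrite ltr_pdivrMr // mulrC => hn.
elim: n P c hP PA c0 ca hn => [|n IH] P c hP PA c0 ca hn.
  have := PA a; rewrite subrr N0 => /(_ ltac:(lra)); move: hn; rewrite expr0; lra.
case: (pselect (exists2 b, N (b - a) < 2 * rho & P b = 0)) => [[b br Pb]|nz]; last first.
  exists [::], P; split=> //; last by rewrite expr0 mulr1.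
    by move=> z zr; apply/eqP => e; apply: nz; exists z.
  by move=> z; rewrite big_nil mul1r.
have r6 : (6 * rho)%:C != 0 :> C by rewrite -N_gt0 Nr normr_gt0 gt_eqF ?mulr_gt0.
have ba : b != a by apply/eqP => e; move: ca; rewrite -e Pb N0; lra.
have Nba : 0 < N (b - a) by rewrite N_gt0 subr_eq0.
pose P' z := (6 * rho)%:C * dquot P b z.
have PE z : P z = (z - b) / (6 * rho)%:C * P' z.
  by rewrite (dquotP P b z) {1}Pb add0r /P' mulrA divfK.
have hP' : holo P' a r0.
  by move=> z zr; apply: cdiffM; [exact: cdiff_cst|apply: (dquot_holo_at hP) => //; lra].
have P'A z : N (z - a) <= 8 * rho -> N (P' z) <= A.
  move: z; apply: (max_principle hP') => // [|z zr]; first by lra.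
  have := PA z ltac:(lra); rewrite PE NM Nf Nr gtr0_norm ?mulr_gt0 // => k.
  apply: le_trans k; rewrite ler_peMl ?N_ge0 // ler_pdivlMr ?mulr_gt0 // mul1r.
  by have := ND3 b a z; lra.
have cP' : c * 3 <= N (P' a).
  move: ca; rewrite PE NM Nf Nr gtr0_norm ?mulr_gt0 // NC => k.
  have k2 : N (b - a) / (6 * rho) <= 1 / 3.
    by rewrite ler_pdivrMr ?mulr_gt0 //; lra.
  have := ler_wpM2r (N_ge0 (P' a)) k2; lra.
have [||s [E [e1 e2 e3 e4 e5]]] := IH P' (c * 3) hP' P'A _ cP'; [lra|by rewrite -mulrA -exprS|].
exists (b :: s), E; split=> //.
  by move=> z; rewrite big_cons PE e3 mulrA.
by rewrite /= exprS mulrA.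
Qed.

Lemma logder_prod (s : seq C) (k : C) E z : k != 0 -> E z != 0 -> cdiff E z ->
  (forall b, b \in s -> z != b) ->
  cdiff (fun z => (\prod_(b <- s) ((z - b) / k)) * E z) z /\
  der (fun z => (\prod_(b <- s) ((z - b) / k)) * E z) z / ((\prod_(b <- s) ((z - b) / k)) * E z) =
  \sum_(b <- s) (z - b)^-1 + der E z / E z.
Proof.
move=> k0 Ez dE; elim: s => [|b s IH] hs.
  have e : near0 (fun h => E (z + h) = (\prod_(b <- [::]) ((z + h - b) / k)) * E (z + h)).
    by apply: near0T => h; rewrite big_nil mul1r.
  have d := @cderiv_ext _ E (fun z => (\prod_(b <- [::]) ((z - b) / k)) * E z) z _ e (derP dE).
  by split; [exists (der E z)|rewrite (derE d) !big_nil mul1r add0r].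
have [|[l hl] E1] := IH; first by move=> x xs; apply: hs; rewrite inE xs orbT.
set Q := fun z => (\prod_(b <- s) ((z - b) / k)) * E z in hl E1.
have zb : z - b != 0 by rewrite subr_eq0; apply: hs; rewrite inE eqxx.
have Q0 : Q z != 0.
  rewrite mulf_neq0 // prodf_seq_neq0; apply/allP => x xs /=.
  by rewrite mulf_neq0 ?invr_eq0 // subr_eq0 hs // inE xs orbT.
have d1 : cderiv (fun z => (z - b) / k) z (k^-1).
  have d := cderivMl k^-1 (cderivB (cderiv_id z) (cderiv_cst b z)).
  rewrite subr0 mulr1 in d; apply: cderiv_ext d; by apply: near0T => h; rewrite mulrC.
have d2 := cderivM d1 hl.
have e : near0 (fun h => (z + h - b) / k * Q (z + h) = (\prod_(b <- b :: s) ((z + h - b) / k)) * E (z + h)).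
  by apply: near0T => h; rewrite big_cons mulrA.
have d3 := @cderiv_ext _ _ (fun z => (\prod_(b <- b :: s) ((z - b) / k)) * E z) z _ e d2.
split; first by eexists; exact: d3.
have e5 : (\prod_(b <- b :: s) ((z - b) / k)) * E z = (z - b) / k * Q z.
  by rewrite big_cons /Q mulrA.
rewrite (derE d3) e5 big_cons -addrA -E1 (derE hl) -/(Q z).
by field; rewrite zb Q0 k0.
Qed.

(** Pigeonhole: among (size s) + 1 radii spaced by 2 de, if each were within de of an element of s,
    two of them would share an element and be closer than 2 de. *)
Lemma good_radius (s : seq R) (rho : R) : 0 < rho ->
  exists r : R, [/\ rho / 2 <= r, r <= rho &
    forall t, t \in s -> rho / 4 / (size s).+1%:R <= `|t - r|].
Proof.
move=> rho0; set m := size s; set de := rho / 4 / m.+1%:R.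
have m0 : (0 : R) < m.+1%:R by rewrite ltr0n.
have de0 : 0 < de by rewrite !divr_gt0.
pose r (i : nat) : R := rho / 2 + i%:R * (2 * de).
have rb i : (i <= m)%N -> rho / 2 <= r i <= rho.
  move=> im; have k : (i%:R : R) <= m.+1%:R by rewrite ler_nat; exact: leqW.
  have k2 : i%:R * de <= rho / 4.
    by rewrite /de mulrA ler_pdivrMr // mulrC ler_wpM2l // divr_ge0 // ltW.
  by rewrite /r; have : 0 <= i%:R * de by [rewrite mulr_ge0 // ltW]; lra.
apply: contrapT => H.
have K (i : 'I_m.+1) : exists j : 'I_m, `|nth 0 s j - r i| < de.
  apply: contrapT => H2; apply: H; exists (r i); have /andP[r1 r2] := rb i (leq_ord i).
  split=> // t ts; rewrite leNgt; apply/negP => lt; apply: H2.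
  have im : (index t s < m)%N by rewrite index_mem.
  by exists (Ordinal im); rewrite /= nth_index.
have {K} /choice[g hg] := K.
have : ~~ injectiveb g.
  apply/negP => /injectiveP inj; have := leq_card g inj; rewrite !card_ord ltnn //.
case/injectivePn => i [i' ii' e].
have h1 := hg i; have h2 := hg i'; rewrite -e in h2.
set t := nth 0 s (g i) in h1 h2.
have : `|r i - r i'| < 2 * de.
  rewrite (_ : r i - r i' = (t - r i') - (t - r i)); last by ring.
  by apply: le_lt_trans (ler_normB _ _) _; lra.
rewrite /r (_ : _ - _ = (i%:R - i'%:R) * (2 * de)); last by ring.
rewrite normrM (gtr0_norm (_ : 0 < 2 * de)) ?mulr_gt0 //.
rewrite -[ltRHS]mul1r ltr_pM2r ?mulr_gt0 // => h.
have {}ii' : i != i' :> nat by [].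
move: h; rewrite ltNge => /negP; apply.
wlog ij : i i' ii' {h1 h2 e t} / (i < i')%N.
  move=> H2; case: (ltngtP i i') ii' => // ij ii'; first by apply: H2; rewrite // neq_ltn ij.
  by rewrite distrC; apply: H2; rewrite // neq_ltn ij.
by rewrite distrC -natrB ?(ltnW ij) // normr_nat ler1n subn_gt0.
Qed.

(** P' / P is a sum of (z - b)^-1 over O(rho) zeros plus E' / E with E zero-free. On a good radius
    each of the first terms is O(1). For the second, Harnack's inequality bounds - ln |E| on the
    circle by its value at a, and then [harnack_der] bounds the logarithmic derivative. *)
Lemma good_circle P a (C0 : R) : entire P -> P a != 0 -> 0 <= C0 ->
  (forall z, N (P z) <= expR (C0 * (1 + N (z - a)))) ->
  exists K : R, forall rho : R, 1 <= rho -> exists r : R, [/\ rho / 2 <= r, r <= rho &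
    forall z, N (z - a) = r -> P z != 0 /\ N (der P z / P z) <= K * rho].
Proof.
move=> hP Pa C00 PA; set c := N (P a); have c0 : 0 < c by rewrite N_gt0.
pose l3 : R := ln 3; have l30 : 0 < l3 by apply: ln_gt0; lra.
(* From c 3^m <= A one gets m ln 3 <= 9 C0 rho + |ln c| rho for the number m of zeros; the + 1
   accounts for m + 1 in place of m. *)
pose K1 := (9 * C0 + `|ln c|) / l3 + 1.
have K10 : 1 <= K1 by rewrite lerDr divr_ge0 ?(ltW l30) // addr_ge0 ?normr_ge0 // mulr_ge0.
pose K2 := 20 * (1 + 9 * C0 + `|ln c|).
exists (4 * K1 ^+ 2 + K2) => rho rho1; have rho0 : 0 < rho by lra.
pose A := expR (C0 * (1 + 8 * rho)).
have hPr : holo P a (9 * rho) by move=> z _; exact: hP.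
have PA' z : N (z - a) <= 8 * rho -> N (P z) <= A.
  by move=> zr; apply: le_trans (PA z) _; rewrite ler_expR ler_wpM2l // lerD2l.
have [|s [E [e1 e2 e3 e4 e5]]] := zeros_factor hPr rho0 _ PA' c0 (lexx _); first by lra.
set m := size s in e5.
have Ea : N (E a) <= A by apply: e4; rewrite subrr N0; lra.
have cEa : c <= N (E a).
  by apply: le_trans e5; rewrite ler_peMr ?(ltW c0) // exprn_ege1 // ler1n.
have lnA : ln A <= 9 * C0 * rho.
  rewrite /A expRK; have := ler_wpM2l C00 rho1; lra.
have lcr : `|ln c| <= `|ln c| * rho by rewrite ler_peMr.
have lc1 : - ln c <= `|ln c| by rewrite -normrN ler_norm.
have mK : m.+1%:R <= K1 * rho.
  have : ln (c * 3 ^+ m) <= ln A by rewrite ler_ln ?posrE ?expR_gt0 ?mulr_gt0 ?exprn_gt0 //; exact: le_trans Ea.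
  rewrite lnM ?posrE ?exprn_gt0 // lnXn // -/l3 -mulr_natr => k.
  have k2 : m%:R <= (9 * C0 + `|ln c|) / l3 * rho.
    rewrite mulrAC ler_pdivlMr // mulrC; lra.
  rewrite -(@natr1 _ m) /K1 mulrDl mul1r; lra.
have [r [r1 r2 hr]] := good_radius [seq N (b - a) | b <- s] rho0.
rewrite size_map -/m in hr.
exists r; split=> // z zr.
have zE : E z != 0 by apply: e2; lra.
have m0 : (0 : R) < m.+1%:R by rewrite ltr0n.
have zb b : b \in s -> rho / 4 / m.+1%:R <= N (z - b).
  move=> bs; have k := hr _ (map_f (fun b => N (b - a)) bs); apply: le_trans k _.
  rewrite -zr ler_norml; have := ND3 b a z; have := ND3 z a b; rewrite (NC b z).
  by move=> k1 k2; apply/andP; split; lra.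
have zb' b : b \in s -> z != b.
  move=> /zb; apply: contraTneq => ->; rewrite subrr N0 -ltNge.
  by rewrite !divr_gt0.
have r6 : (6 * rho)%:C != 0 :> C by rewrite -N_gt0 Nr normr_gt0 gt_eqF ?mulr_gt0.
have dE : cdiff E z by apply: e1; lra.
have [_ LD] := logder_prod r6 zE dE zb'.
have Pz : P z != 0.
  rewrite e3 mulf_neq0 // prodf_seq_neq0; apply/allP => b bs /=.
  by rewrite mulf_neq0 ?invr_eq0 // subr_eq0 zb'.
split=> //.
have -> : der P z / P z = \sum_(b <- s) (z - b)^-1 + der E z / E z.
  by rewrite -LD e3; congr (_ / _); apply: der_ext; apply: near0T => h; exact: e3.
apply: le_trans (ND _ _) _; rewrite mulrDl; apply: lerD.
  apply: le_trans (N_sum _ _ _) _.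
  apply: (@le_trans _ _ (\sum_(b <- s) (4 * K1))).
    rewrite big_seq [leRHS]big_seq; apply: ler_sum => b bs; rewrite NV.
    have k : 0 < rho / 4 / m.+1%:R by rewrite !divr_gt0.
    apply: (@le_trans _ _ (rho / 4 / m.+1%:R)^-1).
      by rewrite lef_pV2 ?posrE ?N_gt0 ?subr_eq0 ?zb' // zb.
    rewrite !invf_div mulrA ler_pdivrMr //; lra.
  rewrite big_const_seq count_predT iter_addr_0 -/m -mulr_natr.
  have : m%:R <= K1 * rho by apply: le_trans mK; rewrite ler_nat.
  by move=> k; have := ler_wpM2l (_ : 0 <= 4 * K1) k; rewrite expr2; lra.
have A0 : 0 < A by exact: expR_gt0.
pose f z := (2 * A)^-1%:C * E z.
have Nf' w : N (f w) = N (E w) / (2 * A).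
  by rewrite NM Nr gtr0_norm ?invr_gt0 ?mulr_gt0 // mulrC.
have hf : holo f a (2 * rho).
  by move=> w wr; apply: cdiffM; [exact: cdiff_cst|apply: e1; lra].
have fnz w : N (w - a) < 2 * rho -> f w != 0.
  by move=> wr; rewrite mulf_neq0 ?e2 // -N_gt0 Nr normr_gt0 gt_eqF ?invr_gt0 ?mulr_gt0.
have f1 w : N (w - a) < 2 * rho -> N (f w) < 1.
  by move=> wr; rewrite Nf' ltr_pdivrMr ?mulr_gt0 //; have := e4 w ltac:(lra); lra.
have s1 : 0 < 3 / 2 * rho by lra.
have s2 : 3 / 2 * rho < 2 * rho by lra.
have zt : N (z - a) <= rho by lra.
have [k1 _] := harnack hf s1 s2 fnz f1 zt ltac:(lra).
have hz : holo f z rho by apply: holo_sub hf; lra.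
have inz w : N (w - z) < rho -> N (w - a) < 2 * rho.
  by move=> k; apply: le_lt_trans (ND3 z _ _) _; lra.
have s3 : 0 < rho / 2 by lra.
have s4 : rho / 2 < rho by lra.
have k2 := harnack_der hz s3 s4 (fun w k => fnz w (inz w k)) (fun w k => f1 w (inz w k)).
have fE : der f z / f z = der E z / E z.
  rewrite (derE (cderivMl (2 * A)^-1%:C (derP dE))) /f.
  by rewrite -mulf_div divff ?mul1r // -N_gt0 Nr normr_gt0 gt_eqF ?invr_gt0 ?mulr_gt0.
rewrite fE in k2.
have k3 : - ln (N (f a)) <= ln 2 + ln A - ln c.
  have : ln (c / (2 * A)) <= ln (N (f a)).
    rewrite ler_ln ?posrE ?Nf' ?divr_gt0 ?mulr_gt0 //; last exact: lt_le_trans cEa.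
    by rewrite ler_pM2r // invr_gt0 mulr_gt0.
  rewrite ln_div ?posrE ?mulr_gt0 // lnM ?posrE //; lra.
have ln2 : ln 2 <= 1 :> R.
  have : ln (2 : R) <= ln (expR 1) by rewrite ler_ln ?posrE ?expR_gt0 //; have := expR_ge1Dx (1 : R); lra.
  by rewrite expRK.
(* The 5 is (s + t) / (s - t) for s = 3/2 rho and t = rho. *)
have k4 : - ln (N (f z)) <= 5 * - ln (N (f a)).
  move: k1; rewrite (_ : 3 / 2 * rho + rho = 5 * (rho / 2)); last by field.
  rewrite (_ : 3 / 2 * rho - rho = rho / 2); last by field.
  by rewrite mulrA ler_pM2r //; lra.
have k5 : N (der E z / E z) * (rho / 2) <= K2 * rho * (1 / 2).
  apply: le_trans k2 _; rewrite mulr2n /K2; have := rho1; nra.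
have k6 : N (der E z / E z) * rho <= K2 * rho by lra.
move: k6; rewrite ler_pM2r // => k6; apply: le_trans k6 _.
by rewrite ler_peMr // /K2 mulr_ge0 // addr_ge0 ?normr_ge0 // addr_ge0 // mulr_ge0.
Qed.

Lemma dquot_mul f a z : (z - a) * dquot f a z = f z - f a.
Proof. by rewrite [in RHS](dquotP f a z) addrAC subrr add0r. Qed.

Lemma entire_dquot f a : entire f -> entire (dquot f a).
Proof.
move=> hf z; apply: (@dquot_holo _ f a (N (z - a) + 1)); last by lra.
exact: entire_holo.
Qed.

Lemma small_on_circles f a (K : R) : entire f ->
  (forall rho : R, 1 <= rho -> exists r : R, [/\ rho / 2 <= r, r <= rho &
    forall z, N (z - a) = r -> N (f z) <= K / rho]) -> forall z, f z = 0.
Proof.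
move=> hf h z; apply: N_small => e e0.
pose rho := 2 * (N (z - a) + 1) + `|K| / e.
have Ke : 0 <= `|K| / e by rewrite divr_ge0 // ltW.
have z0 := N_ge0 (z - a).
have rho1 : 1 <= rho by rewrite /rho; lra.
have [r [r1 r2 hr]] := h rho rho1.
have r0 : 0 < r by lra.
have := @max_principle _ f a (r + 1) r (K / rho) (entire_holo hf) r0 ltac:(lra) hr z.
rewrite /rho in r1 *; move=> /(_ ltac:(lra)) k; apply: le_trans k _.
rewrite ler_pdivrMr; last by lra.
have : K <= `|K| / e * e by rewrite divfK ?ler_norm // gt_eqF.
nra.
Qed.

(** Liouville's theorem by induction on the degree: the difference quotient at a grows one degree
    less, and f inherits its alternative. One circle in each range [rho / 2, rho] is enough by the
    maximum principle, which matters because the estimates of P' / P hold only on circles that avoid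
    the zeros of P. *)
Lemma poly_growth (d : nat) f a (K : R) : entire f ->
  (forall rho : R, 1 <= rho -> exists r : R, [/\ rho / 2 <= r, r <= rho &
    forall z, N (z - a) = r -> N (f z) <= K * rho ^+ d]) ->
  (forall z, f z = f a) \/
  (forall M : R, exists rho : R, forall z, rho <= N (z - a) -> M <= N (f z)).
Proof.
elim: d f K => [|d IH] f K hf hK; have hq := @entire_dquot f a hf.
  left => z; rewrite (dquotP f a z) (_ : dquot f a z = 0) ?mulr0 ?addr0 //.
  apply: (@small_on_circles _ a (2 * (K + N (f a)))) => // rho rho1.
  have [r [r1 r2 hr]] := hK rho rho1; exists r; split=> // w wr.
  have r0 : 0 < r by lra.
  have wa : 0 < N (w - a) by rewrite wr.
  have : N (w - a) * N (dquot f a w) <= K + N (f a).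
    rewrite -NM (_ : _ * _ = f w - f a); last exact: dquot_mul.
    by apply: le_trans (NB _ _) _; have := hr w wr; rewrite expr0; lra.
  rewrite wr ler_pdivlMr; last by lra.
  have := N_ge0 (dquot f a w); nra.
have [|cst|inf] := IH (dquot f a) (2 * (`|K| + N (f a))) hq.
- move=> rho rho1; have [r [r1 r2 hr]] := hK rho rho1; exists r; split=> // w wr.
  have r0 : 0 < r by lra.
  have P1 : 1 <= rho ^+ d.+1 by rewrite exprn_ege1.
  have : N (w - a) * N (dquot f a w) <= (`|K| + N (f a)) * rho ^+ d.+1.
    rewrite -NM (_ : _ * _ = f w - f a); last exact: dquot_mul.
    apply: le_trans (NB _ _) _; have := hr w wr.
    have := ler_wpM2r (_ : 0 <= rho ^+ d.+1) (ler_norm K).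
    have := ler_wpM2l (N_ge0 (f a)) P1; lra.
  rewrite wr exprS => k; have rho0 : 0 < rho by lra.
  rewrite -(ler_pM2l rho0); have := N_ge0 (dquot f a w); move: k.
  set D := N _; set Q := rho ^+ d; set F := `|K| + _; move=> k D0.
  have : rho / 2 * D <= r * D by rewrite ler_wpM2r.
  lra.
- case: (eqVneq (dquot f a a) 0) => [q0|q0].
    by left => z; rewrite (dquotP f a z) cst q0 mulr0 addr0.
  right => M; have q1 : 0 < N (dquot f a a) by rewrite N_gt0.
  exists ((`|M| + N (f a)) / N (dquot f a a)) => z; rewrite ler_pdivrMr // => k.
  rewrite (dquotP f a z) cst addrC; apply: le_trans (_ : _ <= N ((z - a) * dquot f a a) - N (f a)) (ND_ge _ _).
  by rewrite NM; have := ler_norm M; lra.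
right => M; have [rho hrho] := inf (`|M| + N (f a)).
exists (Num.max 1 rho) => z; rewrite ge_max => /andP[z1 z2].
rewrite (dquotP f a z) addrC; apply: le_trans (_ : _ <= N ((z - a) * dquot f a z) - N (f a)) (ND_ge _ _).
rewrite NM; have := hrho z z2; have := ler_norm M; have := normr_ge0 M; have := N_ge0 (f a).
set D := N (dquot _ _ _); nra.
Qed.

End Quotients.

(** * Maps to the Riemann sphere and their limits *)

Section UltraHolo.
Variable R : realType.
Local Notation C := R[i].
Local Notation N := (@normc R).
Implicit Types (f g : C -> C) (z w l a b h y x : C).

Definition dern k f : C -> C := iter k (@der R) f.

Lemma dern_holo k f a (r : R) : holo f a r -> holo (dern k f) a r.
Proof. by move=> hf; elim: k => //= k IH; exact: holo_der. Qed.

Lemma dern_ext k f g a (r : R) : (forall z, N (z - a) < r -> f z = g z) ->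
  forall z, N (z - a) < r -> dern k f z = dern k g z.
Proof.
move=> h; elim: k => [|k IH] //= z zr; apply: der_ext.
by apply: (@near0_ball _ (fun w => dern k f w = dern k g w) a z r).
Qed.

Lemma der_bd f a (r B : R) : 0 < r -> holo f a r ->
  (forall z, N (z - a) < r -> N (f z) <= B) ->
  forall z, N (z - a) < r / 2 -> N (der f z) <= 4 * B / r.
Proof.
move=> r0 hf hB z zr.
have hz : holo f z (r / 2) by apply: holo_sub hf; lra.
have := @cauchy_est _ f z (r / 2) hz (r / 4) B ltac:(lra) ltac:(lra).
rewrite (_ : B / (r / 4) = 4 * B / r); last by field; rewrite gt_eqF.
apply => w wz; apply: hB; apply: le_lt_trans (ND3 z _ _) _; lra.
Qed.

(** B' is chosen before f and a, so that one bound serves a whole sequence and all centres; each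
    derivative costs half of the radius. *)
Lemma dern_bd k (r B : R) : 0 < r -> exists B' : R, forall f a, holo f a r ->
  (forall z, N (z - a) < r -> N (f z) <= B) ->
  forall z, N (z - a) < r / 2 ^+ k -> N (dern k f z) <= B'.
Proof.
move=> r0; elim: k => [|k [B' IH]]; first by exists B => f a hf hB z; rewrite expr0 divr1; exact: hB.
have rk : 0 < r / 2 ^+ k by rewrite divr_gt0 ?exprn_gt0.
exists (4 * B' / (r / 2 ^+ k)) => f a hf hB z zr.
apply: (@der_bd (dern k f) a) => //.
- apply: holoW (dern_holo k hf).
  by rewrite ler_pdivrMr ?exprn_gt0 // ler_peMr ?(ltW r0) // exprn_ege1 // ler1n.
- exact: IH.
by rewrite (_ : r / 2 ^+ k / 2 = r / 2 ^+ k.+1) // exprSr invfM mulrA.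
Qed.

Definition bholo (f_ : nat -> C -> C) a (r B : R) :=
  UF [set j | holo (f_ j) a r /\ forall z, N (z - a) < r -> N (f_ j z) <= B].

(** The second-order estimate f_j (z + h) = f_j z + f_j' z h + O(h^2) has a constant depending only
    on B and the radius, so it survives pointwise limits along the ultrafilter. *)
Lemma ulim_der (f_ : nat -> C -> C) f a (r B : R) : bholo f_ a r B ->
  (forall z, N (z - a) < r -> ucv (fun j => f_ j z) (f z)) ->
  forall z, N (z - a) < r ->
    cdiff f z /\ ucv (fun j => der (f_ j) z) (der f z).
Proof.
move=> hB cv z zr; set s := (r - N (z - a)) / 2.
have s0 : 0 < s by rewrite divr_gt0 // subr_gt0.
have sub w : N (w - z) <= s -> N (w - a) < r.
  move=> k; apply: le_lt_trans (ND3 z _ _) _; rewrite /s in k s0; lra.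
have hz j : holo (f_ j) a r -> holo (f_ j) z (2 * s).
  by apply: holo_sub; rewrite /s; lra.
have ss : s < 2 * s by lra.
have c1 : ucv (fun j => der (f_ j) z) (ulim (fun j => der (f_ j) z)).
  apply: (@ulimP _ _ (B / s)); apply: UF_S hB => j /= [h1 h2].
  by apply: (cauchy_est (hz _ h1) s0 ss) => w wz; apply: h2; apply: sub; rewrite wz.
set l := ulim _ in c1.
have dl : cderiv f z l.
  apply: (@littleo_quad _ _ (2 * B / s ^+ 2)); exists (s / 2); first by rewrite divr_gt0.
  move=> h hs; have zh : N (z + h - a) < r.
    by apply: sub; rewrite addrAC subrr add0r; lra.
  have c2 := ucvB (ucvB (cv _ zh) (cv _ zr)) (ucvMl h c1).
  rewrite [l * h]mulrC; apply: (ucv_le c2); apply: UF_S hB => j /= [h1 h2].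
  rewrite [h * _]mulrC; apply: (second_order (hz _ h1) s0 ss); last exact: ltW.
  by move=> w wz; apply: h2; apply: sub; rewrite wz.
by split; [exists l|rewrite (derE dl)].
Qed.

Lemma ulim_dern k (f_ : nat -> C -> C) f a (r B : R) : 0 < r -> bholo f_ a r B ->
  (forall z, N (z - a) < r -> ucv (fun j => f_ j z) (f z)) ->
  exists B' : R, bholo (fun j => dern k (f_ j)) a (r / 2 ^+ k) B' /\
    forall z, N (z - a) < r / 2 ^+ k -> ucv (fun j => dern k (f_ j) z) (dern k f z).
Proof.
move=> r0 hB cv; have [B' hB'] := dern_bd k B r0.
have rk i : 0 < r / 2 ^+ i by rewrite divr_gt0 ?exprn_gt0.
have rle i : r / 2 ^+ i <= r.
  by rewrite ler_pdivrMr ?exprn_gt0 // ler_peMr ?(ltW r0) // exprn_ege1 // ler1n.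
exists B'; split.
  apply: UF_S hB => j /= [h1 h2]; split; last exact: hB'.
  by apply: holoW (dern_holo k h1).
elim: k {B' hB'} => [|k IH] z zr; first by apply: cv; move: zr; rewrite expr0 divr1.
have [B' hB'] := dern_bd k B r0.
have zk : N (z - a) < r / 2 ^+ k.
  apply: lt_trans zr _; rewrite exprSr invfM mulrA; have := rk k; lra.
have bk : bholo (fun j => dern k (f_ j)) a (r / 2 ^+ k) B'.
  apply: UF_S hB => j /= [h1 h2]; split; last exact: hB'.
  by apply: holoW (dern_holo k h1).
by have [_] := ulim_der bk IH zk.
Qed.

(** Harnack's inequality for h_j / K gives (|h_j z| / K)^5 <= |h_j a| / K, where 5 = (s + t) / (s -
    t) with s = 3/4 r and t = r / 2. In the limit the right side is 0. *)
Lemma hurwitz (h_ : nat -> C -> C) g a (r B : R) : 0 < r -> bholo h_ a r B ->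
  UF [set j | forall z, N (z - a) < r -> h_ j z != 0] ->
  (forall z, N (z - a) < r -> ucv (fun j => h_ j z) (g z)) ->
  g a = 0 -> forall z, N (z - a) < r / 2 -> g z = 0.
Proof.
move=> r0 hB nz cv ga z zr.
have B0 : 0 <= B.
  have [j [/= h1 h2]] := UF_ex hB; apply: le_trans (h2 a _); rewrite ?N_ge0 // subrr N0 //.
pose K := 2 * (B + 1); have K0 : 0 < K by rewrite mulr_gt0 //; lra.
have aa : N (a - a) < r by rewrite subrr N0.
have zz : N (z - a) < r by lra.
have main j : (holo (h_ j) a r /\ forall z, N (z - a) < r -> N (h_ j z) <= B) ->
    (forall z, N (z - a) < r -> h_ j z != 0) -> (N (h_ j z) / K) ^+ 5 <= N (h_ j a) / K.
  move=> [h1 h2] h3; pose f z := K^-1%:C * h_ j z.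
  have Nf' w : N (f w) = N (h_ j w) / K.
    by rewrite NM Nr gtr0_norm ?invr_gt0 // mulrC.
  have hf : holo f a r by move=> w wr; apply: cdiffM; [exact: cdiff_cst|exact: h1].
  have fnz w : N (w - a) < r -> f w != 0.
    by move=> wr; rewrite mulf_neq0 ?h3 // -N_gt0 Nr normr_gt0 gt_eqF ?invr_gt0.
  have f1 w : N (w - a) < r -> N (f w) < 1.
    by move=> wr; rewrite Nf' ltr_pdivrMr // mul1r; have := h2 w wr; rewrite /K; lra.
  have [_ k] := @harnack _ f a r (3 / 4 * r) hf ltac:(lra) ltac:(lra) fnz f1 z (r / 2) ltac:(lra) ltac:(lra).
  rewrite -!Nf'; have fz : 0 < N (f z) by rewrite N_gt0 fnz.
  have fa : 0 < N (f a) by rewrite N_gt0 fnz.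
  rewrite -ler_ln ?posrE ?exprn_gt0 // lnXn // -mulr_natr.
  have r4 : 0 < r / 4 by lra.
  by rewrite -(ler_pM2r r4); lra.
have cz : ucv (fun j => (h_ j z / K%:C) ^+ 5) ((g z / K%:C) ^+ 5).
  by apply: ucvX; rewrite mulrC; apply: ucv_ext (ucvMl K%:C^-1 (cv z zz)); apply: UF_all => j /=; rewrite mulrC.
have E : (g z / K%:C) ^+ 5 = 0.
  apply: N_small => e e0; apply: (ucv_le cz).
  have c0 := cv a aa; rewrite ga in c0.
  have eK : 0 < e * K by rewrite mulr_gt0.
  apply: UF_S (UF_I (UF_I hB nz) ((ucv0P _).1 c0 _ eK)) => j /= [[k1 k2] k3].
  rewrite NX Nf Nr (gtr0_norm K0); apply: le_trans (main j k1 k2) _.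
  by rewrite ler_pdivrMr // ltW.
move/eqP: E; rewrite expf_eq0 /= mulf_eq0 invr_eq0 => /orP[/eqP //|].
by rewrite -N_eq0 Nr normr_eq0 gt_eqF.
Qed.

End UltraHolo.

(** * Maps to the sphere in the charts u and 1 / u *)

Section Sphere.
Variable R : realType.
Local Notation C := R[i].
Local Notation N := (@normc R).
Implicit Types (f g : C -> C) (z w l a b h y x v : C) (u : C -> option C).

Definition fin u z : C := odflt 0 (u z).

Definition sinv (p : option C) : option C :=
  if p is Some a then (if a == 0 then None else Some a^-1) else Some 0.

Definition iv u z := sinv (u z).

Lemma sinvK p : sinv (sinv p) = p.
Proof.
case: p => [a|] /=; last by rewrite eqxx.
by case: eqVneq => [->//|a0] /=; rewrite invr_eq0 (negbTE a0) invrK.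
Qed.

Lemma ivK u : iv (iv u) = u.
Proof. by apply/funext => z; exact: sinvK. Qed.

Lemma fin_iv u z v : u z = Some v -> v != 0 -> iv u z = Some v^-1.
Proof. by rewrite /iv => -> /= /negbTE ->. Qed.

Definition fholo u a (r : R) := (forall w, N (w - a) < r -> u w <> None) /\ holo (fin u) a r.

(* u is holomorphic near z as a map to the sphere; the constant infinity is allowed. *)
Definition sholo u z := exists2 r : R, 0 < r & fholo u z r \/ fholo (iv u) z r.

(* The spherical derivative without its usual factor 2; at a pole it is that of 1 / u. *)
Definition sder u z : R :=
  if u z is Some a then N (der (fin u) z) / (1 + N a ^+ 2) else N (der (fin (iv u)) z).

Lemma sholo_iv u z : sholo u z -> sholo (iv u) z.
Proof. by move=> [r r0 [h|h]]; exists r => //; [right; rewrite ivK|left]. Qed.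

Lemma finP u z v : u z = Some v -> fin u z = v. Proof. by rewrite /fin => ->. Qed.

Lemma fin_neq0 u z : fin (iv u) z != 0 -> u z <> None /\ fin u z = (fin (iv u) z)^-1.
Proof.
rewrite /fin /iv; case: (u z) => [v|] /=; last by rewrite eqxx.
case: (boolP (v == 0)) => v0 h; last by split=> //; rewrite /odflt /oapp (invrK v).
by move: h; rewrite /= eqxx.
Qed.

Lemma sholo_fin u z v : sholo u z -> u z = Some v -> exists2 r : R, 0 < r & fholo u z r.
Proof.
move=> [r r0 [h|[h1 h2]]] uz; first by exists r.
have zz : N (z - z) < r by rewrite subrr N0.
have v0 : v != 0.
  by apply/eqP => e; have := h1 z zz; rewrite /iv uz e /= eqxx.
have fz : fin (iv u) z != 0 by rewrite (finP (fin_iv uz v0)) invr_eq0.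
have [d d0 hd] := ccont_neq0 (cdiff_cont (h2 z zz)) fz.
pose r' := Num.min r d.
have nz w : N (w - z) < r' -> fin (iv u) w != 0.
  by rewrite lt_min => /andP[_ /hd [_]]; rewrite subrKC.
exists r'; first by rewrite lt_min r0.
split=> [w wr|w wr]; first by have [] := fin_neq0 (nz w wr).
apply: (@cdiff_ext _ (fun w => (fin (iv u) w)^-1)).
  apply: (@near0_ball _ (fun w => (fin (iv u) w)^-1 = fin u w) z w r') => // x xr.
  by have [_ ->] := fin_neq0 (nz x xr).
by apply: cdiffV (nz w wr) _; apply: h2; move: wr; rewrite lt_min => /andP[].
Qed.

Lemma sholo_cdiff u z v : sholo u z -> u z = Some v -> cdiff (fin u) z.
Proof. by move=> h1 h2; have [r r0 [_ h]] := sholo_fin h1 h2; apply: h; rewrite subrr N0. Qed.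

Lemma iv_der u z v : sholo u z -> u z = Some v -> v != 0 ->
  der (fin (iv u)) z = - der (fin u) z / v ^+ 2.
Proof.
move=> h1 h2 v0; have [r r0 [k1 k2]] := sholo_fin h1 h2.
have zz : N (z - z) < r by rewrite subrr N0.
have fz : fin u z != 0 by rewrite (finP h2).
have d := cderivV fz (derP (k2 z zz)); rewrite (finP h2) in d; apply: derE.
apply: cderiv_ext d; apply: near0S (near0I (@near0_ball _ (fun w => N (w - z) < r) z z r zz (fun w k => k))
  (ccont_neq0 (cdiff_cont (k2 z zz)) fz)) => x [_ [_ nz]].
have := @fin_neq0 (iv u) (z + x); rewrite ivK => /(_ nz) [_ ->] //.
Qed.

Lemma sder_iv u z : sholo u z -> sder (iv u) z = sder u z.
Proof.
move=> hu; rewrite /sder; case E : (u z) => [v|]; last first.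
  by rewrite /iv E /= N0 expr0n addr0 divr1.
rewrite {1}/iv E /=; case: eqVneq => [v0|v0].
  by rewrite ivK v0 N0 expr0n addr0 divr1.
rewrite (iv_der hu E v0) Nf NN NX NV.
have Nv : N v != 0 by rewrite N_eq0.
have : 0 < N v ^+ 2 by rewrite exprn_gt0 // lt_def Nv N_ge0.
move=> k; have q1 : 1 + N v ^+ 2 != 0 by rewrite gt_eqF //; lra.
have q2 : N v ^+ 2 + 1 != 0 by rewrite addrC.
by field; rewrite ?Nv ?q1 ?q2.
Qed.

Lemma sder_ge0 u z : 0 <= sder u z.
Proof.
rewrite /sder; case: (u z) => [v|]; last exact: N_ge0.
by rewrite divr_ge0 ?N_ge0 // addr_ge0 ?exprn_ge0 ?N_ge0.
Qed.

Lemma der_sder u z v (K : R) : u z = Some v -> sder u z <= K ->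
  N (der (fin u) z) <= K * (1 + N v ^+ 2).
Proof.
move=> e; rewrite /sder e ler_pdivrMr //.
by have : 0 <= N v ^+ 2 by [rewrite exprn_ge0 ?N_ge0]; lra.
Qed.

(** While |u| <= M + 1, |u'| is at most K (1 + (M + 1)^2), so over a shorter distance |u| cannot
    climb from M to M + 1. K + 1 replaces K to allow K = 0. *)
Definition chart_radius (K M : R) : R := ((K + 1) * (1 + (M + 1) ^+ 2))^-1.

Lemma chart_radius_gt0 (K M : R) : 0 <= K -> 0 < chart_radius K M.
Proof. by move=> K0; rewrite invr_gt0 mulr_gt0 //; [lra|rewrite ltr_pwDl ?sqr_ge0]. Qed.

(* Continuation along a segment: as long as u stays bounded by M + 1, the bound
   on the spherical derivative keeps its increment below 1. *)
Lemma chart u a (r K M : R) : 0 <= K -> 0 <= M ->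
  (forall w, N (w - a) < r -> sholo u w /\ sder u w <= K) ->
  u a <> None -> N (fin u a) <= M ->
  forall w, N (w - a) < r -> N (w - a) < chart_radius K M ->
    u w <> None /\ N (fin u w) <= M + 1.
Proof.
move=> K0 M0 hu ua fa w wr wc.
pose ga (t : R) : C := a + t%:C * (w - a).
pose good t := u (ga t) <> None /\ N (fin u (ga t)) <= M + 1.
have gr t : 0 <= t <= 1 -> N (ga t - a) < r.
  move=> /andP[t0 t1]; rewrite addrAC subrr add0r NM Nr ger0_norm //.
  by apply: le_lt_trans wr; rewrite ler_piMl ?N_ge0.
have g0 : ga 0 = a by rewrite /ga rmorph0 mul0r addr0.
have g1 : ga 1 = w by rewrite /ga rmorph1 mul1r subrKC.
(* Connectedness of the segment: u is finite and at most M + 1 up to the supremum T of E, at T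
   itself ([goodT]), and there even strictly ([bound]), so T < 1 would allow going further. *)
pose E := [set t : R | 0 <= t <= 1 /\ forall s, 0 <= s <= t -> good s].
have good0 : good 0 by rewrite /good g0; split=> //; lra.
have E0 : E 0.
  split; first by rewrite lexx ler01.
  by move=> s /andP[s0 s1]; have -> : s = 0 by apply/eqP; rewrite eq_le s1.
have supE : has_sup E by split; [exists 0|exists 1 => t [/andP[]]].
pose T := sup E.
have T0 : 0 <= T by exact: (ub_le_sup supE.2).
have T1 : T <= 1 by apply: ge_sup => [|t [/andP[]] //]; exact: supE.1.
have below s : 0 <= s -> s < T -> good s.
  move=> s0 sT; have e0 : 0 < T - s by lra.
  have [t [_ ht] h] := sup_adherent e0 supE; apply: ht; rewrite s0 /=.
  by move: h; rewrite -/T; lra.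
have step (s : R) : ga s = ga T + (s - T)%:C * (w - a) by rewrite /ga rmorphB; ring.
have close (d : R) : 0 < d -> exists2 e : R, 0 < e & forall s, `|s - T| < e -> N ((s - T)%:C * (w - a)) < d.
  move=> d0; have p : 0 < N (w - a) + 1 by have := N_ge0 (w - a); lra.
  exists (d / (N (w - a) + 1)); first by rewrite divr_gt0.
  move=> s; rewrite ltr_pdivlMr // NM Nr => k; apply: le_lt_trans k.
  by rewrite ler_wpM2l //; lra.
have near_below (P : C -> Prop) : 0 < T -> near0 (fun h => P (ga T + h)) -> exists2 s, good s & P (ga s).
  move=> Tp [d d0 hd]; have [e e0 he] := close d d0.
  pose s := Num.max 0 (T - e / 2).
  have sT : s < T by rewrite gt_max Tp /=; lra.
  have s0 : 0 <= s by rewrite le_max lexx.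
  exists s; first exact: below.
  rewrite step; apply/hd/he; rewrite distrC ger0_norm; last by lra.
  by have : T - e / 2 <= s by [rewrite le_max lexx orbT]; lra.
have T01 : 0 <= T <= 1 by rewrite T0.
have [shT _] := hu _ (gr T T01).
have goodT : good T.
  have [Tp|] := ltP 0 T; last by move=> k; have -> : T = 0 by apply/eqP; rewrite eq_le k.
  have uT : u (ga T) <> None.
    (* At a pole 1 / u would be continuous with value 0, whereas |1 / u| >= 1 / (M + 1) > 1 / (M +
       2) at parameters just before T. *)
    move=> e; have ivT : iv u (ga T) = Some 0 by rewrite /iv e.
    have [r' r'0 [q1 q2]] := sholo_fin (sholo_iv shT) ivT.
    have tt : N (ga T - ga T) < r' by rewrite subrr N0.
    have M2 : 0 < (M + 2)^-1 by rewrite invr_gt0; lra.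
    have cc := cdiff_cont (q2 _ tt) M2.
    have nb := @near0_ball _ (fun x => N (x - ga T) < r') (ga T) (ga T) r' tt (fun x k => k).
    have [s [gs1 gs2] [p1 p2]] := near_below (fun x => N (x - ga T) < r' /\ N (fin (iv u) x - fin (iv u) (ga T)) < (M + 2)^-1) Tp (near0I nb cc).
    have := q1 _ p1; case F : (u (ga s)) gs1 gs2 => [v|//] _.
    rewrite (finP F) => vM; rewrite /iv F /=; case: eqVneq => // v0 _.
    move: p2; rewrite (finP ivT) subr0 (finP (fin_iv F v0)) NV ltf_pV2 ?posrE ?N_gt0 //; last by lra.
    lra.
  split=> //; case F : (u (ga T)) uT => [v|//] _; rewrite (finP F) leNgt; apply/negP => big.
  have cc := cdiff_cont (sholo_cdiff shT F).
  have e0 : 0 < N v - (M + 1) by lra.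
  have [s [_ gs2] p] := near_below (fun x => N (fin u x - fin u (ga T)) < N v - (M + 1)) Tp (cc _ e0).
  rewrite (finP F) in p; have := NB_ge v (v - fin u (ga s)); rewrite subKr (NC v); lra.
have goodle s : 0 <= s <= T -> good s.
  by move=> /andP[s0]; rewrite le_eqVlt => /orP[/eqP ->|/(below _ s0)].
have bound : N (fin u (ga T)) < M + 1.
  have mv := @mean_value _ (fin u) a (ga T) (K * (1 + (M + 1) ^+ 2)).
  have k : N (fin u (ga T) - fin u a) <= K * (1 + (M + 1) ^+ 2) * N (ga T - a).
    apply: mv => t /andP[t0 t1].
    have e : a + t%:C * (ga T - a) = ga (t * T) by rewrite /ga rmorphM; ring.
    rewrite e; have tT : 0 <= t * T <= T by rewrite mulr_ge0 //= ler_piMl.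
    have tT1 : 0 <= t * T <= 1 by move: tT; lra.
    have [q1 q2] := goodle _ tT; have [q3 q4] := hu _ (gr _ tT1).
    case F : (u (ga (t * T))) q1 => [v|//] _.
    exists (der (fin u) (ga (t * T))); first exact: derP (sholo_cdiff q3 F).
    apply: le_trans (der_sder F q4) _; rewrite ler_wpM2l // lerD2l.
    by rewrite lerXn2r ?nnegrE ?N_ge0 -?(finP F) //; lra.
  have k2 : N (ga T - a) < chart_radius K M.
    rewrite addrAC subrr add0r NM Nr ger0_norm //; apply: le_lt_trans wc.
    by rewrite ler_piMl ?N_ge0.
  have q0 : 0 < 1 + (M + 1) ^+ 2 by rewrite ltr_pwDl ?sqr_ge0.
  have q1 : 0 < (K + 1) * (1 + (M + 1) ^+ 2) by rewrite mulr_gt0 //; lra.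
  have k3 : (K + 1) * (1 + (M + 1) ^+ 2) * N (ga T - a) < 1.
    by move: k2; rewrite /chart_radius -[_^-1]mul1r ltr_pdivlMr // mulrC.
  have k4 : K * (1 + (M + 1) ^+ 2) * N (ga T - a) <= (K + 1) * (1 + (M + 1) ^+ 2) * N (ga T - a).
    by rewrite ler_wpM2r ?N_ge0 // ler_wpM2r ?(ltW q0) //; lra.
  have := ND (fin u (ga T) - fin u a) (fin u a); rewrite subrK; lra.
suff -> : w = ga T by [].
rewrite -g1; congr ga; apply/eqP; rewrite eq_sym eq_le T1 /= leNgt; apply/negP => Tlt.
have [uT _] := goodT; case F : (u (ga T)) uT => [v|//] _.
have [r' r'0 [q1 q2]] := sholo_fin shT F.
have tt : N (ga T - ga T) < r' by rewrite subrr N0.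
have nb := @near0_ball _ (fun x => N (x - ga T) < r') (ga T) (ga T) r' tt (fun x k => k).
have e0 : 0 < M + 1 - N (fin u (ga T)) by lra.
have [d d0 hd] := near0I nb (cdiff_cont (q2 _ tt) e0).
have [e ep he] := close d d0.
pose t := Num.min 1 (T + e / 2).
have tT : T < t by rewrite lt_min Tlt /=; lra.
have : E t.
  split; first by rewrite ge_min lexx andbT; lra.
  move=> s /andP[s0 st]; have [sT|sT] := leP s T; first by apply: goodle; rewrite s0.
  have se : `|s - T| < e.
    rewrite ger0_norm; last by lra.
    by have : t <= T + e / 2 by [rewrite ge_min lexx orbT]; lra.
  have [p1 p2] := hd _ (he s se); rewrite -step in p1 p2.
  split; first exact: q1.
  have := ND (fin u (ga s) - fin u (ga T)) (fin u (ga T)); rewrite subrK; lra.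
by move=> /(ub_le_sup supE.2); rewrite -/T leNgt tT.
Qed.

End Sphere.

(** * Pointwise limits of maps to the sphere *)

Section SphereLimit.
Variable R : realType.
Local Notation C := R[i].
Local Notation N := (@normc R).
Implicit Types (z w l a b h y v : C) (u : C -> option C) (x : nat -> option C) (p : option C).

Definition fv p : C := odflt 0 p.
Definition ple p (M : R) := p <> None /\ N (fv p) <= M.

Lemma ple_some v (M : R) : ple (Some v) M <-> N v <= M.
Proof. by split=> [[]|] //. Qed.

Lemma ple_em p : ple p 1 \/ ple (sinv p) 1.
Proof.
case: p => [v|]; last by right; split=> //=; rewrite N0 ler01.
have [h|h] := leP (N v) 1; first by left.
have v0 : v != 0 by rewrite -N_gt0; apply: lt_trans h.
by right; rewrite /sinv (negbTE v0); apply/ple_some; rewrite NV invf_le1 ?ltW //; apply: lt_trans h.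
Qed.

Lemma fv_sinv p : p <> None -> sinv p <> None -> fv p != 0 /\ fv (sinv p) = (fv p)^-1.
Proof. by case: p => [v|] //= _; case: eqVneq => //. Qed.

(** The limit is taken in the chart around 0 if almost all points lie in the closed unit disc, and
    otherwise in the chart around infinity, where almost all inverses then lie in that disc. *)
Definition ulimS x : option C :=
  if asbool (UF [set j | ple (x j) 1]) then Some (ulim (fun j => fv (x j)))
  else sinv (Some (ulim (fun j => fv (sinv (x j))))).

Lemma ucv_sinv x l : l != 0 -> UF [set j | x j <> None] ->
  ucv (fun j => fv (x j)) l -> UF [set j | sinv (x j) <> None] /\ ucv (fun j => fv (sinv (x j))) l^-1.
Proof.
move=> l0 fx cx; have nz : UF [set j | fv (x j) != 0].
  have e0 : 0 < N l by rewrite N_gt0.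
  apply: UF_S (cx _ e0) => j /= k; apply: contraTneq k => ->.
  by rewrite sub0r NN ltxx.
have fs : UF [set j | sinv (x j) <> None].
  by apply: UF_S (UF_I fx nz) => j /=; case: (x j) => [v|] [] //= _ /negbTE ->.
split=> //; apply: ucv_ext (ucvV l0 cx).
by apply: UF_S (UF_I fx fs) => j /= [h1 h2]; have [_ ->] := fv_sinv h1 h2.
Qed.

(** Independence of the chart. When M > 1 the definition may have used inverses; the finite limit
    then has modulus at least 1, so inverting it back is harmless. *)
Lemma ulimS_fin x (M : R) : UF [set j | ple (x j) M] ->
  ulimS x = Some (ulim (fun j => fv (x j))) /\ ucv (fun j => fv (x j)) (ulim (fun j => fv (x j))).
Proof.
move=> hM; have cx : ucv (fun j => fv (x j)) (ulim (fun j => fv (x j))).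
  by apply: (@ulimP _ _ M); apply: UF_S hM => j [].
split=> //; rewrite /ulimS; case: asboolP => // nA.
have A : UF [set j | ple (x j) M /\ 1 < N (fv (x j))].
  have [//|B] := UF_em [set j | ple (x j) 1].
  apply: UF_S (UF_I hM B) => j /= [k1 k2]; split=> //; rewrite ltNge; apply/negP => k3.
  by apply: k2; split=> //; case: k1.
set l := ulim _ in cx *.
have l0 : l != 0.
  apply/eqP => e; rewrite e in cx.
  have [j /= [[_ k1]]] := UF_ex (UF_I A ((ucv0P _).1 cx 1 ltr01)); lra.
have fx : UF [set j | x j <> None] by apply: UF_S hM => j [].
have [_ cs] := ucv_sinv l0 fx cx.
by rewrite (ucv_ulim cs) /= invr_eq0 (negbTE l0) invrK.
Qed.

Lemma ulimS_iv x : ulimS (fun j => sinv (x j)) = sinv (ulimS x).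
Proof.
have [A|nA] := UF_em [set j | ple (x j) 1]; last first.
  have B : UF [set j | ple (sinv (x j)) 1].
    by apply: UF_S nA => j /= k; have [] := ple_em (x j).
  have [-> _] := ulimS_fin B; rewrite /ulimS; case: asboolP => [A|_]; last by rewrite sinvK.
  by have [j /= []] := UF_ex (UF_I A nA).
have [-> cx] := ulimS_fin A.
rewrite {1}/ulimS; case: asboolP => [B|nB].
  set l := ulim _ in cx *.
  have fx : UF [set j | x j <> None] by apply: UF_S A => j [].
  have l0 : l != 0.
    apply/eqP => e; rewrite e in cx.
    have [j /= [[[k1 k2] [k3 k4]] k5]] := UF_ex (UF_I (UF_I A B) ((ucv0P _).1 cx 1 ltr01)).
    have [nz E] := fv_sinv k1 k3; move: k4; rewrite E NV invf_le1 ?N_gt0 //; lra.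
  have [_ cs] := ucv_sinv l0 fx cx.
  by rewrite (ucv_ulim cs) /= (negbTE l0).
by congr (sinv (Some _)); apply: ulim_ext; apply: UF_all => j /=; rewrite sinvK.
Qed.

Lemma ulimS_some x v : ulimS x = Some v ->
  UF [set j | ple (x j) (N v + 1)] /\ ucv (fun j => fv (x j)) v.
Proof.
suff S : ulimS x = Some v -> UF [set j | x j <> None] /\ ucv (fun j => fv (x j)) v.
  by move=> /S [fx cx]; split=> //; apply: UF_S (UF_I fx (ucv_bd cx)).
rewrite /ulimS; case: asboolP => [A [<-]|nA].
  by split; [apply: UF_S A => j []|have [] := ulimS_fin A].
have B : UF [set j | ple (sinv (x j)) 1].
  have [//|B] := UF_em [set j | ple (x j) 1].
  by apply: UF_S B => j /= k; have [] := ple_em (x j).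
have [_] := ulimS_fin B; set l := ulim _ => cy /=; case: eqVneq => // l0 [<-].
have fy : UF [set j | sinv (x j) <> None] by apply: UF_S B => j [].
have [h1 h2] := ucv_sinv l0 fy cy; split.
  by apply: UF_S h1 => j /=; rewrite sinvK.
by apply: ucv_ext h2; apply: UF_all => j /=; rewrite sinvK.
Qed.

Lemma ucv_N (s : nat -> C) l : ucv s l -> ucv (fun j => (N (s j))%:C) (N l)%:C.
Proof.
move=> c e e0; apply: UF_S (c e e0) => j /= k; rewrite -rmorphB Nr; apply: le_lt_trans k.
by have := NB_ge (s j) l; have := NB_ge l (s j); rewrite (NC l) ler_norml; lra.
Qed.

Variables (u_ : nat -> C -> option C) (a : C) (r K : R).
Hypothesis r0 : 0 < r.
Hypothesis K0 : 0 <= K.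

Definition sder_bounded := UF [set j | forall w, N (w - a) < r -> sholo (u_ j) w /\ sder (u_ j) w <= K].

Definition pointwise_ulim (u_ : nat -> C -> option C) : C -> option C := fun z => ulimS (fun j => u_ j z).

(** By [chart], almost all terms are bounded by M + 1 on one common disc, which reduces the limit to
    that of bounded holomorphic functions. *)
Lemma limit_chart (M : R) : 0 <= M -> sder_bounded -> UF [set j | ple (u_ j a) M] ->
  [/\ UF [set j | fholo (u_ j) a (Num.min r (chart_radius K M)) /\ forall w, N (w - a) < Num.min r (chart_radius K M) -> N (fin (u_ j) w) <= M + 1],
   fholo (pointwise_ulim u_) a (Num.min r (chart_radius K M)),
   forall w, N (w - a) < Num.min r (chart_radius K M) -> ucv (fun j => fin (u_ j) w) (fin (pointwise_ulim u_) w)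
   & forall w, N (w - a) < Num.min r (chart_radius K M) -> N (fin (pointwise_ulim u_) w) <= M + 1].
Proof.
move=> M0 hS hM; set rho := Num.min _ _.
have rho0 : 0 < rho by rewrite lt_min r0 chart_radius_gt0.
have A : UF [set j | fholo (u_ j) a rho /\ forall w, N (w - a) < rho -> N (fin (u_ j) w) <= M + 1].
  apply: UF_S (UF_I hS hM) => j /= [k1 [k2 k3]].
  have k w : N (w - a) < rho -> u_ j w <> None /\ N (fin (u_ j) w) <= M + 1.
    rewrite lt_min => /andP[w1 w2]; exact: (chart K0 M0 k1 k2 k3 w1 w2).
  split=> [|w /k[] //]; split=> [w /k[] //|w wr].
  have [k4 _] := k w wr; case E : (u_ j w) k4 => [v|] // _.
  by apply: sholo_cdiff E; apply: (k1 _ _).1; move: wr; rewrite lt_min => /andP[].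
have P w : N (w - a) < rho -> UF [set j | ple (u_ j w) (M + 1)].
  by move=> wr; apply: UF_S A => j /= [[k1 _] k2]; split; [exact: k1|exact: k2].
have cv w : N (w - a) < rho -> ucv (fun j => fin (u_ j) w) (fin (pointwise_ulim u_) w).
  by move=> wr; have [E c] := ulimS_fin (P w wr); rewrite (finP E).
have B : bholo (fun j => fin (u_ j)) a rho (M + 1).
  by apply: UF_S A => j /= [[_ k1] k2].
split=> //.
  split=> w wr; first by rewrite /pointwise_ulim; have [-> _] := ulimS_fin (P w wr).
  by have [] := ulim_der B cv wr.
by move=> w wr; apply: (ucv_le (cv w wr)); apply: UF_S A => j /= [_]; exact.
Qed.

Lemma limit_dern (M : R) k n : 0 <= M -> sder_bounded -> UF [set j | ple (u_ j a) M] ->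
  exists2 B : R, bholo (fun j => dern k (fun z => fin (u_ j) z ^+ n)) a (Num.min r (chart_radius K M) / 2 ^+ k) B &
  forall w, N (w - a) < Num.min r (chart_radius K M) / 2 ^+ k ->
   ucv (fun j => dern k (fun z => fin (u_ j) z ^+ n) w) (dern k (fun z => fin (pointwise_ulim u_) z ^+ n) w).
Proof.
move=> M0 hS hM; have [A _ cv _] := limit_chart M0 hS hM.
have rho0 : 0 < Num.min r (chart_radius K M) by rewrite lt_min r0 chart_radius_gt0.
have [|w wr|B [h1 h2]] := @ulim_dern _ k (fun j z => fin (u_ j) z ^+ n) (fun z => fin (pointwise_ulim u_) z ^+ n) a _ ((M + 1) ^+ n) rho0.
- apply: UF_S A => j /= [[_ k1] k2]; split=> w wr; first by apply: cdiffX; exact: k1.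
  by rewrite NX lerXn2r ?nnegrE ?N_ge0 //; [lra|exact: k2].
- by apply: ucvX; exact: cv.
by exists B.
Qed.

End SphereLimit.

Section SphereLimit2.
Variable R : realType.
Local Notation C := R[i].
Local Notation N := (@normc R).
Implicit Types (z w l a b h y v : C) (u : C -> option C) (x : nat -> option C) (p : option C).
Variables (u_ : nat -> C -> option C) (a : C) (r K : R).
Hypothesis r0 : 0 < r.
Hypothesis K0 : 0 <= K.
Hypothesis hS : sder_bounded u_ a r K.

Lemma sder_bounded_iv : sder_bounded (fun j => iv (u_ j)) a r K.
Proof.
by apply: UF_S hS => j /= k w wr; have [k1 k2] := k w wr; split; [exact: sholo_iv|rewrite sder_iv].
Qed.

Lemma pointwise_ulim_iv : pointwise_ulim (fun j => iv (u_ j)) = iv (pointwise_ulim u_).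
Proof. by apply/funext => z; exact: ulimS_iv. Qed.

Lemma limit_sder_fin (v_ : nat -> C -> option C) : sder_bounded v_ a r K ->
  UF [set j | ple (v_ j a) 1] ->
  ucv (fun j => (sder (v_ j) a)%:C) (sder (pointwise_ulim v_) a)%:C.
Proof.
move=> hv A; have [B [f1 f2] cv _] := limit_chart r0 K0 ler01 hv A.
set rho := Num.min _ _ in B f1 f2 cv.
have rho0 : 0 < rho by rewrite lt_min r0 chart_radius_gt0.
have aa : N (a - a) < rho by rewrite subrr N0.
have bh : bholo (fun j => fin (v_ j)) a rho (1 + 1) by apply: UF_S B => j /= [[_ k1] k2].
have [_ cd] := ulim_der bh cv aa.
have := f1 a aa; case E : (pointwise_ulim v_ a) => [l|//] _.
have c1 := cv a aa; rewrite (finP E) in c1.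
have c2 := ucvM (ucv_N c1) (ucv_N c1).
have nz : 1 + (N l)%:C * (N l)%:C != 0 :> C.
  rewrite -rmorphM -rmorphD -N_gt0 Nr normr_gt0 gt_eqF // ltr_pwDl // mulr_ge0 ?N_ge0 //.
have c3 := ucvM (ucv_N cd) (ucvV nz (ucvD (ucv_cst 1) c2)).
have -> : (sder (pointwise_ulim v_) a)%:C = (N (der (fin (pointwise_ulim v_)) a))%:C * (1 + (N l)%:C * (N l)%:C)^-1.
  by rewrite /sder E -rmorphM -rmorphD -fmorphV -rmorphM expr2.
apply: ucv_ext c3; apply: UF_S A => j /= [+ _].
rewrite /sder; case F : (v_ j a) => [m|//] _.
by rewrite (finP F) -rmorphM -rmorphD -fmorphV -rmorphM expr2.
Qed.

Lemma limit_dich : UF [set j | ple (u_ j a) 1] \/ UF [set j | ple (iv (u_ j) a) 1].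
Proof.
have [A|A] := UF_em [set j | ple (u_ j a) 1]; first by left.
by right; apply: UF_S A => j /= k; have [] := ple_em (u_ j a).
Qed.

Lemma limit_sholo : sholo (pointwise_ulim u_) a.
Proof.
have rho0 : 0 < Num.min r (chart_radius K 1) by rewrite lt_min r0 chart_radius_gt0.
exists (Num.min r (chart_radius K 1)) => //; have [A|A] := limit_dich; [left|right].
  by have [] := limit_chart r0 K0 ler01 hS A.
by rewrite -pointwise_ulim_iv; have [] := limit_chart r0 K0 ler01 sder_bounded_iv A.
Qed.

Lemma limit_sder : ucv (fun j => (sder (u_ j) a)%:C) (sder (pointwise_ulim u_) a)%:C.
Proof.
have [A|A] := limit_dich; first exact: limit_sder_fin A.
rewrite -(sder_iv limit_sholo) -pointwise_ulim_iv; apply: ucv_ext (limit_sder_fin sder_bounded_iv A).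
apply: UF_S hS => j /= k; rewrite sder_iv //; apply: (k _ _).1.
by rewrite subrr N0.
Qed.

Lemma limit_sder_le : sder (pointwise_ulim u_) a <= K.
Proof.
have := ucv_le limit_sder; rewrite Nr ger0_norm ?sder_ge0 //; apply.
apply: UF_S hS => j /= k; rewrite Nr ger0_norm ?sder_ge0 //; apply: (k _ _).2.
by rewrite subrr N0.
Qed.

Lemma limit_sder_ge (e : R) : UF [set j | e <= sder (u_ j) a] -> e <= sder (pointwise_ulim u_) a.
Proof.
move=> he; rewrite leNgt; apply/negP => lt; have lt' : 0 < e - sder (pointwise_ulim u_) a by rewrite subr_gt0.
have [j /= [k1]] := UF_ex (UF_I he (limit_sder lt')).
by rewrite -rmorphB Nr ltr_norml; lra.
Qed.

End SphereLimit2.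

(** * Maps to the sphere with bounded spherical derivative *)

Section Propagation.
Variable R : realType.
Local Notation C := R[i].
Local Notation N := (@normc R).
Implicit Types (f g F : C -> C) (z w l a b h y v c : C) (u : C -> option C) (p q : {poly C}).

Lemma cderiv_horner p z : cderiv (fun x => p.[x]) z p^`().[z].
Proof.
elim/poly_ind: p => [|p c IH].
  rewrite deriv0 hornerC; apply: cderiv_ext (cderiv_cst 0 z).
  by apply: near0T => h /=; rewrite horner0.
have d := cderivD (cderivM IH (cderiv_id z)) (cderiv_cst c z).
apply: cderiv_eq (cderiv_ext _ d) _.
  by apply: near0T => h /=; rewrite hornerD hornerM hornerX hornerC.
by rewrite derivD derivM derivX derivC mulr1 !addr0 mulr1 hornerD hornerM hornerX.
Qed.

Lemma poly_antiderivative p : exists2 q : {poly C}, q^`() = p & (size q <= (size p).+1)%N.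
Proof.
exists (\poly_(i < (size p).+1) (p`_i.-1 / i%:R)); last exact: size_poly.
apply/polyP => i; rewrite coef_deriv coef_poly ltnS /=; case: ltnP => [ip|ip].
  by rewrite -(mulr_natr (_ / _)) mulfVK // pnatr_eq0.
by rewrite mul0rn nth_default.
Qed.

Lemma dern_const_poly k F a (r : R) c : holo F a r ->
  (forall z, N (z - a) < r -> dern k F z = c) ->
  exists2 p : {poly C}, (size p <= k.+1)%N & forall z, N (z - a) < r -> F z = p.[z].
Proof.
elim: k F => [|k IH] F hF hc.
  exists c%:P; first by rewrite size_polyC leq_b1.
  by move=> z zr; rewrite hornerC; exact: hc.
have [|p sp hp] := IH (der F) (holo_der hF).
  by move=> z zr; rewrite -(hc z zr) /dern iterSr.
have [q qp sq] := poly_antiderivative p.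
exists (q + (F a - q.[a])%:P).
  rewrite (leq_trans (size_polyD _ _)) // geq_max (leq_trans sq) //=.
  by rewrite (leq_trans (size_polyC_leq1 _)).
move=> z zr; have := @zero_der_const _ (fun x => F x - q.[x]) a r.
rewrite hornerD hornerC => Q; rewrite -(Q _ z zr) ?subrKC //.
move=> x xr; apply: cderiv_eq (cderivB (derP (hF x xr)) (cderiv_horner q x)) _.
by rewrite qp hp // subrr.
Qed.

Lemma poly_growth_bound p k : (size p <= k.+1)%N ->
  exists2 K : R, 0 <= K & forall z, N p.[z] <= K * (1 + N z) ^+ k.
Proof.
move=> sp; exists (\sum_(i < size p) N p`_i); first by apply: sumr_ge0 => i _; exact: N_ge0.
move=> z; rewrite horner_coef mulr_suml; apply: le_trans (N_sum _ _ _) _.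
apply: ler_sum => i _; rewrite NM ler_wpM2l ?N_ge0 // NX.
have z1 : 1 <= 1 + N z by rewrite lerDl N_ge0.
apply: le_trans (_ : (1 + N z) ^+ i <= _).
  by rewrite lerXn2r ?nnegrE ?N_ge0 //; lra.
by apply: ler_weXn2l => //; rewrite -ltnS (leq_trans (ltn_ord i)).
Qed.

(** Cauchy's estimate on |w - z| = rho gives |g' z|^n <= K (2 rho)^k / rho^n, and k < n. The radius
    is chosen with K 2^k <= e^n rho. *)
Lemma sublinear_const g (n k : nat) (K : R) : (k < n)%N -> 0 <= K -> entire g ->
  (forall z, N (g z) ^+ n <= K * (1 + N z) ^+ k) -> forall z w, g z = g w.
Proof.
move=> kn K0 eg hg; have d0 z : der g z = 0.
  apply: N_small => e e0; have z1 : 1 <= 1 + N z by rewrite lerDl N_ge0.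
  have en : 0 < e ^+ n by rewrite exprn_gt0.
  have q0 : 0 <= K * 2 ^+ k / e ^+ n by rewrite divr_ge0 ?mulr_ge0 ?exprn_ge0 // ltW.
  pose rho := 1 + N z + K * 2 ^+ k / e ^+ n.
  have rz : 1 + N z <= rho by rewrite /rho; lra.
  have rho1 : 1 <= rho by lra.
  have rho0 : 0 < rho by lra.
  have rK : K * 2 ^+ k <= e ^+ n * rho.
    by rewrite [leRHS]mulrC -ler_pdivrMr // /rho; lra.
  have eh : holo g z (rho + 1) by exact: entire_holo.
  have rr : rho < rho + 1 by lra.
  have := @cauchy_est _ g z (rho + 1) eh rho (e * rho) rho0 rr.
  rewrite mulfK ?gt_eqF //; apply => w wz.
  have er : 0 <= e * rho by rewrite mulr_ge0 // ltW.
  rewrite -(@ler_pXn2r _ n) ?nnegrE ?N_ge0 //; last exact: leq_ltn_trans kn.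
  apply: le_trans (hg w) _.
  have w2 : 1 + N w <= 2 * rho.
    by have := ND (w - z) z; rewrite subrK wz; lra.
  apply: le_trans (_ : K * (2 * rho) ^+ k <= _).
    by rewrite ler_wpM2l // lerXn2r ?nnegrE //; have := N_ge0 w; lra.
  rewrite !exprMn mulrA; apply: le_trans (_ : e ^+ n * rho * rho ^+ k <= _).
    by rewrite ler_wpM2r ?exprn_ge0 // ltW.
  rewrite -mulrA -exprS ler_wpM2l ?(ltW en) //.
  exact: ler_weXn2l.
move=> z w; have zw : N (z - w) < N (z - w) + 1 by lra.
apply: (zero_der_const (a := w) (r := N (z - w) + 1)) zw => x _.
by rewrite -(d0 x); exact: derP.
Qed.

Definition tame u (K : R) := forall z, sholo u z /\ sder u z <= K.

Lemma tame_iv u (K : R) : tame u K -> tame (iv u) K.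
Proof. by move=> h z; have [h1 h2] := h z; split; [exact: sholo_iv|rewrite sder_iv]. Qed.

Lemma tame_chart u a (K M : R) : 0 <= K -> 0 <= M -> tame u K -> ple (u a) M ->
  fholo u a (chart_radius K M) /\ forall w, N (w - a) < chart_radius K M -> N (fin u w) <= M + 1.
Proof.
move=> K0 M0 hu [ua fa].
have k w : N (w - a) < chart_radius K M -> u w <> None /\ N (fin u w) <= M + 1.
  by move=> wr; exact: (chart K0 M0 (fun x _ => hu x) ua fa wr wr).
split=> [|w /k[] //]; split=> [w /k[] //|w /k[+ _]].
case E : (u w) => [v|] // _; exact: sholo_cdiff (hu w).1 E.
Qed.

(** Rigidity: near a the function u^n is a polynomial p of degree at most k. The equation u^n = p is
    continued over the plane by discs of fixed radius and excludes poles, so u is entire with |u|^n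
    = O(|z|^k) and k < n. *)
Lemma dern_const_const u (K : R) n k a (r : R) c : 0 <= K -> (k < n)%N -> tame u K ->
  0 < r -> fholo u a r ->
  (forall z, N (z - a) < r -> dern k (fun w => fin u w ^+ n) z = c) ->
  forall z, u z = u a.
Proof.
move=> K0 kn hu r0 [ua ha] hc; have n0 : (0 < n)%N by exact: leq_ltn_trans kn.
have hF : holo (fun w => fin u w ^+ n) a r by move=> w wr; apply: cdiffX; exact: ha.
have [p sp hp] := dern_const_poly hF hc.
have [Kp Kp0 hKp] := poly_growth_bound sp.
pose d := chart_radius K 1; have d0 : 0 < d by exact: chart_radius_gt0.
pose good w := u w <> None /\ fin u w ^+ n = p.[w].
have hp' x : cdiff (horner p) x by exists p^`().[x]; exact: cderiv_horner.
have step z : near0 (fun h => good (z + h)) -> forall w, N (w - z) < d -> good w.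
  move=> nz w wd; have [A|A] := ple_em (u z).
    have [[f1 f2] _] := tame_chart K0 ler01 hu A.
    split; first exact: f1.
    apply/eqP; rewrite -subr_eq0; apply/eqP.
    have hd : holo (fun x => fin u x ^+ n - p.[x]) z d.
      by move=> x xd; apply: cdiffB; [apply: cdiffX; exact: f2|exact: hp'].
    have hd' : near0 (fun h => (fun x => fin u x ^+ n - p.[x]) (z + h) = 0).
      by apply: near0S nz => h [_ /= ->]; rewrite subrr.
    exact: (identity_disc hd hd' wd).
  (* In the chart around infinity the equation becomes (1 / u)^n p = 1, which also shows that 1 / u
     has no zero, that is, u no pole. *)
  have [[f1 f2] _] := tame_chart K0 ler01 (tame_iv hu) A.
  have hd : holo (fun x => fin (iv u) x ^+ n * p.[x] - 1) z d.
    move=> x xd; apply: cdiffB (cdiff_cst _ _); apply: cdiffM; first by apply: cdiffX; exact: f2.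
    exact: hp'.
  have zz : N (z - z) < d by rewrite subrr N0.
  have hd' : near0 (fun h => (fun x => fin (iv u) x ^+ n * p.[x] - 1) (z + h) = 0).
    apply: near0S (near0I nz (@near0_ball _ (fun x => N (x - z) < d) z z d zz (fun x k => k))) => h [[h1 h2] h3] /=.
    rewrite -h2; have [nzv E] := fv_sinv h1 (f1 _ h3).
    have -> : fin (iv u) (z + h) = (fin u (z + h))^-1 by [].
    by rewrite -exprMn mulVf // expr1n subrr.
  have /eqP := identity_disc hd hd' wd; rewrite subr_eq0 => /eqP E.
  have nzw : fin (iv u) w != 0.
    by apply/eqP => E0; move/eqP: E; rewrite E0 expr0n eqn0Ngt n0 mul0r eq_sym oner_eq0.
  have [k1 k2] := fin_neq0 nzw; split=> //.
  rewrite k2 exprVn; apply: (mulfI (expf_neq0 n nzw)).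
  by rewrite mulfV ?expf_neq0.
have aa : N (a - a) < r by rewrite subrr N0.
have start : near0 (fun h => good (a + h)).
  by apply: (near0_ball aa) => w wr; split; [exact: ua|exact: hp].
(* Induction along the segment from a to z, cut into m + 1 pieces: y is the last division point, at
   distance at most d / 2 < d from z. *)
have all m : forall z, N (z - a) <= m%:R * (d / 2) -> near0 (fun h => good (z + h)).
  elim: m => [|m IH] z.
    rewrite mul0r => /N_le0 /eqP; rewrite subr_eq0 => /eqP -> //.
  move=> zm; have m1 : m.+1%:R != 0 :> R by rewrite pnatr_eq0.
  pose y := a + (m%:R / m.+1%:R)%:C * (z - a).
  have mm : 0 <= m%:R / m.+1%:R :> R by rewrite divr_ge0.
  have dd : 0 < d / 2 by lra.
  have ya : N (y - a) <= m%:R * (d / 2).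
    rewrite /y addrAC subrr add0r NM Nr ger0_norm //.
    by rewrite -mulrA ler_wpM2l // mulrC ler_pdivrMr ?ltr0n // mulrC.
  have zy : N (z - y) < d.
    have -> : z - y = (m.+1%:R^-1)%:C * (z - a).
      rewrite (_ : (m.+1%:R^-1)%:C = 1 - (m%:R / m.+1%:R)%:C); first by rewrite /y; ring.
      rewrite -(rmorph1 (real_complex R)) -rmorphB; congr (_%:C).
      by field; rewrite addrC natr1.
    rewrite NM Nr ger0_norm ?invr_ge0 // mulrC ltr_pdivrMr ?ltr0n //.
    apply: le_lt_trans zm _; rewrite mulrC ltr_pM2r ?ltr0n //; lra.
  by apply: (near0_ball zy) => w wd; exact: (step y (IH y ya)).
have every z : good z.
  have dd : 0 < d / 2 by lra.
  have [m hm] : exists m : nat, N (z - a) <= m%:R * (d / 2).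
    exists (Num.bound (N (z - a) / (d / 2))); rewrite -ler_pdivrMr // ltW //.
    by apply: archi_boundP; rewrite divr_ge0 ?N_ge0 // ltW.
  apply: (step z (all m z hm)); by rewrite subrr N0.
have ent : entire (fin u).
  move=> z; have [k1 _] := every z; case E : (u z) k1 => [v|] // _.
  exact: sholo_cdiff (hu z).1 E.
move=> z.
have E : fin u z = fin u a.
  apply: (sublinear_const kn Kp0 ent) => x; rewrite -NX (every x).2; exact: hKp.
move: E; have [k1 _] := every z; have [k2 _] := every a.
by rewrite /fin; case: (u z) k1 => [v|] // _; case: (u a) k2 => [v'|] //= _ ->.
Qed.

End Propagation.

(** * Affine changes of variable *)

Section Affine.
Variable R : realType.
Local Notation C := R[i].
Local Notation N := (@normc R).
Implicit Types (f g F : C -> C) (z w l a b s x y v c : C) (u : C -> option C).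
Variables (b s : C).
Hypothesis s0 : s != 0.
Definition aff x := b + s * x.

Lemma aff_ball z w (r : R) : N (w - z) < r / N s -> N (aff w - aff z) < r.
Proof.
have -> : aff w - aff z = s * (w - z) by rewrite /aff; ring.
by rewrite NM ltr_pdivlMr ?N_gt0 // mulrC.
Qed.

Lemma cdiff_aff f z : cdiff f (aff z) -> cdiff (fun x => f (aff x)) z.
Proof. by move=> /derP/cderiv_affine/cderiv_diff. Qed.

Lemma holo_aff f z (r : R) : holo f (aff z) r -> holo (fun x => f (aff x)) z (r / N s).
Proof. by move=> h w wr; apply: cdiff_aff; apply: h; exact: aff_ball. Qed.

Lemma fholo_aff u z (r : R) : fholo u (aff z) r -> fholo (fun x => u (aff x)) z (r / N s).
Proof.
move=> [h1 h2]; split=> [w wr|]; first by apply: h1; exact: aff_ball.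
exact: (holo_aff h2).
Qed.

Lemma sholo_aff u z : sholo u (aff z) -> sholo (fun x => u (aff x)) z.
Proof.
move=> [r r0 h]; exists (r / N s); first by rewrite divr_gt0 // N_gt0.
by case: h => /fholo_aff; [left|right].
Qed.

Lemma der_aff f z : cdiff f (aff z) -> der (fun x => f (aff x)) z = s * der f (aff z).
Proof. by move=> /derP/cderiv_affine/derE ->; rewrite mulrC. Qed.

Lemma sder_aff u z : sholo u (aff z) -> sder (fun x => u (aff x)) z = N s * sder u (aff z).
Proof.
move=> h; rewrite /sder; case E : (u (aff z)) => [v|].
  by rewrite mulrA -NM -(der_aff (sholo_cdiff h E)).
have E' : iv u (aff z) = Some 0 by rewrite /iv E.
by rewrite -NM -(der_aff (sholo_cdiff (sholo_iv h) E')).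
Qed.

Lemma dern_aff k f a (r : R) : holo f (aff a) r -> forall z, N (z - a) < r / N s ->
  dern k (fun x => f (aff x)) z = s ^+ k * dern k f (aff z).
Proof.
move=> hf; elim: k => [|k IH] z zr; first by rewrite mul1r.
rewrite /= (@der_ext _ _ (fun x => s ^+ k * dern k f (aff x))).
  have d := derP (@dern_holo _ k _ _ _ hf _ (aff_ball zr)).
  by have /derE -> := cderivMl (s ^+ k) (cderiv_affine d); rewrite exprSr -mulrA (mulrC s).
exact: (@near0_ball _ (fun x => dern k (fun x => f (aff x)) x = s ^+ k * dern k f (aff x)) a z _ zr).
Qed.

End Affine.

(** * Limits of maps whose (u^n)^(k) avoids 1 *)

Section Limits.
Variable R : realType.
Local Notation C := R[i].
Local Notation N := (@normc R).
Implicit Types (f g F : C -> C) (z w l a b h y v c : C) (u : C -> option C).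
Variables (n k : nat).
Hypothesis k0 : (0 < k)%N.
Hypothesis kn : (k < n)%N.

Definition Fk u z : C := dern k (fun w => fin u w ^+ n) z.
Definition avoids u z := u z <> None -> Fk u z <> 1.

Lemma dern_cst j c z : (0 < j)%N -> dern j (fun=> c) z = 0.
Proof.
case: j => // j _; rewrite /dern iterSr (_ : der _ = fun=> 0); last first.
  by apply/funext => x; apply: derE; exact: cderiv_cst.
have -> : iter j (@der R) (fun=> 0) = fun=> 0 => //.
by elim: j => //= j ->; apply/funext => x; apply: derE; exact: cderiv_cst.
Qed.

Lemma Fk_const u a z : (forall w, u w = u a) -> Fk u z = 0.
Proof.
move=> h; rewrite /Fk (_ : (fun w => _) = fun=> fin u a ^+ n) ?dern_cst //.
by apply/funext => w; rewrite /fin h.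
Qed.

Lemma Fk_aff b s u z : s != 0 -> sholo u (aff b s z) -> u (aff b s z) <> None ->
  Fk (fun x => u (aff b s x)) z = s ^+ k * Fk u (aff b s z).
Proof.
move=> s0 h; case E : (u _) => [v|] // _.
have [r r0 [_ hr]] := sholo_fin h E.
apply: (@dern_aff _ b s s0 k (fun w => fin u w ^+ n) z r).
  by move=> w wr; apply: cdiffX; exact: hr.
by rewrite subrr N0 divr_gt0 // N_gt0.
Qed.

(** Avoidance passes to the limit by Hurwitz: if (u^n)^(k) equals 1 at z, it is 1 around z, so u is
    constant by rigidity, and then (u^n)^(k) = 0 because k > 0. *)
Lemma limit_tame (u_ : nat -> C -> option C) (K : R) : 0 <= K ->
  (forall A : R, UF [set j | forall w, N w < A ->
     [/\ sholo (u_ j) w, sder (u_ j) w <= K & avoids (u_ j) w]]) ->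
  tame (pointwise_ulim u_) K /\ forall z, avoids (pointwise_ulim u_) z.
Proof.
move=> K0 hA; have hS z : sder_bounded u_ z 1 K.
  apply: UF_S (hA (N z + 1)) => j /= h w wz; have [] := h w; last by [].
  by have := ND (w - z) z; rewrite subrK; lra.
have tm : tame (pointwise_ulim u_) K.
  by move=> z; split; [exact: limit_sholo ltr01 K0 (hS z)|exact: limit_sder_le ltr01 K0 (hS z)].
split=> // z uz e; case E : (pointwise_ulim u_ z) uz => [v|] // _.
have M0 : 0 <= N v + 1 by rewrite addr_ge0 ?N_ge0.
have [A _] := ulimS_some E.
have [B1 fh cv _] := limit_chart ltr01 K0 M0 (hS z) A.
have [B B2 cvk] := limit_dern ltr01 K0 k n M0 (hS z) A.
set rho := Num.min _ _ in B1 fh cv B2 cvk.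
have rho0 : 0 < rho by rewrite lt_min ltr01 chart_radius_gt0.
have rk0 : 0 < rho / 2 ^+ k by rewrite divr_gt0 ?exprn_gt0.
have rk1 : rho / 2 ^+ k <= rho.
  by rewrite ler_pdivrMr ?exprn_gt0 // ler_peMr ?(ltW rho0) // exprn_ege1 // ler1n.
have rho1 : rho <= 1 by rewrite ge_min lexx.
have b1 : bholo (fun j x => dern k (fun z => fin (u_ j) z ^+ n) x - 1) z (rho / 2 ^+ k) (B + 1).
  apply: UF_S B2 => j /= [h1 h2]; split=> w wr; first by apply: cdiffB (cdiff_cst _ _); exact: h1.
  by apply: le_trans (NB _ _) _; rewrite N1 lerD2r; exact: h2.
have b2 : UF [set j | forall w, N (w - z) < rho / 2 ^+ k -> dern k (fun z => fin (u_ j) z ^+ n) w - 1 != 0].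
  apply: UF_S (UF_I B1 (hA (N z + 1))) => j /= [[[h1 _] _] h2] w wr; rewrite subr_eq0; apply/eqP.
  have [] := h2 w; first by have := ND (w - z) z; rewrite subrK; lra.
  by move=> _ _; apply; apply: h1; lra.
have b3 w : N (w - z) < rho / 2 ^+ k -> ucv (fun j => dern k (fun z => fin (u_ j) z ^+ n) w - 1)
   (dern k (fun z => fin (pointwise_ulim u_) z ^+ n) w - 1).
  by move=> wr; apply: ucvB (ucv_cst 1); exact: cvk.
have H := hurwitz rk0 b1 b2 b3; rewrite -/(Fk _ z) e subrr in H.
have rk2 : 0 < rho / 2 ^+ k / 2 by lra.
have fh' : fholo (pointwise_ulim u_) z (rho / 2 ^+ k / 2).
  by case: fh => f1 f2; split; [move=> w wr; apply: f1; lra|apply: holoW f2; lra].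
have cst := dern_const_const (c := 1) K0 kn tm rk2 fh' _.
have e0 : Fk (pointwise_ulim u_) z = 0.
  apply: (@Fk_const _ z); apply: cst => w wr.
  by apply/eqP; rewrite -subr_eq0 H.
by move/eqP: e; rewrite e0 eq_sym oner_eq0.
Qed.

(** Otherwise there are points a_j with |u| <= M at which (u^n)^(k) tends to 1. The translates u
    (a_j + x) then have a tame limit that is finite at 0 and attains there the value it avoids. *)
Lemma Fk_away u (K M : R) : 0 <= K -> 0 <= M -> tame u K -> (forall z, avoids u z) ->
  exists2 B : R, 0 < B & forall z, ple (u z) M -> N (Fk u z - 1)^-1 <= B.
Proof.
move=> K0 M0 hu av; apply: contrapT => H.
have /choice[a ha] j : exists a, ple (u a) M /\ N (Fk u a - 1) <= (j.+1%:R)^-1.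
  apply: contrapT => H2; apply: H; exists j.+1%:R; first by rewrite ltr0n.
  move=> z uz; rewrite leNgt; apply/negP => big; apply: H2; exists z; split=> //.
  have p : 0 < N (Fk u z - 1).
    by rewrite N_gt0 subr_eq0; apply/eqP; apply: av; case: uz.
  by rewrite -[leLHS]invrK lef_pV2 ?posrE ?invr_gt0 ?ltr0n // -NV ltW.
have o0 : 1 != 0 :> C by rewrite oner_eq0.
pose u_ j x := u (aff (a j) 1 x).
have tu j w : sholo (u_ j) w /\ sder (u_ j) w <= K.
  split; first by apply: (sholo_aff o0); exact: (hu _).1.
  by rewrite (sder_aff (hu _).1) N1 mul1r; exact: (hu _).2.
have fk j w : u_ j w <> None -> Fk (u_ j) w = Fk u (aff (a j) 1 w).
  by move=> h; rewrite Fk_aff ?expr1n ?mul1r //; exact: (hu _).1.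
have [tl avl] : tame (pointwise_ulim u_) K /\ forall z, avoids (pointwise_ulim u_) z.
  apply: limit_tame => // A; apply: UF_all => j /= w _; have [t1 t2] := tu j w; split=> //.
  by move=> uw; rewrite fk //; exact: av.
have hS : sder_bounded u_ 0 1 K by apply: UF_all => j /= w _; exact: tu.
have a0 j : aff (a j) 1 0 = a j by rewrite /aff mulr0 addr0.
have A : UF [set j | ple (u_ j 0) M] by apply: UF_all => j /=; rewrite /u_ a0; have [] := ha j.
have [E _] := ulimS_fin A.
have [B _ cvk] := limit_dern ltr01 K0 k n M0 hS A.
have rho0 : 0 < Num.min 1 (chart_radius K M) by rewrite lt_min ltr01 chart_radius_gt0.
have c1 := cvk 0 _; apply: (avl 0); first by rewrite /pointwise_ulim E.
apply/eqP; rewrite -subr_eq0; apply/eqP; apply: N_small => e e0.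
apply: (ucv_le (ucvB (c1 _) (ucv_cst 1))); first by rewrite subrr N0 divr_gt0 ?exprn_gt0.
apply: UF_S (UF_inv e0) => j /= je; apply: le_trans (ltW je).
have [h1 h2] := ha j; have -> : dern k (fun z => fin (u_ j) z ^+ n) 0 = Fk (u_ j) 0 by [].
by rewrite fk ?a0 // /u_ a0; case: h1.
Qed.

End Limits.

(** * Removable singularities and derivatives of powers *)

Section LogDer.
Variable R : realType.
Local Notation C := R[i].
Local Notation N := (@normc R).
Implicit Types (f g F V phi : C -> C) (z w l a b h y v c : C) (u : C -> option C).

Lemma near0_eq f g a z (r : R) : N (z - a) < r -> (forall w, N (w - a) < r -> f w = g w) ->
  near0 (fun h => f (z + h) = g (z + h)).
Proof. by move=> zr h; exact: (@near0_ball _ (fun w => f w = g w) a z r zr). Qed.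

(** The value at each z is defined as the limit along z + 1 / (j + 1), so the local extensions H
    need not be chosen or compared. *)
Lemma patch f : (forall z, exists H (r : R), [/\ 0 < r, holo H z r &
    forall w, N (w - z) < r -> w != z -> f w = H w]) ->
  exists2 g, entire g & forall z, ccont f z -> g z = f z.
Proof.
move=> hf; pose g z := ulim (fun j => f (z + (j.+1%:R^-1)%:C)).
have seq z H (r : R) : 0 < r -> ccont H z ->
    (forall w, N (w - z) < r -> w != z -> f w = H w) -> g z = H z.
  move=> r0 hH hfH; apply: ucv_ulim => e e0; have [d d0 hd] := hH e e0.
  have m0 : 0 < Num.min r d by rewrite lt_min r0.
  apply: UF_S (UF_inv m0) => j /=; rewrite lt_min => /andP[jr jd].
  have p : 0 < j.+1%:R^-1 :> R by rewrite invr_gt0 ltr0n.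
  have Np : N (j.+1%:R^-1)%:C = j.+1%:R^-1 by rewrite Nr gtr0_norm.
  rewrite hfH; first by apply: hd; rewrite Np.
    by rewrite addrAC subrr add0r Np.
  by rewrite -subr_eq0 addrAC subrr add0r -N_gt0 Np.
exists g => [z|z zc]; last by apply: (@seq z f 1).
have [H [r [r0 hH hfH]]] := hf z.
have zz : N (z - z) < r by rewrite subrr N0.
have gH w : N (w - z) < r -> g w = H w.
  move=> wr; have [->|wz] := eqVneq w z.
    exact: (seq z H r r0 (cdiff_cont (hH z zz))).
  have p : 0 < Num.min (r - N (w - z)) (N (w - z)).
    by rewrite lt_min N_gt0 subr_eq0 wz subr_gt0 wr.
  apply: (seq w H _ p (cdiff_cont (hH w wr))) => x; rewrite lt_min => /andP[x1 x2] _.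
  apply: hfH; first by have := ND3 w z x; lra.
  by apply/eqP => e; move: x2; rewrite e NC ltxx.
apply: (@cdiff_ext _ H); last exact: hH.
by apply: (near0_eq zz) => w wr; rewrite gH.
Qed.

(* g^(c - m) * lder c g V m is the m-th derivative of g^c * V. *)
Fixpoint lder c g V m : C -> C :=
  if m is j.+1 then fun z => (c - j%:R) * der g z * lder c g V j z + g z * der (lder c g V j) z
  else V.

Lemma lderS c g V j z :
  lder c g V j.+1 z = (c - j%:R) * der g z * lder c g V j z + g z * der (lder c g V j) z.
Proof. by []. Qed.
Arguments lder : simpl never.

Lemma lder_holo c g V m a (r : R) : holo g a r -> holo V a r -> holo (lder c g V m) a r.
Proof.
move=> hg hV; elim: m => // m IH z zr.
apply: cdiffD; apply: cdiffM; [apply: cdiffM (cdiff_cst _ _) _| | |].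
- by apply: (holo_der hg).
- exact: IH.
- exact: hg.
by apply: (holo_der IH).
Qed.

(* phi plays the part of g^c, which need not make sense. *)
Lemma dern_lder c g V phi F a (r : R) m :
  holo g a r -> holo V a r -> holo phi a r -> holo F a r ->
  (forall z, N (z - a) < r -> g z * der phi z = c * der g z * phi z) ->
  (forall z, N (z - a) < r -> F z = phi z * V z) ->
  forall z, N (z - a) < r -> g z ^+ m * dern m F z = phi z * lder c g V m z.
Proof.
move=> hg hV hp hF E EF; elim: m => [|m IH] z zr; first by rewrite expr0 mul1r /dern /= EF.
have hFm := @dern_holo _ m _ _ _ hF.
have hL := @lder_holo c g V m a r hg hV.
have d1 := cderivM (cderivX m (derP (hg z zr))) (derP (hFm z zr)).
have d2 := cderivM (derP (hp z zr)) (derP (hL z zr)).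
have d3 : cderiv (fun x => g x ^+ m * dern m F x) z (der phi z * lder c g V m z + phi z * der (lder c g V m) z).
  by apply: cderiv_ext (near0_eq zr _) d2 => w wr; rewrite IH.
have EQ := cderiv_unique d1 d3.
have -> : g z ^+ m.+1 * dern m.+1 F z = g z * (g z ^+ m * der (dern m F) z).
  by rewrite exprS mulrA.
have -> : g z ^+ m * der (dern m F) z = (der phi z * lder c g V m z + phi z * der (lder c g V m) z)
   - m%:R * g z ^+ m.-1 * der g z * dern m F z by rewrite -EQ; ring.
have -> : g z * (der phi z * lder c g V m z + phi z * der (lder c g V m) z - m%:R * g z ^+ m.-1 * der g z * dern m F z)
  = g z * der phi z * lder c g V m z + phi z * (g z * der (lder c g V m) z) - m%:R * (g z * g z ^+ m.-1) * der g z * dern m F z.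
  by ring.
rewrite E // lderS; case: m IH {hFm hL d1 d2 d3 EQ} => [|m] IH.
  by rewrite mulr0n; ring.
by rewrite -exprS; have := IH z zr; rewrite -!(mulrA (m.+1%:R)) (mulrAC (g z ^+ m.+1)) => ->; ring.
Qed.

Lemma lder_bd m c (r B : R) : 0 < r -> exists B' : R, forall g a, holo g a r ->
  (forall z, N (z - a) < r -> N (g z) <= B) ->
  forall z, N (z - a) < r / 2 ^+ m -> N (lder c g (fun=> 1) m z) <= B'.
Proof.
move=> r0; elim: m => [|m [B' IH]]; first by exists 1 => g a _ _ z _; rewrite N1.
pose s := r / 2 ^+ m; have s0 : 0 < s by rewrite divr_gt0 ?exprn_gt0.
have sr : s <= r by rewrite ler_pdivrMr ?exprn_gt0 // ler_peMr ?(ltW r0) // exprn_ege1 // ler1n.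
exists (N (c - m%:R) * (4 * B / s) * B' + B * (4 * B' / s)) => g a hg hB z.
rewrite exprSr invfM (mulrA r) -/s => zs.
have gs : holo g a s by exact: holoW hg.
have Bs w : N (w - a) < s -> N (g w) <= B by move=> ws; apply: hB; lra.
have hL : holo (lder c g (fun=> 1) m) a s by apply: lder_holo gs _ => w _; exact: cdiff_cst.
have b1 := der_bd s0 gs Bs zs.
have b2 := der_bd s0 hL (IH g a hg hB) zs.
have zs' : N (z - a) < s by lra.
rewrite lderS; apply: le_trans (ND _ _) _; rewrite lerD // !NM; last first.
  by rewrite ler_pM ?N_ge0 // Bs.
rewrite ler_pM ?mulr_ge0 ?N_ge0 // ?ler_wpM2l ?N_ge0 //; exact: (IH g a).
Qed.

(** At a zero of g only the first term of each step of the recursion survives. *)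
Lemma lder_zero c g V m b (r : R) : 0 < r -> holo g b r -> holo V b r -> g b = 0 ->
  lder c g V m b = (\prod_(j < m) (c - j%:R)) * der g b ^+ m * V b.
Proof.
move=> r0 hg hV gb; elim: m => [|m IH]; first by rewrite big_ord0 !mul1r.
by rewrite lderS gb mul0r addr0 IH big_ord_recr /= exprS; ring.
Qed.

Lemma der_subr b z : der (fun x => x - b) z = 1.
Proof. by apply: derE; apply: cderiv_eq (cderivB (cderiv_id z) (cderiv_cst b z)) _; rewrite subr0. Qed.

Lemma holo_subr b a (r : R) : holo (fun x => x - b) a r.
Proof. by move=> z _; apply: cdiffB (cdiff_id _) (cdiff_cst _ _). Qed.

(** q = (w - b) g is differentiable at b as well, with derivative g b by continuity of g. Hence g is
    the difference quotient of a holomorphic function. *)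
Lemma removable g b (r : R) : (forall w, N (w - b) < r -> w != b -> cdiff g w) ->
  ccont g b -> holo g b r.
Proof.
move=> hg cg; pose q w := (w - b) * g w.
have q0 : cderiv q b (g b).
  move=> e e0; apply: near0S (cg e e0) => h hh.
  rewrite /q subrr mul0r subr0 addrAC subrr add0r [g b * h]mulrC -mulrBr NM mulrC.
  by rewrite ler_wpM2r ?N_ge0 // ltW.
have hq : holo q b r.
  move=> w wr; have [->|wb] := eqVneq w b; first by exists (g b).
  by apply: cdiffM; [exact: (holo_subr b wr)|exact: hg].
have gq w : g w = dquot q b w.
  rewrite /dquot; case: eqVneq => [->|wb]; first by rewrite (derE q0).
  by rewrite /q subrr mul0r subr0 mulrC mulKf // subr_eq0.
move=> w wr; apply: (@cdiff_ext _ (dquot q b)); last exact: dquot_holo hq w wr.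
by apply: near0T => h; rewrite gq.
Qed.

End LogDer.

(** * The entire function 1 / ((u ^ n) ^ (k) - 1) *)

Section Poles.
Variable R : realType.
Local Notation C := R[i].
Local Notation N := (@normc R).
Implicit Types (f g F V A phi : C -> C) (z w l a b h y v c : C).
Variables (n k : nat) (u : C -> option C) (K : R).
Hypothesis k0 : (0 < k)%N.
Hypothesis k2n : (k + 2 <= n)%N.
Hypothesis K0 : 0 <= K.
Hypothesis hu : tame u K.
Hypothesis av : forall z, avoids n k u z.
Hypothesis ncst : ~ exists p, forall z, u z = p.

Let kn : (k < n)%N. Proof. by rewrite (leq_trans _ k2n) // addn2 ltnS leqnSn. Qed.
Let n0 : (0 < n)%N. Proof. exact: leq_ltn_trans kn. Qed.
Local Notation h z := (Fk n k u z - 1).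

Lemma fin_not_const a (r : R) c : 0 < r -> fholo u a r ->
  ~ (forall z, N (z - a) < r -> Fk n k u z = c).
Proof.
move=> r0 fh e; apply: ncst; exists (u a) => z.
exact: (dern_const_const K0 kn hu r0 fh e).
Qed.

Lemma dern_eq_cst f j a (r : R) c : (0 < j)%N -> (forall z, N (z - a) < r -> f z = c) ->
  forall z, N (z - a) < r -> dern j f z = 0.
Proof.
move=> j0 e z zr; rewrite -(@dern_cst _ j c z j0).
exact: (@dern_ext _ j f (fun=> c) a r e).
Qed.

Lemma iv_not_zero a (r : R) : 0 < r -> fholo (iv u) a r ->
  ~ (forall z, N (z - a) < r -> fin (iv u) z = 0).
Proof.
move=> r0 fh e; apply: ncst; exists (u a) => z.
rewrite -(ivK u) /iv; congr sinv.
apply: (dern_const_const (c := 0) K0 kn (tame_iv hu) r0 fh) => w wr.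
by apply: (@dern_eq_cst _ k a r (0 ^+ n)) wr => // x xr; rewrite e.
Qed.

Lemma finite_nonzero_exists : exists a v, u a = Some v /\ v != 0.
Proof.
apply: contrapT => H; have z0 z v : u z = Some v -> v = 0.
  by move=> E; apply/eqP; apply: contrapT => /negP nz; apply: H; exists z, v.
case E : (u 0) => [v|].
  have [r r0 fh] := sholo_fin (hu 0).1 E.
  apply: (@fin_not_const 0 r 0 r0 fh) => z zr.
  apply: (@dern_eq_cst _ k 0 r (0 ^+ n)) zr => // x xr.
  by have := fh.1 x xr; rewrite /fin; case F : (u x) => [y|] // _; rewrite /= (z0 _ _ F).
have E' : iv u 0 = Some 0 by rewrite /iv E.
have [r r0 fh] := sholo_fin (sholo_iv (hu 0).1) E'.
apply: (@iv_not_zero 0 r r0 fh) => z zr; apply/eqP; apply: contrapT => /negP nz.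
have [k1 k2] := fin_neq0 nz; case F : (u z) k1 => [y|] // _.
by move/eqP: nz; apply; rewrite /fin /iv F (z0 _ _ F) /= eqxx.
Qed.

(* If u = A / (z - b)^p near a pole b, then (u^n)^(k) - 1 = Bp / (z - b)^(n p + k). *)
Definition Bp p A b z : C :=
  lder (- (n * p)%:R) (fun x => x - b) (fun x => A x ^+ n) k z - (z - b) ^+ (n * p + k).

Lemma Bp_holo p A b a (r : R) : holo A a r -> holo (Bp p A b) a r.
Proof.
move=> hA z zr; apply: cdiffB; last by apply: cdiffX; exact: (holo_subr b zr).
apply: (@lder_holo _ _ _ _ _ a r _ _ z zr); first exact: holo_subr.
by move=> w wr; apply: cdiffX; exact: hA.
Qed.

Lemma pole_data b : u b = None -> exists (r : R) p A,
  [/\ 0 < r, (0 < p)%N, holo A b r, (forall z, N (z - b) < r -> A z != 0 /\ Bp p A b z != 0) &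
   forall z, N (z - b) < r -> z != b -> u z = Some (A z / (z - b) ^+ p) /\
     h z = Bp p A b z / (z - b) ^+ (n * p + k)].
Proof.
move=> ub; have ib : iv u b = Some 0 by rewrite /iv ub.
have [r1 r10 fh1] := sholo_fin (sholo_iv (hu b).1) ib.
have bb (s : R) : 0 < s -> N (b - b) < s by rewrite subrr N0.
have [/(iv_not_zero r10 fh1)//|[p [q [hq q0 Gq]]]] := holo_prod_factor fh1.2.
have p0 : (0 < p)%N.
  rewrite lt0n; apply/eqP => e; move: (Gq b); rewrite e (finP ib) mul1r => /esym/eqP.
  by rewrite (negbTE q0).
have [d d0 hd] := ccont_neq0 (cdiff_cont (hq b (bb _ r10))) q0.
pose A z := (q z)^-1; pose r2 := Num.min r1 d.
have r20 : 0 < r2 by rewrite lt_min r10.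
have qn z : N (z - b) < r2 -> q z != 0.
  by rewrite lt_min => /andP[_ /hd[_]]; rewrite subrKC.
have hA : holo A b r2.
  by move=> z zr; apply: cdiffV (qn z zr) _; apply: hq; move: zr; rewrite lt_min => /andP[].
have An z : N (z - b) < r2 -> A z != 0 by move=> zr; rewrite invr_eq0 qn.
have uz z : N (z - b) < r2 -> z != b -> u z = Some (A z / (z - b) ^+ p).
  move=> zr zb; have nz : fin (iv u) z != 0.
    by rewrite Gq mulf_neq0 ?qn // expf_neq0 // subr_eq0.
  have [k1 kk] := fin_neq0 nz; move: k1 kk; rewrite /fin; case: (u z) => [v|] //= _ ->.
  by rewrite -/(fin (iv u) z) Gq /A invfM mulrC.
(* At b the value is A^n times the product of the numbers - (n p + j), none of which is 0: the pole
   of (u^n)^(k) has exact order n p + k. *)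
have Bb : Bp p A b b != 0.
  rewrite /Bp (lder_zero _ _ r20) ?subrr //; last 2 first.
  - exact: holo_subr.
  - by move=> z zr; apply: cdiffX; exact: hA.
  rewrite der_subr expr1n mulr1 expr0n addn_eq0 (gtn_eqF k0) andbF subr0.
  rewrite mulf_neq0 ?expf_neq0 ?An ?bb //; apply/prodf_neq0 => j _.
  by rewrite -opprD oppr_eq0 -natrD pnatr_eq0 addn_eq0 muln_eq0 (gtn_eqF n0) (gtn_eqF p0).
have [e e0 he] := ccont_neq0 (cdiff_cont (Bp_holo p b hA (bb _ r20))) Bb.
pose r := Num.min r2 e; have r0 : 0 < r by rewrite lt_min r20.
exists r, p, A; split=> //.
- by apply: holoW hA; rewrite ge_min lexx.
- move=> z; rewrite lt_min => /andP[zr ze]; split; first exact: An.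
  by have [_] := he _ ze; rewrite subrKC.
move=> z; rewrite lt_min => /andP[zr _] zb; split; first exact: uz.
pose s := Num.min (r2 - N (z - b)) (N (z - b)).
have s0 : 0 < s by rewrite lt_min N_gt0 subr_eq0 zb subr_gt0 zr.
have sub w : N (w - z) < s -> N (w - b) < r2 /\ w != b.
  rewrite lt_min => /andP[x1 x2]; split; first by have := ND3 z b w; lra.
  by apply/eqP => ee; move: x2; rewrite ee NC ltxx.
have zz : N (z - z) < s by rewrite subrr N0.
have tn w : N (w - z) < s -> (w - b) ^+ (n * p) != 0.
  by move=> /sub[_ wb]; rewrite expf_neq0 // subr_eq0.
have hphi w : N (w - z) < s -> cderiv (fun x => ((x - b) ^+ (n * p))^-1) w
    (- ((n * p)%:R * (w - b) ^+ (n * p).-1 * 1) / ((w - b) ^+ (n * p)) ^+ 2).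
  move=> ws; have dX := cderivX (n * p) (cderivB (cderiv_id w) (cderiv_cst b w)).
  by apply: cderiv_eq (@cderivV _ (fun x => (x - b) ^+ (n * p)) w _ (tn w ws) dX) _; rewrite subr0.
have np0 : (0 < n * p)%N by rewrite muln_gt0 n0.
(* Here g = x - b, and (x - b)^-(n p) plays the part of g^c with c = - n p. *)
have := @dern_lder _ (- (n * p)%:R) (fun x => x - b) (fun x => A x ^+ n) (fun x => ((x - b) ^+ (n * p))^-1)
  (fun w => fin u w ^+ n) z s k.
move=> /(_ (@holo_subr _ b z s)) L.
have E : (z - b) ^+ k * Fk n k u z = ((z - b) ^+ (n * p))^-1 * lder (- (n * p)%:R) (fun x => x - b) (fun x => A x ^+ n) k z.
  apply: L => // [w ws|w ws|w ws|w ws|w ws].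
  - by apply: cdiffX; apply: hA; have [] := sub w ws.
  - by exists (- ((n * p)%:R * (w - b) ^+ (n * p).-1 * 1) / ((w - b) ^+ (n * p)) ^+ 2); exact: hphi.
  - apply: cdiffX; have [w1 w2] := sub w ws; exact: sholo_cdiff (hu w).1 (uz w w1 w2).
  - rewrite (derE (hphi w ws)) der_subr mulr1.
    have -> : (w - b) ^+ (n * p) = (w - b) * (w - b) ^+ (n * p).-1 by rewrite -exprS prednK.
    set m := (n * p)%:R.
    have tw : w - b != 0 by have [_ wb] := sub w ws; rewrite subr_eq0.
    have tw' : (w - b) ^+ (n * p).-1 != 0 by rewrite expf_neq0.
    by field; rewrite tw tw'.
  have [w1 w2] := sub w ws; rewrite (finP (uz w w1 w2)) expr_div_n -exprM mulnC mulrC //.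
have tz : (z - b) != 0 by rewrite subr_eq0.
rewrite /Bp exprD mulrBl divff ?mulf_neq0 ?expf_neq0 //; congr (_ - _).
apply: (mulfI (expf_neq0 k tz)); rewrite E.
have t1 : (z - b) ^+ (n * p) != 0 by rewrite expf_neq0.
have t2 : (z - b) ^+ k != 0 by rewrite expf_neq0.
by field; rewrite t1 t2.
Qed.

(** The value 0 at a pole of u is the limit value, since (u^n)^(k) - 1 has a pole there. *)
Definition Pf z : C := if u z is Some _ then (h z)^-1 else 0.

Lemma fin_nbhd z : u z <> None -> exists2 r : R, 0 < r & fholo u z r.
Proof. by case E : (u z) => [v|] // _; exact: sholo_fin (hu z).1 E. Qed.

Lemma Fk_holo z (r : R) : fholo u z r -> holo (Fk n k u) z r.
Proof. by move=> [_ h2]; apply: dern_holo => w wr; apply: cdiffX; exact: h2. Qed.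

Lemma h_neq0 z : u z <> None -> h z != 0.
Proof. by move=> uz; rewrite subr_eq0; apply/eqP; exact: av. Qed.

Lemma Pf_fin z : u z <> None -> Pf z = (h z)^-1.
Proof. by rewrite /Pf; case: (u z). Qed.

Lemma Pf_pole b (r : R) p A :
   (forall z, N (z - b) < r -> A z != 0 /\ Bp p A b z != 0) ->
   (forall z, N (z - b) < r -> z != b -> u z = Some (A z / (z - b) ^+ p) /\
     h z = Bp p A b z / (z - b) ^+ (n * p + k)) -> u b = None ->
  forall z, N (z - b) < r -> Pf z = (z - b) ^+ (n * p + k) / Bp p A b z.
Proof.
move=> h1 h2 ub z zr; have [->|zb] := eqVneq z b.
  by rewrite /Pf ub subrr expr0n addn_eq0 (gtn_eqF k0) andbF mul0r.
have [uz hz] := h2 z zr zb; rewrite Pf_fin ?uz // hz invfM invrK mulrC //.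
Qed.

Lemma Pf_entire : entire Pf.
Proof.
move=> z; case E : (u z) => [v|].
  have [|r r0 fh] := @fin_nbhd z; first by rewrite E.
  have zz : N (z - z) < r by rewrite subrr N0.
  apply: (@cdiff_ext _ (fun z => (h z)^-1)).
    by apply: (@near0_eq _ (fun z => (h z)^-1) Pf z z r zz) => w wr; rewrite Pf_fin //; exact: fh.1.
  apply: cdiffV; first by apply: h_neq0; rewrite E.
  by apply: cdiffB (cdiff_cst _ _); exact: Fk_holo zz.
have [r [p [A [r0 p0 hA h1 h2]]]] := pole_data E.
have zz : N (z - z) < r by rewrite subrr N0.
apply: (@cdiff_ext _ (fun x => (x - z) ^+ (n * p + k) / Bp p A z x)).
  by apply: (@near0_eq _ (fun x => (x - z) ^+ (n * p + k) / Bp p A z x) Pf z z r zz) => w wr; rewrite (Pf_pole h1 h2 E).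
apply: cdiffM; first by apply: cdiffX; exact: (holo_subr z zz).
by apply: cdiffV; [exact: (h1 z zz).2|exact: Bp_holo zz].
Qed.

Lemma Pf_bound (M : R) : 0 <= M -> exists2 B : R, 0 < B & forall z, ple (u z) M -> N (Pf z) <= B.
Proof.
move=> M0; have [B B0 hB] := Fk_away k0 kn K0 M0 hu av; exists B => // z uz.
by rewrite Pf_fin; [exact: hB|case: uz].
Qed.

End Poles.

(** * Exponential growth of P *)

Section Growth.
Variable R : realType.
Local Notation C := R[i].
Local Notation N := (@normc R).
Implicit Types (f g F V A phi : C -> C) (z w l a b h y v c x : C).
Variables (n k : nat) (u : C -> option C) (K : R).
Hypothesis k0 : (0 < k)%N.
Hypothesis k2n : (k + 2 <= n)%N.
Hypothesis K0 : 0 <= K.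
Hypothesis hu : tame u K.
Hypothesis av : forall z, avoids n k u z.
Hypothesis ncst : ~ exists p, forall z, u z = p.

Let kn : (k < n)%N. Proof. by rewrite (leq_trans _ k2n) // addn2 ltnS leqnSn. Qed.
Local Notation G := (fin (iv u)).
Local Notation P := (Pf n k u).

(* P = G^(n + k) / Lf where G = 1 / u is finite, by differentiating G^(-n). *)
Definition Lf z : C := lder (- n%:R) G (fun=> 1) k z - G z ^+ (n + k).

Lemma iv_sym z : iv u z <> None -> u z <> None -> G z != 0 /\ fin u z = (G z)^-1.
Proof. move=> h1 h2; have [nz E] := fv_sinv h2 h1.
have -> : G z = (fin u z)^-1 by [].
by rewrite invrK invr_eq0. Qed.

Lemma Pf_Lf z : iv u z <> None -> P z * Lf z = G z ^+ (n + k).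
Proof.
move=> iz; have [r r0 fh] := fin_nbhd (tame_iv hu) iz.
case E : (u z) => [v|]; last first.
  by rewrite /Pf E mul0r /fin /iv E /= expr0n addn_eq0 (gtn_eqF k0) andbF.
have uz : u z <> None by rewrite E.
have [r' r'0 fh'] := fin_nbhd hu uz.
pose s := Num.min r r'; have s0 : 0 < s by rewrite lt_min r0.
have zz : N (z - z) < s by rewrite subrr N0.
have Gn w : N (w - z) < s -> G w != 0 /\ fin u w = (G w)^-1.
  by rewrite lt_min => /andP[w1 w2]; apply: iv_sym; [exact: fh.1|exact: fh'.1].
have hG : holo G z s by apply: holoW fh.2; rewrite ge_min lexx.
have d w : N (w - z) < s -> cderiv (fun x => (G x ^+ n)^-1) w
    (- (n%:R * G w ^+ n.-1 * der G w) / (G w ^+ n) ^+ 2).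
  move=> ws; have dX := cderivX n (derP (hG w ws)).
  by apply: (@cderivV _ (fun x => G x ^+ n) w _ _ dX); rewrite expf_neq0 // (Gn w ws).1.
have := @dern_lder _ (- n%:R) G (fun=> 1) (fun x => (G x ^+ n)^-1) (fun w => fin u w ^+ n) z s k hG.
have n0 : (0 < n)%N by exact: leq_ltn_trans kn.
move=> /(_ _ _ _ _ _ z zz) L.
have {L} EQ : G z ^+ k * Fk n k u z = (G z ^+ n)^-1 * lder (- n%:R) G (fun=> 1) k z.
  apply: L => w ws; first exact: cdiff_cst.
  - by exists (- (n%:R * G w ^+ n.-1 * der G w) / (G w ^+ n) ^+ 2); exact: d.
  - by apply: cdiffX; apply: fh'.2; move: ws; rewrite lt_min => /andP[].
  - rewrite (derE (d w ws)).
    have -> : G w ^+ n = G w * G w ^+ n.-1 by rewrite -exprS prednK.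
    have [g1 _] := Gn w ws; have g2 : G w ^+ n.-1 != 0 by rewrite expf_neq0.
    by set m := n%:R; field; rewrite g1 g2.
  by rewrite (Gn w ws).2 exprVn mulr1.
have [g1 _] := Gn z zz; have g2 : G z ^+ n != 0 by rewrite expf_neq0.
have hn := h_neq0 av uz.
have EL : Lf z = G z ^+ (n + k) * (Fk n k u z - 1).
  rewrite /Lf exprD mulrBr mulr1; congr (_ - _).
  by rewrite -mulrA EQ mulrA mulfV ?mul1r.
by rewrite Pf_fin // EL mulrC mulfK.
Qed.

(** Let d be the distance from z to the set |u| <= M. On the disc of radius d + de about z the chart
    1 / u is available, so P = G^(n+k) / Lf there with G and Lf bounded. At a point y of the set
    almost nearest to z, |Lf y| is bounded below because |P y| is bounded above. [quotient_bound]
    then gives ln |P z| = O(1 + d / de), and d is at most the distance from z to a0. *)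
Lemma Pf_growth a0 : u a0 <> None -> exists2 C0 : R, 0 <= C0 &
  forall z, N (P z) <= expR (C0 * (1 + N (z - a0))).
Proof.
move=> ua; pose M := Num.max 1 (N (fin u a0)).
have M1 : 1 <= M by rewrite le_max lexx.
have M0 : 0 < M by apply: lt_le_trans M1.
have aM : ple (u a0) M.
  by split=> //; rewrite le_max; apply/orP; right; rewrite /fin lexx.
have [B1 B10 hB1] := Pf_bound k0 k2n K0 hu av (ltW M0).
pose del := chart_radius K 1; have del0 : 0 < del by exact: chart_radius_gt0.
have [B' hB'] := lder_bd k (- n%:R) 2 del0.
pose de := del / 2 ^+ k; have de0 : 0 < de by rewrite divr_gt0 ?exprn_gt0.
have de1 : de <= del by rewrite ler_pdivrMr ?exprn_gt0 // ler_peMr ?(ltW del0) // exprn_ege1 // ler1n.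
pose B2 := `|B'| + 2 ^+ (n + k).
have B20 : 0 < B2 by rewrite ltr_wpDl // exprn_gt0.
(* Lower bound for |Lf y| / B2 at a point where |u y| <= M: there |P y| <= B1, while |P y Lf y| = |u
   y|^-(n+k) >= M^-(n+k). *)
pose c := M^-1 ^+ (n + k) / (B1 * B2).
have c0 : 0 < c by rewrite divr_gt0 ?mulr_gt0 // exprn_gt0 // invr_gt0.
pose C0 := `|ln (2 / c)| * (5 / de + 2) + B1.
have q0 : 0 <= `|ln (2 / c)| * (5 / de + 2) by rewrite mulr_ge0 // addr_ge0 ?divr_ge0 // ltW.
have C00 : 0 <= C0 by rewrite addr_ge0 // ltW.
exists C0 => // z.
have z1 : 1 <= 1 + N (z - a0) by rewrite lerDl N_ge0.
have C0z : C0 <= C0 * (1 + N (z - a0)) by rewrite ler_peMr.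
case: (pselect (ple (u z) M)) => [uz|uz].
  apply: le_trans (hB1 z uz) _; apply: le_trans (_ : expR B1 <= _).
    by apply: le_trans (expR_ge1Dx B1); lra.
  by rewrite ler_expR; apply: le_trans C0z; rewrite /C0; lra.
pose S := [set N (y - z) | y in [set y | ple (u y) M]].
have iS : has_inf S.
  by split; [exists (N (a0 - z)), a0|exists 0 => _ [y _ <-]; exact: N_ge0].
pose d := inf S.
have d0 : 0 <= d by apply: lb_le_inf; [exact: iS.1|move=> _ [y _ <-]; exact: N_ge0].
have dz : d <= N (z - a0) by rewrite NC; apply: (ge_inf iS.2); exists a0.
have far x : N (x - z) < d -> ~ ple (u x) M.
  by move=> xd xM; have : d <= N (x - z) by [apply: (ge_inf iS.2); exists x]; lra.
have ivp x : ~ ple (u x) M -> ple (iv u x) 1.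
  move=> nx; have [[p1 p2]|//] := ple_em (u x).
  by case: nx; split=> //; lra.
(* w is pulled radially towards z into the disc of radius d, or to z itself if d = 0. There |u| > M
   >= 1, so the chart of 1 / u around the new point applies and reaches w. *)
have cover w : N (w - z) < d + de -> exists2 x, ple (iv u x) 1 & N (w - x) < de.
  move=> wd; have dd : 0 < d + de by lra.
  exists (z + (d / (d + de))%:C * (w - z)).
    apply: ivp; have [d0'|] := ltP 0 d.
      apply: far; rewrite addrAC subrr add0r NM Nr ger0_norm ?divr_ge0 ?(ltW dd) //.
      by rewrite mulrAC ltr_pdivrMr // ltr_pM2l.
    by move=> d0'; have -> : d = 0 by [lra]; rewrite mul0r rmorph0 mul0r addr0.
  have -> : w - (z + (d / (d + de))%:C * (w - z)) = (de / (d + de))%:C * (w - z).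
    have -> : de / (d + de) = 1 - d / (d + de) by field; rewrite gt_eqF.
    by rewrite rmorphB rmorph1; ring.
  rewrite NM Nr ger0_norm; last by rewrite divr_ge0 // ltW.
  by rewrite mulrAC ltr_pdivrMr // ltr_pM2l.
have loc w : N (w - z) < d + de -> [/\ iv u w <> None, cdiff G w, cdiff Lf w, N (G w) <= 2 & N (Lf w) <= B2].
  move=> /cover [x xp wx]; have [[f1 f2] f3] := tame_chart K0 ler01 (tame_iv hu) xp.
  have wx' : N (w - x) < chart_radius K 1 by apply: lt_le_trans wx de1.
  have b2 y : N (y - x) < chart_radius K 1 -> N (G y) <= 2 by move=> /f3; lra.
  have hL : holo (lder (- n%:R) G (fun=> 1) k) x (chart_radius K 1).
    by apply: lder_holo => // y _; exact: cdiff_cst.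
  split; [exact: f1|exact: f2| |exact: b2|].
    by apply: cdiffB; [exact: hL|apply: cdiffX; exact: f2].
  apply: le_trans (NB _ _) _; rewrite lerD //.
    by apply: le_trans (ler_norm B'); exact: (hB' G x f2 b2).
  by rewrite NX lerXn2r ?nnegrE ?N_ge0 // b2.
have de10 : 0 < de / 10 by lra.
have [_ [y yM <-] yd] := inf_adherent de10 iS; rewrite -/d in yd.
have yd' : N (y - z) < d + de by lra.
have [iy _ _ _ _] := loc y yd'.
have [Gy uy] := iv_sym iy yM.1.
have Ly : M^-1 ^+ (n + k) / B1 <= N (Lf y).
  rewrite ler_pdivrMr //; apply: le_trans (_ : N (P y * Lf y) <= _); last first.
    by rewrite NM mulrC ler_wpM2l ?N_ge0 // hB1.
  rewrite Pf_Lf // NX lerXn2r ?nnegrE ?N_ge0 ?invr_ge0 ?(ltW M0) //.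
  rewrite -[leRHS]invrK lef_pV2 ?posrE ?invr_gt0 ?N_gt0 //.
  by rewrite -NV -uy; exact: yM.2.
have nb : B2^-1%:C != 0 :> C by rewrite -N_gt0 Nr normr_gt0 invr_eq0 gt_eqF.
have NLB w : N (B2^-1%:C * Lf w) = N (Lf w) / B2 by rewrite NM Nr gtr0_norm ?invr_gt0 // mulrC.
have gap : (d + de / 2 + (d + de / 10)) / (d + de / 2 - (d + de / 10)) = 5 * d / de + 3 / 2.
  have e1 : d + de / 2 - (d + de / 10) = 2 / 5 * de by field.
  by rewrite e1; field; rewrite gt_eqF.
have hP : holo P z (d + de) by apply: entire_holo; exact: Pf_entire k0 k2n K0 hu av ncst.
have hL : holo (fun w => B2^-1%:C * Lf w) z (d + de).
  by move=> w wd; apply: cdiffM (cdiff_cst _ _) _; have [] := loc w wd.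
have := @quotient_bound _ P (fun w => B2^-1%:C * Lf w) z (d + de) (d + de * 4 / 5)
  (d + de * 3 / 5) (d + de / 2) (d + de / 10) c y hP hL ltac:(lra) ltac:(lra) ltac:(lra) ltac:(lra) ltac:(lra).
have sub w : N (w - z) <= d + de * 4 / 5 -> N (w - z) < d + de by lra.
move=> /(_ _ _ _ c0 _) QB; apply: le_trans (QB _ _ _ _) _ => {QB} [w /sub wd|w /sub wd|||].
- rewrite NLB ler_pdivrMr // mul1r; by have [] := loc w wd.
- have [l1 l2 l3 l4 l5] := loc w wd.
  rewrite mulrCA Pf_Lf // NM Nr gtr0_norm ?invr_gt0 // mulrC ler_pdivrMr // mul1r NX.
  apply: le_trans (_ : 2 ^+ (n + k) <= _); last by rewrite /B2 lerDr.
  by rewrite lerXn2r ?nnegrE ?N_ge0.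
- by lra.
- rewrite NLB /c invfM mulrA ler_wpM2r // invr_ge0 ltW //.
rewrite gap ler_expR; apply: le_trans (_ : `|ln (2 / c)| * (5 * d / de + 3 / 2) <= _).
  by rewrite ler_wpM2r ?ler_norm // addr_ge0 // divr_ge0 ?mulr_ge0 // ltW.
apply: le_trans (_ : `|ln (2 / c)| * (5 / de + 2) * (1 + N (z - a0)) <= _); last first.
  by rewrite ler_wpM2r ?addr_ge0 ?N_ge0 // /C0; lra.
rewrite -[leRHS]mulrA ler_wpM2l //.
have e5 : 0 <= 5 / de by rewrite divr_ge0 // ltW.
have := ler_wpM2l e5 dz; move: e5 z1; rewrite mulrAC.
by move: (N _) (5 / de) => X q; clear; lra.
Qed.

End Growth.

(** * The quotient - P' / (P u), and the behaviour of u at infinity *)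

Section Phi.
Variable R : realType.
Local Notation C := R[i].
Local Notation N := (@normc R).
Implicit Types (f g F V A phi : C -> C) (z w l a b h y v c x : C).
Variables (n k : nat) (u : C -> option C) (K : R).
Hypothesis k0 : (0 < k)%N.
Hypothesis k2n : (k + 2 <= n)%N.
Hypothesis K0 : 0 <= K.
Hypothesis hu : tame u K.
Hypothesis av : forall z, avoids n k u z.
Hypothesis ncst : ~ exists p, forall z, u z = p.

Let kn : (k < n)%N. Proof. by rewrite (leq_trans _ k2n) // addn2 ltnS leqnSn. Qed.
Let n0 : (0 < n)%N. Proof. exact: leq_ltn_trans kn. Qed.
Local Notation f := (fin u).
Local Notation P := (Pf n k u).

(** (u^n)^(k+1) equals u^(n-k-1) times this function; as n >= k + 2, one factor u can still be
    divided out. *)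
Definition power_lder z : C := lder n%:R f (fun=> 1) k.+1 z.
(* - P' / (P u), written without dividing by u. *)
Definition phi_fin z : C := P z * f z ^+ (n - k - 2) * power_lder z.

Lemma phi_fin_holo z (r : R) : fholo u z r -> holo phi_fin z r.
Proof.
move=> [h1 h2] w wr; apply: cdiffM; last first.
  by apply: (@lder_holo _ n%:R f (fun=> 1) k.+1 z r h2 _ w wr) => x _; exact: cdiff_cst.
apply: cdiffM; first exact: Pf_entire k0 k2n K0 hu av ncst w.
by apply: cdiffX; exact: h2.
Qed.

Lemma phi_fin_spec z v : u z = Some v -> v != 0 -> phi_fin z * v = P z * (der (Fk n k u) z).
Proof.
move=> E v0; have [|r r0 [h1 h2]] := @fin_nbhd _ u K hu z; first by rewrite E.
have zz : N (z - z) < r by rewrite subrr N0.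
have hF : holo (fun w => f w ^+ n) z r by move=> w wr; apply: cdiffX; exact: h2.
have EQ : f z ^+ k.+1 * dern k.+1 (fun w => f w ^+ n) z = f z ^+ n * power_lder z.
  apply: (@dern_lder _ n%:R f (fun=> 1) (fun w => f w ^+ n) (fun w => f w ^+ n) z r k.+1 h2 _ hF hF) => // w wr.
  - exact: cdiff_cst.
  - rewrite (derE (cderivX n (derP (h2 w wr)))).
    have -> : f w ^+ n = f w * f w ^+ n.-1 by rewrite -exprS prednK.
    by set m := n%:R; ring.
  by rewrite mulr1.
rewrite (finP E) in EQ; rewrite /phi_fin -mulrA -mulrA; congr (_ * _).
apply: (mulfI (expf_neq0 k.+1 v0)); rewrite [RHS]EQ (finP E) [power_lder z * v]mulrC !mulrA.
rewrite -exprD -exprSr; congr (_ ^+ _ * _).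
by move: k2n; rewrite addn2 -subnDA addn2; lia.
Qed.

Lemma der_Pf z : u z <> None -> der P z = - (P z ^+ 2 * der (Fk n k u) z).
Proof.
move=> uz; have [r r0 fh] := fin_nbhd hu uz.
have zz : N (z - z) < r by rewrite subrr N0.
have hn := h_neq0 av uz.
have d := @cderivV _ (fun z => Fk n k u z - 1) z _ hn (cderivB (derP (Fk_holo n k fh zz)) (cderiv_cst 1 z)).
have d' : cderiv P z (- (der (Fk n k u) z - 0) / (Fk n k u z - 1) ^+ 2).
  apply: cderiv_ext d; apply: (@near0_eq _ (fun z => (Fk n k u z - 1)^-1) P z z r zz) => w wr.
  by rewrite Pf_fin //; exact: fh.1.
by rewrite (derE d') Pf_fin // subr0 exprVn; ring.
Qed.

Lemma Phi_exists : exists Phi, [/\ entire Phi,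
  (forall z v, u z = Some v -> v != 0 -> der P z = - (Phi z * v * P z)) &
  forall M : R, 0 <= M -> exists B : R, forall z, ple (u z) M -> N (Phi z) <= B].
Proof.
have [|Phi e1 e2] := @patch _ phi_fin.
  move=> z; case E : (u z) => [v|].
    have [|r r0 fh] := @fin_nbhd _ u K hu z; first by rewrite E.
    by exists phi_fin, r; split=> //; exact: phi_fin_holo.
  have [r [p [A [r0 p0 hA h1 h2]]]] := pole_data k0 k2n K0 hu ncst E.
  have hB := Bp_holo n k p z hA.
  pose B := Bp n k p A z; pose m := (n * p + k)%N.
  (* With t = x - z, P = t^m / B and u = A / t^p, this is - P' / (P u) written out; p >= 1 leaves no
     negative power of t. *)
  exists (fun x => (x - z) ^+ p.-1 * ((x - z) * der B x - m%:R * B x) / (A x * B x)), r; split=> //.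
    move=> x xr; apply: cdiffM; last first.
      by apply: cdiffV; [have [? ?] := h1 x xr; rewrite mulf_neq0|apply: cdiffM; [exact: hA|exact: hB]].
    apply: cdiffM; first by apply: cdiffX; exact: (holo_subr z xr).
    apply: cdiffB; apply: cdiffM; [exact: (holo_subr z xr)|exact: (holo_der hB)|exact: cdiff_cst|exact: hB].
  move=> x xr xz; have [ux hx] := h2 x xr xz; have [Ax Bx] := h1 x xr.
  have tx : x - z != 0 by rewrite subr_eq0.
  have vx : A x / (x - z) ^+ p != 0 by rewrite mulf_neq0 // invr_eq0 expf_neq0.
  have uxn : u x <> None by rewrite ux.
  apply: (mulIf vx); rewrite (phi_fin_spec ux vx) (Pf_pole k0 h1 h2 E xr).
  have tm : (x - z) ^+ m != 0 by rewrite expf_neq0.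
  have m0 : (0 < m)%N by rewrite addn_gt0 k0 orbT.
  have dB := derP (hB x xr).
  have dX := cderivX m (cderivB (cderiv_id x) (cderiv_cst z x)).
  have dV := @cderivV _ (fun y => (y - z) ^+ m) x _ tm dX.
  have d1 := cderivD (cderivM dB dV) (cderiv_cst 1 x).
  have s0 : 0 < Num.min (r - N (x - z)) (N (x - z)).
    by rewrite lt_min N_gt0 tx subr_gt0 xr.
  have xx : N (x - x) < Num.min (r - N (x - z)) (N (x - z)) by rewrite subrr N0.
  have d2 := cderiv_ext (near0_eq (g := Fk n k u) xx _) d1.
  rewrite (derE (d2 _)); last first.
    move=> w; rewrite lt_min => /andP[w1 w2].
    have wr : N (w - z) < r by have := ND3 x z w; lra.
    have wz : w != z by apply/eqP => e; move: w2; rewrite e NC ltxx.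
    by have [_ hw] := h2 w wr wz; rewrite -[RHS](subrK 1) hw.
  rewrite -/B -/m; have Bx' : B x != 0 := Bx.
  have -> : (x - z) ^+ p = (x - z) * (x - z) ^+ p.-1 by rewrite -exprS prednK.
  have -> : (x - z) ^+ m = (x - z) * (x - z) ^+ m.-1 by rewrite -exprS prednK.
  have t1 : (x - z) ^+ p.-1 != 0 by rewrite expf_neq0.
  have t2 : (x - z) ^+ m.-1 != 0 by rewrite expf_neq0.
  rewrite subr0; move: t1 t2 tx Bx' Ax {dX dV d1 d2 tm vx ux uxn hx dB}.
  move: (der B x) (B x) (A x) ((x - z) ^+ p.-1) ((x - z) ^+ m.-1) (x - z) (m%:R) => b1 b2 a1 t1 t2 t mm.
  by move=> n1 n2 n3 n4 n5; field; rewrite n1 n2 n3 n4 n5.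
have fE z : u z <> None -> Phi z = phi_fin z.
  move=> uz; have [r r0 fh] := fin_nbhd hu uz.
  by apply/e2/cdiff_cont; apply: (phi_fin_holo fh); rewrite subrr N0.
exists Phi; split=> // [z v E v0|M M0].
  have uz : u z <> None by rewrite E.
  by rewrite der_Pf // fE // (phi_fin_spec E v0); ring.
have [B1 B10 hB1] := Pf_bound k0 k2n K0 hu av M0.
have del0 : 0 < chart_radius K M by exact: chart_radius_gt0.
have [B' hB'] := lder_bd k.+1 n%:R (M + 1) del0.
exists (B1 * M ^+ (n - k - 2) * B') => z uz; rewrite fE; last by case: uz.
have [[f1 f2] f3] := tame_chart K0 M0 hu uz.
rewrite /phi_fin NM (NM (P z)) (NX (f z)); apply: ler_pM; rewrite ?mulr_ge0 ?exprn_ge0 ?N_ge0 //.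
  apply: ler_pM; rewrite ?exprn_ge0 ?N_ge0 //; first exact: hB1.
  by rewrite lerXn2r ?nnegrE ?N_ge0 //; case: uz.
by apply: (hB' f z f2 f3); rewrite subrr N0 divr_gt0 ?exprn_gt0.
Qed.

(* With zeta = 1 / z the functions 1 / u and F^(k) become meromorphic at zeta = 0. *)
Lemma Pf_decay : (forall M : R, exists rho : R, forall z, rho <= N z -> ~ ple (u z) M) ->
  forall z, P z = 0.
Proof.
move=> hM; pose G := fin (iv u).
have Gle (M : R) z : 1 <= M -> ~ ple (u z) M -> iv u z <> None /\ N (G z) <= M^-1.
  move=> M1 nu; have M0 : 0 < M by lra.
  have iz : iv u z <> None.
    by move=> e; apply: nu; rewrite -(ivK u) /iv -/(iv u z) e /=; apply/ple_some; rewrite N0 ltW.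
  split=> //; case E : (u z) => [v|]; last by rewrite /G /fin /iv E /= N0 invr_ge0 ltW.
  have uz : u z <> None by rewrite E.
  have [nz e] := iv_sym iz uz; rewrite -[N _]invrK -NV lef_pV2 ?posrE ?N_gt0 ?invr_eq0 //.
  by rewrite -e leNgt; apply/negP => h; apply: nu; split=> //; exact: ltW.
have [rho0 hr0] := hM 1; pose rho := Num.max 1 rho0.
have rho1 : 1 <= rho by rewrite le_max lexx.
have rhop : 0 < rho by lra.
have out z : rho <= N z -> iv u z <> None /\ N (G z) <= 1.
  move=> h; have [] := @Gle 1 z (lexx _); last by rewrite invr1.
  by apply: hr0; apply: le_trans h; rewrite le_max lexx orbT.
pose g x := if x == 0 then 0 else G x^-1.
pose r := rho^-1; have r0 : 0 < r by rewrite invr_gt0.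
have inv_out x (s : R) : 0 < s -> x != 0 -> N x <= s^-1 -> s <= N x^-1.
  by move=> s0 x0 h; rewrite NV -[s]invrK lef_pV2 ?posrE ?invr_gt0 ?N_gt0.
have gcd x : x != 0 -> N x < r -> cdiff g x.
  move=> x0 xr; have [i1 _] := out _ (inv_out x rho rhop x0 (ltW xr)).
  have [s s0 [f1 f2]] := fin_nbhd (tame_iv hu) i1.
  have zz : N (x^-1 - x^-1) < s by rewrite subrr N0.
  have d := cderiv_comp (cderivV x0 (cderiv_id x)) (derP (f2 _ zz)).
  exists (der G x^-1 * (- 1 / x ^+ 2)); apply: cderiv_ext d.
  have xx : N (x - x) < N x by rewrite subrr N0 N_gt0.
  apply: (@near0_eq _ (fun y => G y^-1) g x x _ xx) => y yx; rewrite /g; case: eqVneq => // e.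
  by move: yx; rewrite e sub0r NN ltxx.
have g0 : g 0 = 0 by rewrite /g eqxx.
have gsmall (e : R) : 0 < e -> near0 (fun x => N (g x) <= e).
  move=> e0; pose M := Num.max 1 e^-1; have M1 : 1 <= M by rewrite le_max lexx.
  have [s hs] := hM M; pose s' := Num.max 1 s.
  have s1 : 1 <= s' by rewrite le_max lexx.
  exists s'^-1; first by rewrite invr_gt0; lra.
  move=> x xs; rewrite /g; case: eqVneq => [_|x0]; first by rewrite N0 ltW.
  have s'0 : 0 < s' by lra.
  have ss' : s <= s' by rewrite le_max lexx orbT.
  have [_] := Gle M x^-1 M1 (hs _ (le_trans ss' (inv_out x s' s'0 x0 (ltW xs)))).
  move=> h; apply: le_trans h _; rewrite -[leRHS]invrK lef_pV2 ?posrE ?invr_gt0 //; last by lra.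
  by rewrite le_max lexx orbT.
have hg : holo g 0 r.
  apply: removable => [x|e e0]; first by rewrite subr0 => xr x0; exact: gcd.
  have e2 : 0 < e / 2 by lra.
  apply: near0S (gsmall _ e2) => x; rewrite g0 subr0 add0r; lra.
have [gz|[e [kf [hk k00 Gk]]]] := holo_prod_factor hg.
  (* If 1 / u vanished identically near infinity, it would vanish on the disc of centre 2 rho and
     radius rho, which [iv_not_zero] excludes. *)
  pose c : C := (2 * rho)%:C; have Nc : N c = 2 * rho by rewrite Nr gtr0_norm //; lra.
  have cn w : N (w - c) < rho -> rho < N w.
    by move=> wc; have := NB_ge c (c - w); rewrite subKr (NC c w) Nc; lra.
  exfalso; apply: (iv_not_zero (r := rho) (a := c) k0 k2n K0 hu ncst rhop).
    split=> w /cn w1; first by have [] := out w (ltW w1).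
    by have [i1 _] := out w (ltW w1); have [s s0 [_ h2]] := fin_nbhd (tame_iv hu) i1; apply: h2; rewrite subrr N0.
  move=> w /cn w1; have w0 : w != 0 by rewrite -N_gt0; lra.
  have := gz w^-1; rewrite subr0 /g invr_eq0 (negbTE w0) invrK; apply.
  by rewrite NV ltf_pV2 ?posrE ?N_gt0.
have e0 : (0 < e)%N.
  rewrite lt0n; apply/eqP => e0; move: (Gk 0); rewrite g0 e0 mul1r => /esym/eqP.
  by rewrite (negbTE k00).
have zr0 : N (0 - 0) < r by rewrite subrr N0.
have [d d0 hd] := ccont_neq0 (cdiff_cont (hk 0 zr0)) k00.
pose r' := Num.min r d; have r'0 : 0 < r' by rewrite lt_min r0.
have kn0 x : N x < r' -> kf x != 0.
  by rewrite lt_min => /andP[_ /hd[_]]; rewrite add0r.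
(* Near infinity u = z^e / kf (1 / z), so that u^n = z^(n e) v (1 / z). *)
pose v x := (kf x)^-1 ^+ n.
have hv : holo v 0 r'.
  move=> x; rewrite subr0 => xr; apply: cdiffX; apply: cdiffV (kn0 x xr) _.
  by apply: hk; move: xr; rewrite subr0 lt_min => /andP[].
pose c : C := (n * e)%:R.
pose V z := v z^-1.
have big z : r'^-1 < N z -> z != 0 /\ N (z^-1 - 0) < r'.
  move=> h; have z0 : 0 < N z by apply: lt_trans h; rewrite invr_gt0.
  by rewrite -N_gt0 z0 subr0 NV -[r']invrK ltf_pV2 ?posrE ?invr_gt0.
(* In the variable x = 1 / z the operator z d/dz becomes - x d/dx, which turns the recursion of
   [lder] for g = z into one that stays holomorphic at x = 0. There only the factors n e - i
   survive. *)
have [vj [hvj vj0 vjE]] : exists w_ : nat -> C -> C, [/\ forall j, holo (w_ j) 0 r',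
    forall j, w_ j 0 = (\prod_(i < j) (c - i%:R)) * v 0 &
    forall j z, r'^-1 < N z -> lder c (fun x => x) V j z = w_ j z^-1].
  pose w_ := fix w_ j := if j is i.+1 then fun x => (c - i%:R) * w_ i x - x * der (w_ i) x else v.
  exists w_; have hw j : holo (w_ j) 0 r'.
    elim: j => //= j IH x xr; apply: cdiffB; apply: cdiffM; [exact: cdiff_cst|exact: IH|exact: cdiff_id|exact: holo_der IH x xr].
  split=> //.
    by elim=> [|j IH] /=; [rewrite big_ord0 mul1r|rewrite mul0r subr0 IH big_ord_recr /=; ring].
  elim=> [|j IH] z zb //; rewrite lderS (derE (cderiv_id z)) mulr1 IH //=.
  have [z0 zr] := big z zb.
  have dd := cderiv_comp (cderivV z0 (cderiv_id z)) (derP (hw j _ zr)).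
  have p0 : 0 < N z - r'^-1 by lra.
  have zz : N (z - z) < N z - r'^-1 by rewrite subrr N0.
  have d1 := cderiv_ext (near0_eq (g := lder c (fun x => x) V j) zz _) dd.
  rewrite (derE (d1 _)) => [|w wz]; last first.
    by rewrite IH //; have := NB_ge z (z - w); rewrite subKr (NC z); lra.
  congr (_ + _); rewrite -mulrN; move: (der (w_ j) z^-1) => D; field.
  exact: z0.
have FE z : r'^-1 < N z -> u z <> None /\ z ^+ k * Fk n k u z = z ^+ (n * e) * vj k z^-1.
  move=> zb; have ue w : r'^-1 < N w -> u w <> None /\ f w = w ^+ e / kf w^-1.
    move=> wb; have [w0 wr] := big w wb.
    have gw : g w^-1 = G w by rewrite /g invr_eq0 (negbTE w0) invrK.
    have nz : G w != 0 by rewrite -gw Gk subr0 mulf_neq0 ?kn0 ?expf_neq0 ?invr_eq0 //; rewrite subr0 in wr.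
    have [q1 q2] := fin_neq0 nz; split=> //.
    by rewrite q2 -/G -gw Gk subr0 invfM exprVn invrK.
  split; first by have [] := ue z zb.
  have p0 : 0 < N z - r'^-1 by lra.
  have zz : N (z - z) < N z - r'^-1 by rewrite subrr N0.
  have bw w : N (w - z) < N z - r'^-1 -> r'^-1 < N w.
    by move=> wz; have := NB_ge z (z - w); rewrite subKr (NC z); lra.
  have := @dern_lder _ c (fun x => x) V (fun x => x ^+ (n * e)) (fun w => f w ^+ n) z _ k _ _ _ _ _ _ z zz.
  rewrite vjE //; apply => w wz.
  - exact: cdiff_id.
  - have [w0 wr] := big w (bw w wz); apply: (cderiv_diff (cderiv_comp (cderivV w0 (cderiv_id w)) (derP (hv _ wr)))).
  - by apply: cdiffX; exact: cdiff_id.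
  - have [uw _] := ue w (bw w wz); have [s s0 [_ h2]] := fin_nbhd hu uw.
    by apply: cdiffX; apply: h2; rewrite subrr N0.
  - rewrite (derE (cderivX (n * e) (cderiv_id w))) (derE (cderiv_id w)) !mulr1.
    rewrite mulrCA -exprS prednK // muln_gt0 n0 //.
  by rewrite (ue w (bw w wz)).2 expr_div_n -exprM mulnC /V /v exprVn.
have vk0 : vj k 0 != 0.
  rewrite vj0 mulf_neq0 ?expf_neq0 ?invr_eq0 //; apply/prodf_neq0 => j _.
  have lt : (j < n * e)%N.
    by apply: leq_trans (_ : n <= n * e)%N; [apply: ltn_trans (ltn_ord j) kn|rewrite leq_pmulr].
  by rewrite /c -natrB ?(ltnW lt) // pnatr_eq0 subn_eq0 -ltnNge.
have z00 : N (0 - 0) < r' by rewrite subrr N0.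
have [d1 d10 hd1] := ccont_neq0 (cdiff_cont (hvj k 0 z00)) vk0.
pose c1 := N (vj k 0) / 2; have c10 : 0 < c1 by rewrite divr_gt0 ?N_gt0.
(* z^k (u^n)^(k) = z^(n e) vj k (1 / z) with n e > k and vj k 0 nonzero, so (u^n)^(k) grows at least
   linearly and P tends to 0. *)
have low z : r'^-1 < N z -> d1^-1 < N z -> 1 <= N z -> c1 * N z <= N (Fk n k u z).
  move=> zb zd z1; have [uz EQ] := FE z zb; have [z0 _] := big z zb.
  have zp : 0 < N z by rewrite N_gt0.
  have : N z ^+ k.+1 * c1 <= N z ^+ k * N (Fk n k u z).
    rewrite -(NX z k) -NM EQ NM NX; apply: ler_pM; rewrite ?exprn_ge0 ?N_ge0 ?(ltW c10) //.
      apply: ler_weXn2l => //; apply: leq_trans (_ : n <= _)%N; rewrite ?leq_pmulr //.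
    have [] := hd1 z^-1; last by rewrite add0r.
    by rewrite NV -[d1]invrK ltf_pV2 ?posrE ?invr_gt0.
  by rewrite exprSr -mulrA ler_pM2l ?exprn_gt0 // mulrC.
have small (eps : R) z : 0 < eps -> N (P z) <= eps.
  move=> ep; have pi := Pf_entire k0 k2n K0 hu av ncst.
  have i1 : 0 < r'^-1 by rewrite invr_gt0.
  have i2 : 0 < d1^-1 by rewrite invr_gt0.
  have i3 : 0 < eps^-1 by rewrite invr_gt0.
  have i4 : 0 < (1 + eps^-1) / c1 by rewrite divr_gt0 //; lra.
  pose S := 1 + r'^-1 + d1^-1 + (1 + eps^-1) / c1 + N z.
  have Sz := N_ge0 z; have S0 : 0 < S by rewrite /S; lra.
  have SS : S < S + 1 by lra.
  apply: (@max_principle _ P 0 (S + 1) S eps (entire_holo pi) S0 SS); last by rewrite subr0 /S; lra.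
  move=> w; rewrite subr0 => wS; have [uw _] := FE w ltac:(rewrite wS /S; lra).
  have lw := low w ltac:(rewrite wS /S; lra) ltac:(rewrite wS /S; lra) ltac:(rewrite wS /S; lra).
  have big1 : 1 + eps^-1 <= c1 * N w by rewrite mulrC -ler_pdivrMr // wS /S; lra.
  rewrite Pf_fin // NV -[leRHS]invrK lef_pV2 ?posrE ?N_gt0 ?h_neq0 //.
    by have := NB_ge (Fk n k u w) 1; rewrite N1; lra.
by move=> z; apply: N_small => eps ep; exact: small.
Qed.

End Phi.

(** * Nonexistence of the limit map *)

Section LocalStep.
Variable R : realType.
Local Notation C := R[i].
Local Notation N := (@normc R).
Implicit Types (f g F V A phi rho tau : C -> C) (z w l a b h y v c x al : C).

Lemma punctured_eq f g b (r : R) : 0 < r -> ccont f b -> ccont g b ->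
  (forall z, N (z - b) < r -> z != b -> f z = g z) -> f b = g b.
Proof.
move=> r0 cf cg e; apply/eqP; rewrite -subr_eq0; apply/eqP; apply: N_small => eps ep.
have e2 : 0 < eps / 2 by lra.
have [d d0 hd] := near0I (cf _ e2) (cg _ e2).
pose m := Num.min r d / 2; have m0 : 0 < Num.min r d by rewrite lt_min r0.
have m1 : 0 < m by rewrite divr_gt0.
have Nm : N m%:C = m by rewrite Nr gtr0_norm.
have mlt : m < Num.min r d by rewrite /m; lra.
have [md mr] : m < d /\ m < r by move: mlt; rewrite lt_min => /andP[].
have [h1 h2] := hd m%:C ltac:(by rewrite Nm).
have E : f (b + m%:C) = g (b + m%:C).
  by apply: e; [rewrite addrAC subrr add0r Nm|rewrite -subr_eq0 addrAC subrr add0r -N_gt0 Nm].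
have -> : f b - g b = (g (b + m%:C) - g b) - (f (b + m%:C) - f b) by rewrite E; ring.
by apply: le_trans (NB _ _) _; lra.
Qed.

Lemma der_eq_ball f g a z (r : R) : N (z - a) < r ->
  (forall w, N (w - a) < r -> f w = g w) -> der f z = der g z.
Proof. by move=> zr h; apply: der_ext; exact: near0_eq zr h. Qed.

Lemma der_tpow s rho v b (r : R) z : holo rho b r -> N (z - b) < r ->
  (z - b) * der (fun x => v + (x - b) ^+ s * rho x) z =
  (z - b) ^+ s * (s%:R * rho z + (z - b) * der rho z).
Proof.
move=> hr zr; have dX := cderivX s (cderivB (cderiv_id z) (cderiv_cst b z)).
have d := cderivD (cderiv_cst v z) (cderivM dX (derP (hr z zr))).
rewrite (derE d) subr0 mulr1 add0r; case: s {dX d} => [|s]; first by rewrite !mul0r; ring.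
by rewrite exprS; set q := s.+1%:R; ring.
Qed.

(** For g = x - b, [lder] multiplies the coefficient of (z - b)^s by the product of the s + c - i.
    Only the constant term and the one of order s are tracked, the rest staying inside [rj]. *)
Lemma lder_split c v V rho s b (r : R) j : holo rho b r -> 0 < r ->
  (forall z, N (z - b) < r -> V z = v + (z - b) ^+ s * rho z) ->
  exists rj, [/\ holo rj b r, rj b = (\prod_(i < j) (s%:R + c - i%:R)) * rho b &
   forall z, N (z - b) < r -> lder c (fun x => x - b) V j z =
     (\prod_(i < j) (c - i%:R)) * v + (z - b) ^+ s * rj z].
Proof.
move=> hr r0 hV; elim: j => [|j [rj [h1 h2 h3]]].
  by exists rho; split=> [//||z zr]; rewrite big_ord0 mul1r //; exact: hV.
exists (fun z => (s%:R + c - j%:R) * rj z + (z - b) * der rj z); split.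
- move=> z zr; apply: cdiffD; apply: cdiffM; [exact: cdiff_cst|exact: h1|exact: (holo_subr b zr)|exact: (holo_der h1)].
- by rewrite subrr mul0r addr0 h2 big_ord_recr /=; ring.
move=> z zr; rewrite lderS der_subr mulr1 h3 //.
rewrite (der_eq_ball (g := fun x => (\prod_(i < j) (c - i%:R)) * v + (x - b) ^+ s * rj x) zr h3).
rewrite (der_tpow _ _ h1 zr) big_ord_recr /=; ring.
Qed.

Lemma lder_cst c v V b (r : R) j : (forall z, N (z - b) < r -> V z = v) ->
  forall z, N (z - b) < r -> lder c (fun x => x - b) V j z = (\prod_(i < j) (c - i%:R)) * v.
Proof.
move=> hV; elim: j => [|j IH] z zr; first by rewrite big_ord0 mul1r; exact: hV.
rewrite lderS der_subr mulr1 IH // (der_eq_ball (g := fun=> (\prod_(i < j) (c - i%:R)) * v) zr IH).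
by rewrite (derE (cderiv_cst _ z)) mulr0 addr0 big_ord_recr /=; ring.
Qed.

Lemma prod_rising (n k s : nat) : (s <= n)%N ->
  \prod_(i < k) (s%:R - n%:R - i%:R) = (-1) ^+ k * (\prod_(i < k) (n - s + i))%N%:R :> C.
Proof.
move=> sn; elim: k => [|k IH]; first by rewrite !big_ord0 mul1r.
by rewrite !big_ord_recr /= IH natrM natrD natrB // exprS; ring.
Qed.

(* Comparing the coefficients of (z - b) ^ s in the equation for B gives
   (n + k) n (n+1) ... (n+k-1) = - s n (n-s) ... (n-s+k-1) unless tau b = 0. *)
Lemma local_step (n k s : nat) c al A tau b (r : R) : (s < n)%N -> (0 < s)%N ->
  0 < r -> holo A b r -> holo tau b r -> A b = al -> al != 0 -> c * al = - (n + k)%:R ->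
  (forall z, N (z - b) < r -> A z = al + (z - b) ^+ s * tau z) ->
  (forall z, N (z - b) < r -> c * A z * Bp n k 1 A b z = - (n + k)%:R * Bp n k 1 A b z + (z - b) * der (Bp n k 1 A b) z) ->
  tau b = 0.
Proof.
move=> sn s0 r0 hA ht Ab al0 cal EA EB.
have bb : N (b - b) < r by rewrite subrr N0.
(* The cofactor in A^n - al^n = (A - al) S, so that A^n = al^n + (z - b)^s tau S. *)
pose S z := \sum_(i < n) A z ^+ (n.-1 - i) * al ^+ i.
have hS : holo S b r.
  move=> z zr; exists (\sum_(i < n) der (fun z => A z ^+ (n.-1 - i) * al ^+ i) z).
  apply: cderiv_sum => i; apply: derP; apply: cdiffM (cdiff_cst _ _).
  by apply: cdiffX; exact: hA.
have Sb : S b = n%:R * al ^+ n.-1.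
  rewrite /S Ab (eq_bigr (fun=> al ^+ n.-1)) => [|i _].
    by rewrite sumr_const card_ord mulr_natl.
  rewrite -exprD subnK //; have := ltn_ord i; lia.
have hrho : holo (fun z => tau z * S z) b r by move=> z zr; apply: cdiffM; [exact: ht|exact: hS].
have EV z : N (z - b) < r -> A z ^+ n = al ^+ n + (z - b) ^+ s * (tau z * S z).
  move=> zr; have -> : A z ^+ n = al ^+ n + (A z ^+ n - al ^+ n) by rewrite addrC subrK.
  by rewrite subrXX mulrA; congr (_ + _ * _); rewrite EA // addrC addKr.
have [rk [k1 k2 k3]] := lder_split (- n%:R) k hrho r0 EV.
set lam := \prod_(i < k) (- n%:R - i%:R) in k3.
pose be z := rk z - (z - b) ^+ (n + k - s).
have hbe : holo be b r.
  by move=> z zr; apply: cdiffB; [exact: k1|apply: cdiffX; exact: (holo_subr b zr)].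
have beb : be b = rk b by rewrite /be subrr expr0n subn_eq0 leqNgt ltn_addr // subr0.
have EBp z : N (z - b) < r -> Bp n k 1 A b z = lam * al ^+ n + (z - b) ^+ s * be z.
  move=> zr; rewrite /Bp muln1 k3 // /be mulrBr -exprD subnKC ?addrA //.
  by apply: leq_trans (ltnW sn) (leq_addr _ _).
(* As c al = - (n + k), the constant term of A cancels against the - (n + k) B of the equation, and
   what remains is divisible by (z - b)^s. Continuity then allows evaluation at b. *)
have ES z : N (z - b) < r -> z != b -> c * tau z * Bp n k 1 A b z = s%:R * be z + (z - b) * der be z.
  move=> zr zb; have tn : (z - b) ^+ s != 0 by rewrite expf_neq0 // subr_eq0.
  apply: (mulfI tn); rewrite -(der_tpow s (lam * al ^+ n) hbe zr).
  have E := EB z zr; rewrite (der_eq_ball (g := fun x => lam * al ^+ n + (x - b) ^+ s * be x) zr EBp) in E.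
  have -> : (z - b) * der (fun x => lam * al ^+ n + (x - b) ^+ s * be x) z = (c * A z + (n + k)%:R) * Bp n k 1 A b z.
    by rewrite [RHS]mulrDl E; ring.
  by rewrite EA // [c * (al + _)]mulrDr cal; ring.
have E0 : c * tau b * Bp n k 1 A b b = s%:R * be b + (b - b) * der be b.
  apply: (@punctured_eq (fun z => c * tau z * Bp n k 1 A b z) (fun z => s%:R * be z + (z - b) * der be z) b r r0) ES.
    apply: cdiff_cont; apply: cdiffM; last exact: Bp_holo hA b bb.
    by apply: cdiffM (cdiff_cst _ _) _; exact: ht.
  apply: cdiff_cont; apply: cdiffD; apply: cdiffM; [exact: cdiff_cst|exact: hbe|exact: (holo_subr b bb)|exact: holo_der hbe b bb].
rewrite subrr mul0r addr0 beb k2 Sb (EBp b bb) subrr expr0n (gtn_eqF s0) mul0r addr0 in E0.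
apply/eqP; apply: contrapT => /negP t0.
have aln : al ^+ n.-1 != 0 by rewrite expf_neq0.
have n0 : (0 < n)%N by apply: leq_ltn_trans sn.
have ealn : al ^+ n = al * al ^+ n.-1 by rewrite -exprS prednK.
rewrite ealn in E0.
have E1 : (c * al) * lam = s%:R * n%:R * \prod_(i < k) (s%:R - n%:R - i%:R).
  apply: (mulfI t0); apply: (mulfI aln); move: E0; set q := \prod_(i < k) (s%:R + _ - _) => E0.
  have -> : al ^+ n.-1 * (tau b * (c * al * lam)) = c * tau b * (lam * (al * al ^+ n.-1)) by ring.
  by rewrite E0; ring.
have L : lam = \prod_(i < k) (0%:R - n%:R - i%:R) by apply: eq_bigr => i _; rewrite sub0r.
rewrite cal L !prod_rising // ?(ltnW sn) // subn0 in E1.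
(* Up to sign, the two products of negative factors are products of natural numbers, and the
   equation makes the sum of a positive and a nonnegative integer vanish. *)
have /eqP : (-1) ^+ k * (((n + k) * (\prod_(i < k) (n + i)) + s * n * (\prod_(i < k) (n - s + i)))%N%:R) = 0 :> C.
  by rewrite natrD 2!natrM natrM mulrDr mulrCA -[X in X + _]opprK -mulNr E1; ring.
rewrite mulf_eq0 expf_eq0 oppr_eq0 oner_eq0 andbF /= pnatr_eq0 addn_eq0 !muln_eq0 addn_eq0 (gtn_eqF n0) /=.
move=> /andP[+ _]; apply/negP; rewrite -lt0n; apply: prodn_gt0 => i; lia.
Qed.

End LocalStep.

(** * A nonconstant tame map cannot avoid the value 1 *)

Section NoTame.
Variable R : realType.
Local Notation C := R[i].
Local Notation N := (@normc R).
Implicit Types (g F V A phi Psi : C -> C) (z w l a b h y v c x : C).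
Variables (n k : nat) (u : C -> option C) (K : R).
Hypothesis k0 : (0 < k)%N.
Hypothesis k2n : (k + 2 <= n)%N.
Hypothesis K0 : 0 <= K.
Hypothesis hu : tame u K.
Hypothesis av : forall z, avoids n k u z.
Hypothesis ncst : ~ exists p, forall z, u z = p.

Let kn : (k < n)%N. Proof. by rewrite (leq_trans _ k2n) // addn2 ltnS leqnSn. Qed.
Let n0 : (0 < n)%N. Proof. exact: leq_ltn_trans kn. Qed.
Local Notation f := (fin u).
Local Notation P := (Pf n k u).

Lemma Pf_neq0 z : u z <> None -> P z != 0.
Proof. by move=> uz; rewrite Pf_fin // invr_eq0; exact: h_neq0. Qed.

Lemma ratio_const Psi (K1 : R) : entire Psi -> 0 <= K1 ->
  (forall M : R, 0 <= M -> exists B : R, forall z, ple (u z) M -> N (Psi z) <= B) ->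
  (forall z, u z <> None -> ~ ple (u z) 1 -> N (Psi z) <= K1 * (1 + N (der P z / P z)) ^+ 2) ->
  forall z w, Psi z = Psi w.
Proof.
move=> ePsi K10 hB hK.
have [a [v [ua v0]]] := finite_nonzero_exists k0 k2n K0 hu ncst.
have ua' : u a <> None by rewrite ua.
have eP := Pf_entire k0 k2n K0 hu av ncst.
have [C0 C00 gP] := Pf_growth k0 k2n K0 hu av ncst ua'.
have [K2 hK2] := good_circle eP (Pf_neq0 ua') C00 gP.
have [B hB1] := hB 1 ler01.
have circ (rho : R) : 1 <= rho -> exists r : R, [/\ rho / 2 <= r, r <= rho &
    forall z, N (z - a) = r -> N (Psi z) <= (`|B| + K1 * (1 + `|K2|) ^+ 2) * rho ^+ 2].
move=> rho1; have [r [r1 r2 hr]] := hK2 rho rho1; exists r; split=> // z zr.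
have [Pz dP] := hr z zr.
(* P vanishes at the poles of u, so a circle without zeros of P meets no pole and one of the two
   bounds on Psi applies at each point. *)
have uz : u z <> None by move=> e; move/eqP: Pz; apply; rewrite /Pf e.
have rr : 1 <= rho ^+ 2 by rewrite expr_ge1 //; lra.
have q0 : 0 <= K1 * (1 + `|K2|) ^+ 2 by rewrite mulr_ge0 // sqr_ge0.
have [uz1|uz1] := pselect (ple (u z) 1).
  apply: le_trans (hB1 z uz1) _; apply: le_trans (ler_norm B) _.
  apply: le_trans (_ : `|B| + K1 * (1 + `|K2|) ^+ 2 <= _); first by rewrite lerDl.
  by rewrite ler_peMr // addr_ge0.
apply: le_trans (hK z uz uz1) _; apply: le_trans (_ : K1 * (1 + `|K2|) ^+ 2 * rho ^+ 2 <= _); last first.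
  by rewrite ler_wpM2r ?sqr_ge0 // lerDr.
rewrite -mulrA -exprMn ler_wpM2l // lerXn2r ?nnegrE ?addr_ge0 ?mulr_ge0 ?N_ge0 //; try lra.
have : K2 * rho <= `|K2| * rho by rewrite ler_wpM2r ?ler_norm //; lra.
lra.
have [cst|inf] := poly_growth ePsi circ.
  by move=> z w; rewrite cst [RHS]cst.
have Pz : forall z, P z = 0.
  apply: (Pf_decay k0 k2n K0 hu av ncst) => M.
    have M0 : 0 <= Num.max 0 M by rewrite le_max lexx.
    have [B' hB'] := hB _ M0.
    have [rho hrho] := inf (B' + 1); exists (rho + N a) => z zr [u1 u2].
    have : N (Psi z) <= B' by apply: hB'; split=> //; rewrite le_max u2 orbT.
    have := hrho z ltac:(have := NB_ge z a; lra); lra.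
by have := Pf_neq0 ua'; rewrite Pz eqxx.
Qed.

(** Where |u| > 1, |Phi| = |P' / (P u)| <= |P' / P|, so [ratio_const] applies to Phi. *)
Lemma Phi_const : exists2 c, c != 0 & forall z v, u z = Some v -> v != 0 -> der P z = - (c * v * P z).
Proof.
have [Phi [e1 e2 e3]] := Phi_exists k0 k2n K0 hu av ncst.
have [a [v [ua v0]]] := finite_nonzero_exists k0 k2n K0 hu ncst.
have cst : forall z w, Phi z = Phi w.
  apply: (ratio_const e1 ler01 e3) => z uz nz; rewrite mul1r.
  case E : (u z) uz => [y|] // _.
  have y1 : 1 < N y by rewrite ltNge; apply/negP => y1; apply: nz; rewrite E; apply/ple_some.
  have y0 : y != 0 by rewrite -N_gt0; lra.
  have Pz : P z != 0 by apply: Pf_neq0; rewrite E.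
  have -> : der P z / P z = - (Phi z * y) by rewrite (e2 _ _ E y0) mulNr mulfK.
  rewrite NN NM; have := N_ge0 (Phi z); move: (N _) y1 (N _) => q q1 p p0.
  have : 0 <= p * (q - 1) by rewrite mulr_ge0 // subr_ge0 ltW.
  have : 0 <= (p * q) ^+ 2 by rewrite sqr_ge0.
  nra.
exists (Phi a) => [|z w E w0]; last by rewrite (e2 _ _ E w0) (cst z a).
(* For c = 0 the function P is constant near a, hence so is (u^n)^(k), which [fin_not_const]
   excludes. *)
apply/eqP => c0.
have uan : u a <> None by rewrite ua.
have [r r0 fh] := fin_nbhd hu uan.
  have aa : N (a - a) < r by rewrite subrr N0.
  have fa : f a != 0 by rewrite (finP ua).
  have [d d0 hd] := ccont_neq0 (cdiff_cont (fh.2 a aa)) fa.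
  pose s := Num.min r d; have s0 : 0 < s by rewrite lt_min r0.
  have fin_s w : N (w - a) < s -> u w <> None /\ f w != 0.
    rewrite lt_min => /andP[w1 w2]; split; first exact: fh.1.
    by have [_] := hd _ w2; rewrite subrKC.
  have fh' : fholo u a s.
    by split=> [w /fin_s[]//|]; apply: holoW fh.2; rewrite ge_min lexx.
  apply: (fin_not_const k2n K0 hu ncst (c := Fk n k u a) s0 fh') => z zs.
  have Pc : P z = P a.
    apply: (zero_der_const (r := s)) zs => w ws; have [uw fw] := fin_s w ws.
    have eP := Pf_entire k0 k2n K0 hu av ncst.
    case E : (u w) uw => [y|] // _; have y0 : y != 0 by rewrite -(finP E).
    by apply: cderiv_eq (derP (eP w)) _; rewrite (e2 _ _ E y0) (cst w a) c0 !mul0r oppr0.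
  have [uz _] := fin_s z zs; move: Pc; rewrite !Pf_fin // ?ua // => /invr_inj.
  by move/(congr1 (fun x => x + 1)); rewrite !subrK.
Qed.

(** With t = z - b, inserting P = t^m / B and u = A / t^p into P' = - c u P gives c A B = t^(p-1) (-
    m B + t B'). At t = 0 the left side is nonzero, which forces p = 1. *)
Lemma pole_eq c b (r : R) p A : c != 0 ->
  (forall z v, u z = Some v -> v != 0 -> der P z = - (c * v * P z)) -> u b = None ->
  0 < r -> (0 < p)%N -> holo A b r ->
  (forall z, N (z - b) < r -> A z != 0 /\ Bp n k p A b z != 0) ->
  (forall z, N (z - b) < r -> z != b -> u z = Some (A z / (z - b) ^+ p) /\
     Fk n k u z - 1 = Bp n k p A b z / (z - b) ^+ (n * p + k)) ->
  p = 1%N /\ forall z, N (z - b) < r ->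
    c * A z * Bp n k 1 A b z = - (n + k)%:R * Bp n k 1 A b z + (z - b) * der (Bp n k 1 A b) z.
Proof.
move=> c0 hc ub r0 p0 hA h1 h2.
have bb : N (b - b) < r by rewrite subrr N0.
pose B := Bp n k p A b; pose m := (n * p + k)%N.
have hB : holo B b r by exact: Bp_holo.
have m0 : (0 < m)%N by rewrite addn_gt0 k0 orbT.
have E1 z : N (z - b) < r -> z != b ->
    c * A z * B z = (z - b) ^+ p.-1 * (- m%:R * B z + (z - b) * der B z).
  move=> zr zb; have [uz _] := h2 z zr zb; have [Az Bz] := h1 z zr.
  have tz : z - b != 0 by rewrite subr_eq0.
  have vz : A z / (z - b) ^+ p != 0 by rewrite mulf_neq0 // invr_eq0 expf_neq0.
  have := hc _ _ uz vz.
  have PE := Pf_pole k0 h1 h2 ub.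
  rewrite (der_eq_ball (g := fun x => (x - b) ^+ m * (B x)^-1) zr PE) PE //.
  have dX := cderivX m (cderivB (cderiv_id z) (cderiv_cst b z)).
  rewrite (derE (cderivM dX (cderivV Bz (derP (hB z zr))))) -/B -/m subr0 mulr1.
  have -> : (z - b) ^+ p = (z - b) * (z - b) ^+ p.-1 by rewrite -exprS prednK.
  have -> : (z - b) ^+ m = (z - b) * (z - b) ^+ m.-1 by rewrite -exprS prednK.
  have t1 : (z - b) ^+ p.-1 != 0 by rewrite expf_neq0.
  have t2 : (z - b) ^+ m.-1 != 0 by rewrite expf_neq0.
  have Bz' : B z != 0 := Bz; move: t1 t2 tz Bz' Az; clear.
  move: (z - b) (der B z) (B z) (A z) (m%:R) => t b1 b2 a1 mm; move: (t ^+ p.-1) (t ^+ m.-1) => t1 t2.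
  move=> n1 n2 n3 n4 n5 E.
  have X : mm * t2 * b2 - t * t2 * b1 = - (c * a1 * t2 * b2) / t1.
    have -> : mm * t2 * b2 - t * t2 * b1 = (mm * t2 / b2 + t * t2 * (- b1 / b2 ^+ 2)) * b2 ^+ 2 by field; rewrite n4.
    by rewrite E; field; rewrite n1 n3 n4.
  have X2 : mm * b2 - t * b1 = - (c * a1 * b2) / t1.
    apply: (mulfI n2); rewrite mulrBr [t2 * (mm * _)]mulrCA [t2 * (t * _)]mulrCA.
    by rewrite !mulrA X; field; rewrite n1.
  have -> : - mm * b2 + t * b1 = - (mm * b2 - t * b1) by ring.
  by rewrite X2; field; rewrite n1.
have Bb : cdiff B b := hB b bb.
have E2 z : N (z - b) < r -> c * A z * B z = (z - b) ^+ p.-1 * (- m%:R * B z + (z - b) * der B z).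
  move=> zr; have [->|zb] := eqVneq z b; last exact: E1.
  apply: (@punctured_eq _ (fun z => c * A z * B z) (fun z => (z - b) ^+ p.-1 * (- m%:R * B z + (z - b) * der B z)) b r r0) E1.
    apply: cdiff_cont; apply: cdiffM Bb; apply: cdiffM (cdiff_cst _ _) _; exact: hA.
  apply: cdiff_cont; apply: cdiffM; first by apply: cdiffX; exact: (holo_subr b bb).
  apply: cdiffD; apply: cdiffM; [exact: cdiff_cst|exact: Bb|exact: (holo_subr b bb)|exact: holo_der hB b bb].
have p1 : p = 1%N.
  case: p p0 @B @m hB m0 E1 Bb E2 h1 {h2} => [//|[//|p]] _ B m hB m0 E1 Bb E2 h1.
  have := E2 b bb; rewrite subrr /= exprS !mul0r => /eqP.
  by have [Ab Bb'] := h1 b bb; rewrite !mulf_eq0 (negbTE c0) (negbTE Ab) (negbTE Bb').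
split=> // z zr; have := E2 z zr; rewrite /B /m p1 /= mul1r muln1; exact.
Qed.

(** The pole equation at b gives A b = - (n + k) / c, and [local_step] with s = 1 and then s = 2
    removes the next two coefficients; s = 2 is allowed because n >= k + 2 >= 3. *)
Lemma pole_expansion c b : c != 0 ->
  (forall z v, u z = Some v -> v != 0 -> der P z = - (c * v * P z)) -> u b = None ->
  exists (r : R) sg, [/\ 0 < r, holo sg b r,
    forall z, N (z - b) < r -> - (n + k)%:R / c + (z - b) ^+ 3 * sg z != 0 /\
     (z != b -> u z = Some ((- (n + k)%:R / c + (z - b) ^+ 3 * sg z) / (z - b)))
   & forall z, N (z - b) < r -> let A x := - (n + k)%:R / c + (x - b) ^+ 3 * sg x in
     c * A z * Bp n k 1 A b z = - (n + k)%:R * Bp n k 1 A b z + (z - b) * der (Bp n k 1 A b) z].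
Proof.
move=> c0 hc ub; have [r [p [A [r0 p0 hA h1 h2]]]] := pole_data k0 k2n K0 hu ncst ub.
have [p1 E] := pole_eq c0 hc ub r0 p0 hA h1 h2; rewrite p1 in h1 h2.
have bb : N (b - b) < r by rewrite subrr N0.
have [Ab Bb] := h1 b bb.
have cA : c * A b = - (n + k)%:R.
  by apply: (mulIf Bb); rewrite E // subrr mul0r addr0.
have EA : - (n + k)%:R / c = A b by rewrite -cA mulrAC mulfV ?mul1r.
pose t1 := dquot A b; pose t2 := dquot t1 b; pose t3 := dquot t2 b.
have d1 : holo t1 b r by exact: dquot_holo.
have d2 : holo t2 b r by exact: dquot_holo.
have d3 : holo t3 b r by exact: dquot_holo.
have n2 : (2 < n)%N by apply: leq_trans k2n; rewrite addn2; case: k k0.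
have z1 : t1 b = 0.
  apply: (local_step (s := 1) _ _ r0 hA d1 (erefl (A b)) Ab cA _ E) => //; first by apply: ltn_trans n2.
  by move=> z zr; rewrite expr1; exact: dquotP.
have e2 z : A z = A b + (z - b) ^+ 2 * t2 z.
  by rewrite {1}(dquotP A b z) -/t1 (dquotP t1 b z) -/t2 z1 add0r mulrA.
have z2 : t2 b = 0.
  by apply: (local_step (s := 2) _ _ r0 hA d2 (erefl (A b)) Ab cA _ E) => //.
have e3 : A = fun z => - (n + k)%:R / c + (z - b) ^+ 3 * t3 z.
  apply/funext => z; rewrite EA {1}e2 (dquotP t2 b z) -/t3 z2 add0r mulrA; congr (_ + _ * _).
  by rewrite -exprSr.
exists r, t3; split=> // z zr.
  have := h1 z zr; have := h2 z zr; rewrite e3 => q1 [q2 _]; split=> // zb.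
  by have [-> _] := q1 zb; rewrite expr1.
by have := E z zr; rewrite {1 2 3 4}e3.
Qed.

Lemma no_tame : False.
Proof.
have [c c0 hc] := Phi_const; have Nc : 0 < N c by rewrite N_gt0.
have ratio z v : u z = Some v -> ~ ple (u z) 1 -> N v = N (der P z / P z) / N c.
  move=> E nz.
  have v1 : 1 < N v by rewrite ltNge; apply/negP => v1; apply: nz; rewrite E; apply/ple_some.
  have v0 : v != 0 by rewrite -N_gt0; lra.
  have Pz : P z != 0 by apply: Pf_neq0; rewrite E.
  have -> : der P z / P z = - (c * v) by rewrite (hc _ _ E v0) mulNr mulfK.
  by rewrite NN NM mulrAC divff ?mul1r ?gt_eqF.
have [[b ub]|np] := pselect (exists b, u b = None); last first.
  have ent : entire f.
    by move=> z; case E : (u z) => [v|]; [exact: sholo_cdiff (hu z).1 E|case: np; exists z].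
  have cst : forall z w, f z = f w.
    apply: (@ratio_const f (N c)^-1 ent) => [|M M0|z uz nz].
    - by rewrite invr_ge0 ltW.
    - by exists M => z [].
    case E : (u z) uz => [v|] // _; rewrite (finP E) (ratio _ _ E nz) mulrC.
    rewrite ler_wpM2l ?invr_ge0 ?(ltW Nc) //.
    by have := N_ge0 (der P z / P z); move: (N _) => x x0; nra.
  apply: ncst; exists (u 0) => z; have := cst z 0; rewrite /fin.
  case E : (u z) => [v|]; last by case: np; exists z.
  by case F : (u 0) => [v'|]; [move=> /= ->|case: np; exists 0].
pose m : C := (n + k)%:R.
have m0 : m != 0 by rewrite pnatr_eq0 addn_eq0 (gtn_eqF n0).
(* The value 0 at a pole is the right one: for u = - m / (c t) + t^2 sg the double poles of both
   terms cancel and the remainder is divisible by t. *)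
pose H z := if u z is Some v then c * der f z - c ^+ 2 * v ^+ 2 / m else 0.
have Hfin z (r : R) : fholo u z r -> forall w, N (w - z) < r -> H w = c * der f w - c ^+ 2 * f w ^+ 2 / m.
  by move=> [fh _] w /fh; rewrite /H; case E : (u w) => [v|] // _; rewrite (finP E).
have Hpole x : u x = None -> exists (r : R) sg, [/\ 0 < r, holo sg x r &
    forall z, N (z - x) < r -> H z = (z - x) * (4 * c * sg z + c * (z - x) * der sg z - c ^+ 2 * (z - x) ^+ 3 * sg z ^+ 2 / m)].
  move=> ux; have [r [sg [r0 hs h1 _]]] := pole_expansion c0 hc ux.
  exists r, sg; split=> // z zr; have [->|zx] := eqVneq z x.
    by rewrite /H ux subrr mul0r.
  have [_ /(_ zx) uz] := h1 z zr.
  have s0 : 0 < Num.min (r - N (z - x)) (N (z - x)).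
    by rewrite lt_min N_gt0 subr_eq0 zx subr_gt0 zr.
  have zz : N (z - z) < Num.min (r - N (z - x)) (N (z - x)) by rewrite subrr N0.
  rewrite /H uz (der_eq_ball (g := fun y => (- (n + k)%:R / c + (y - x) ^+ 3 * sg y) * (y - x)^-1) zz); last first.
    move=> w; rewrite lt_min => /andP[w1 w2].
    have wr : N (w - x) < r by have := ND3 z x w; lra.
    have wx : w != x by apply/eqP => e; move: w2; rewrite e NC ltxx.
    by have [_ /(_ wx) uw] := h1 w wr; rewrite (finP uw).
  have dt := cderivB (cderiv_id z) (cderiv_cst x z).
  have tz : z - x != 0 by rewrite subr_eq0.
  have dA := cderivD (cderiv_cst (- (n + k)%:R / c) z) (cderivM (cderivX 3 dt) (derP (hs z zr))).
  rewrite (derE (cderivM dA (@cderivV _ (fun y => y - x) z _ tz dt))) -/m /= subr0.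
  move: c0 m0 tz; clear; move: (der sg z) (sg z) (z - x) m => s1 s t mm q1 q2 q3.
  by field; rewrite q1 q2 q3.
have eH : entire H.
  move=> z; case E : (u z) => [v|].
    have uz : u z <> None by rewrite E.
    have [r r0 fh] := fin_nbhd hu uz.
    have zz : N (z - z) < r by rewrite subrr N0.
    apply: (@cdiff_ext _ (fun w => c * der f w - c ^+ 2 * f w ^+ 2 * m^-1)).
      by apply: (@near0_eq _ (fun w => c * der f w - c ^+ 2 * f w ^+ 2 / m) H z z r zz) => w wr; rewrite (Hfin z r fh w wr).
    apply: cdiffB; first by apply: cdiffM (cdiff_cst _ _) _; exact: holo_der fh.2 z zz.
    apply: cdiffM (cdiff_cst _ _); apply: cdiffM (cdiff_cst _ _) _.
    by apply: cdiffX; exact: fh.2.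
  have [r [sg [r0 hs h1]]] := Hpole z E.
  have zz : N (z - z) < r by rewrite subrr N0.
  apply: (@cdiff_ext _ (fun w => (w - z) * (4 * c * sg w + c * (w - z) * der sg w - c ^+ 2 * (w - z) ^+ 3 * sg w ^+ 2 * m^-1))).
    by apply: near0S (near0_eq zz h1) => x ->.
  have dt := holo_subr z zz; have ds := hs z zz; have ds' := holo_der hs zz.
  apply: cdiffM (dt) _; apply: cdiffB.
    apply: cdiffD; first by apply: cdiffM (cdiff_cst _ _) (ds).
    by apply: cdiffM (ds'); apply: cdiffM (cdiff_cst _ _) (dt).
  apply: cdiffM (cdiff_cst _ _); apply: cdiffM; last exact: cdiffX.
  by apply: cdiffM (cdiff_cst _ _) _; exact: cdiffX.
have Nm : 1 <= N m by rewrite Nnat ler1n addn_gt0 n0.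
have Hbd z v : u z = Some v -> N (H z) <= N c * (K * (1 + N v ^+ 2)) + N c ^+ 2 * N v ^+ 2.
  move=> E; rewrite /H E; apply: le_trans (NB _ _) _; rewrite lerD // NM.
    by rewrite ler_wpM2l ?N_ge0 //; apply: der_sder E (hu z).2.
  rewrite NV NM !NX ler_pdivrMr ?(lt_le_trans ltr01) // ler_peMr //.
  by rewrite mulr_ge0 ?exprn_ge0 ?N_ge0.
(* |u'| <= K (1 + |u|^2) makes H of size O(1 + |u|^2), and |u| = |P' / P| / |c| where |u| > 1. This
   is the reason for the square in [ratio_const]. *)
have cst : forall z w, H z = H w.
  apply: (@ratio_const H (N c * K + K / N c + 1) eH).
  - by rewrite !addr_ge0 ?mulr_ge0 ?invr_ge0 ?N_ge0.
  - move=> M M0; exists (N c * (K * (1 + M ^+ 2)) + N c ^+ 2 * M ^+ 2) => z [].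
    case E : (u z) => [v|] // _ vM; apply: le_trans (Hbd _ _ E) _.
    have v2 : N v ^+ 2 <= M ^+ 2 by rewrite lerXn2r ?nnegrE ?N_ge0.
    by rewrite lerD // ler_wpM2l ?sqr_ge0 ?(ltW Nc) // ler_wpM2l // lerD2l.
  move=> z uz nz; case E : (u z) uz => [v|] // _; apply: le_trans (Hbd _ _ E) _.
  rewrite (ratio _ _ E nz); have := N_ge0 (der P z / P z); move: (N (_ / _)) (N c) Nc K0 => x q q0 Kp x0.
  have -> : q * (K * (1 + (x / q) ^+ 2)) + q ^+ 2 * (x / q) ^+ 2 = q * K + K / q * x ^+ 2 + x ^+ 2.
    by field; rewrite gt_eqF.
  have a1 : 0 <= q * K by rewrite mulr_ge0 // ltW.
  have a2 : 0 <= K / q by rewrite divr_ge0 // ltW.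
  have x2 : 0 <= x ^+ 2 by rewrite sqr_ge0.
  move: (q * K) (K / q) a1 a2 => s t s0 t0.
  have : 0 <= s * x by rewrite mulr_ge0.
  have : 0 <= s * x ^+ 2 by rewrite mulr_ge0.
  have : 0 <= t * x by rewrite mulr_ge0.
  by lra.
have H0 z : H z = 0 by rewrite (cst z b) /H ub.
have [r [sg [r0 hs h1 h2]]] := pole_expansion c0 hc ub.
pose A x := - (n + k)%:R / c + (x - b) ^+ 3 * sg x.
have bb : N (b - b) < r by rewrite subrr N0.
have hA : holo A b r.
  move=> x xr; apply: cdiffD (cdiff_cst _ _) _; apply: cdiffM; last exact: hs.
  by apply: cdiffX; exact: (holo_subr b xr).
have Ab : A b = - m / c by rewrite /A subrr expr0n mul0r addr0.
(* H = 0 is a Riccati equation for u; with u = A / t it reads t A' = A + (c / m) A^2. *)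
have EA z : N (z - b) < r -> (z - b) * der A z = A z + c / m * A z ^+ 2.
  move=> zr; have [->|zb] := eqVneq z b.
    by rewrite subrr mul0r Ab; move: (m) m0 => mm m1; field; rewrite c0 m1.
  have [Az /(_ zb) uz] := h1 z zr.
  have s0 : 0 < Num.min (r - N (z - b)) (N (z - b)).
    by rewrite lt_min N_gt0 subr_eq0 zb subr_gt0 zr.
  have zz : N (z - z) < Num.min (r - N (z - b)) (N (z - b)) by rewrite subrr N0.
  have := H0 z; rewrite /H uz (der_eq_ball (g := fun y => A y * (y - b)^-1) zz); last first.
    move=> w; rewrite lt_min => /andP[w1 w2].
    have wr : N (w - b) < r by have := ND3 z b w; lra.
    have wb : w != b by apply/eqP => e; move: w2; rewrite e NC ltxx.
    by have [_ /(_ wb) uw] := h1 w wr; rewrite (finP uw).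
  have dt := cderivB (cderiv_id z) (cderiv_cst b z).
  have tz : z - b != 0 by rewrite subr_eq0.
  rewrite (derE (cderivM (derP (hA z zr)) (@cderivV _ (fun y => y - b) z _ tz dt))) -/(A z) subr0.
  move: c0 m0 tz; clear; move: (der A z) (A z) (z - b) m => a1 a t mm q1 q2 q3 E.
  apply/eqP; rewrite -subr_eq0; apply/eqP.
  have -> : t * a1 - (a + c / mm * a ^+ 2) = (c * (a1 / t + a * (- 1 / t ^+ 2)) - c ^+ 2 * (a / t) ^+ 2 / mm) * (t ^+ 2 / c).
    by field; rewrite q1 q2 q3.
  by rewrite E mul0r.
(* The Riccati equation becomes linear for t / A = 1 / u: t / A + (c / m) t has derivative 0 and
   vanishes at b. Hence A is constant. *)
have JE z : N (z - b) < r -> (z - b) / A z + c / m * (z - b) = 0.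
  move=> zr; have := @zero_der_const _ (fun x => (x - b) * (A x)^-1 + c / m * (x - b)) b r _ z zr.
  rewrite !subrr mul0r mulr0 addr0; apply => w wr.
  have dt := cderivB (cderiv_id w) (cderiv_cst b w).
  have [Aw _] := h1 w wr; have Aw' : A w != 0 := Aw.
  apply: cderiv_eq (cderivD (cderivM dt (cderivV Aw' (derP (hA w wr)))) (cderivMl (c / m) dt)) _.
  rewrite subr0 mul1r.
  have -> : (w - b) * (- der A w / A w ^+ 2) = - ((w - b) * der A w) / A w ^+ 2 by ring.
  by rewrite EA //; move: (m) m0 => mm m1; field; rewrite m1 Aw'.
have Acst z : N (z - b) < r -> A z = - m / c.
  move=> zr; have [->|zb] := eqVneq z b; first exact: Ab.
  have tz : z - b != 0 by rewrite subr_eq0.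
  have [Az _] := h1 z zr; have Az' : A z != 0 := Az.
  have := JE z zr; rewrite mulrC -mulrDl => /eqP; rewrite mulf_eq0 (negbTE tz) orbF addr_eq0 => /eqP e.
  by rewrite -[A z]invrK e invrN invf_div mulNr.
pose al := - m / c.
have EV z : N (z - b) < r -> A z ^+ n = al ^+ n by move=> zr; rewrite Acst.
have EL := lder_cst (- n%:R) k EV.
set lam := \prod_(i < k) _ in EL.
have EBp z : N (z - b) < r -> Bp n k 1 A b z = lam * al ^+ n - (z - b) ^+ (n + k).
  by move=> zr; rewrite /Bp muln1 EL.
(* With A = al constant the pole equation reduces to t B' = 0 although B = lam al^n - t^(n+k). Any t
   != 0 in the disc gives the contradiction; here t = r / 2. *)
pose z := b + (r / 2)%:C.
have r2 : 0 < r / 2 by lra.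
have zr : N (z - b) < r by rewrite addrAC subrr add0r Nr gtr0_norm //; lra.
have tz : z - b != 0 by rewrite addrAC subrr add0r -N_gt0 Nr gtr0_norm.
have : c * A z * Bp n k 1 A b z = - m * Bp n k 1 A b z + (z - b) * der (Bp n k 1 A b) z := h2 z zr.
rewrite Acst // [c * _]mulrCA mulfV // mulr1.
rewrite (der_eq_ball (g := fun x => lam * al ^+ n - (x - b) ^+ (n + k)) zr EBp).
have dX := cderivX (n + k) (cderivB (cderiv_id z) (cderiv_cst b z)).
rewrite (derE (cderivB (cderiv_cst (lam * al ^+ n) z) dX)) -/m => /eqP.
rewrite -subr_eq0 opprD addrA subrr sub0r oppr_eq0 mulf_eq0 (negbTE tz) /= subr0 mulr1 sub0r oppr_eq0.
by rewrite mulf_eq0 (negbTE m0) expf_eq0 (negbTE tz) andbF.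
Qed.

End NoTame.

(** * Rescaling *)

Section Scale.
Variable R : realType.
Local Notation C := R[i].
Local Notation N := (@normc R).
Implicit Types (f g F : C -> C) (z w l a b s x y v c t : C) (u : C -> option C).

Definition scl t u z : option C := omap (fun v => t * v) (u z).

Lemma fin_scl t u z : fin (scl t u) z = t * fin u z.
Proof. by rewrite /fin /scl; case: (u z) => //=; rewrite mulr0. Qed.

Lemma scl_None t u z : scl t u z <> None <-> u z <> None.
Proof. by rewrite /scl; case: (u z). Qed.

Lemma iv_scl t u : t != 0 -> iv (scl t u) = scl t^-1 (iv u).
Proof.
move=> t0; apply/funext => z; rewrite /iv /scl; case: (u z) => [v|] /=; last by rewrite mulr0.
by rewrite mulf_eq0 (negbTE t0) /=; case: ifP => //= _; rewrite invfM.
Qed.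

Lemma fholo_scl t u z (r : R) : fholo u z r -> fholo (scl t u) z r.
Proof.
move=> [h1 h2]; split=> w wr; first by apply/scl_None; exact: h1.
apply: (@cdiff_ext _ (fun x => t * fin u x)).
  by apply: near0T => h; rewrite fin_scl.
by apply: cdiffM (cdiff_cst _ _) _; exact: h2.
Qed.

Lemma sholo_scl t u z : t != 0 -> sholo u z -> sholo (scl t u) z.
Proof.
move=> t0 [r r0 [h|h]]; exists r => //; [left|right]; first exact: fholo_scl.
by rewrite iv_scl //; exact: fholo_scl.
Qed.

Lemma der_scl t u z : cdiff (fin u) z -> der (fin (scl t u)) z = t * der (fin u) z.
Proof.
move=> /derP d; apply: derE; apply: cderiv_ext (cderivMl t d).
by apply: near0T => h; rewrite fin_scl.
Qed.

Lemma dernMl j c f a (r : R) : holo f a r -> forall z, N (z - a) < r ->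
  dern j (fun x => c * f x) z = c * dern j f z.
Proof.
move=> hf; elim: j => // j IH z zr.
rewrite /= (@der_ext _ _ (fun x => c * dern j f x)); last first.
  exact: (@near0_ball _ (fun x => dern j (fun x => c * f x) x = c * dern j f x) a z r zr).
have hj := @dern_holo _ j _ _ _ hf.
by rewrite (derE (cderivMl c (derP (hj z zr)))).
Qed.

Lemma Fk_scl n k t u z : sholo u z -> u z <> None -> Fk n k (scl t u) z = t ^+ n * Fk n k u z.
Proof.
move=> h; case E : (u z) => [v|] // _; have [r r0 [_ h2]] := sholo_fin h E.
have hF : holo (fun w => fin u w ^+ n) z r by move=> w wr; apply: cdiffX; exact: h2.
have zz : N (z - z) < r by rewrite subrr N0.
rewrite /Fk -(dernMl k (t ^+ n) hF zz); apply: (@dern_ext _ k _ _ z r) zz => w _.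
by rewrite fin_scl exprMn.
Qed.

Lemma sder_scl (t : R) u z : 0 < t -> sholo u z -> sder (scl t%:C u) z =
  if u z is Some v then t * N (der (fin u) z) / (1 + t ^+ 2 * N v ^+ 2) else t^-1 * N (der (fin (iv u)) z).
Proof.
move=> t0 h; have tn : t%:C != 0 by rewrite -N_gt0 Nr gtr0_norm.
have Nt : N t%:C = t by rewrite Nr gtr0_norm.
rewrite /sder /scl; case E : (u z) => [v|] /=.
  by rewrite (der_scl _ (sholo_cdiff h E)) !NM Nt exprMn.
have E' : iv u z = Some 0 by rewrite /iv E.
rewrite -/(scl t%:C u) iv_scl // (der_scl _ (sholo_cdiff (sholo_iv h) E')).
by rewrite NM NV Nt.
Qed.

Lemma sder_local_bd u z : sholo u z -> exists d B : R, 0 < d /\ forall w, N (w - z) < d -> sder u w <= B.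
Proof.
suff H (v : C -> option C) (r : R) : 0 < r -> fholo v z r ->
    exists d B : R, 0 < d /\ forall w, N (w - z) < d -> sholo v w /\ sder v w <= B.
  move=> [r r0 [h|h]]; have [d [B [d0 hd]]] := H _ r r0 h; exists d, B; split=> // w /hd [] //.
  by move=> s1 s2; rewrite -sder_iv // -(ivK u); exact: sholo_iv.
move=> r0 [h1 h2]; have r2 : r / 2 < r by lra.
have [B B0 hB] := holo_bd (holo_der h2) r2.
exists (r / 2), B; split; first by lra.
move=> w wr; have wr' : N (w - z) < r by lra.
split.
  exists (r / 2); first by lra.
  left; split=> x xr; [apply: h1|apply: h2]; apply: le_lt_trans (ND3 w _ _) _; lra.
have := h1 w wr'; rewrite /sder; case: (v w) => [y|//] _.
have p : 1 <= 1 + N y ^+ 2 by rewrite lerDl sqr_ge0.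
rewrite ler_pdivrMr; last by apply: lt_le_trans p.
apply: le_trans (hB w (ltW wr)) _; rewrite ler_peMr // ltW //.
Qed.

Lemma sder_bd u a (s : R) : (forall z, N (z - a) <= s -> sholo u z) ->
  exists B : R, 0 <= B /\ forall z, N (z - a) <= s -> sder u z <= B.
Proof.
move=> h; apply: contrapT => H.
have /choice[x hx] j : exists x, N (x - a) <= s /\ j%:R < sder u x.
  apply: contrapT => H2; apply: H; exists j%:R; split=> // z zs.
  by rewrite leNgt; apply/negP => big; apply: H2; exists z.
have cx : ucv x (ulim x).
  apply: (@ulimP _ _ (s + N a)); apply: UF_all => j /=.
  by have [k1 _] := hx j; have := ND (x j - a) a; rewrite subrK; lra.
have xs : N (ulim x - a) <= s.
  by apply: (ucv_le (ucvB cx (ucv_cst a))); apply: UF_all => j /=; have [] := hx j.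
have [d [B [d0 hd]]] := sder_local_bd (h _ xs).
have [j /= [k1 k2]] := UF_ex (UF_I (cx d d0) (UF_ge (Num.bound `|B|))).
have [_ k3] := hx j; have k4 := hd _ k1.
have : B < j%:R.
  apply: le_lt_trans (ler_norm B) _; apply: lt_le_trans (archi_boundP _) _ => //.
  by rewrite ler_nat.
lra.
Qed.

End Scale.

(** * Choice of centre and scale *)

Section Zalcman.
Variable R : realType.
Local Notation C := R[i].
Local Notation N := (@normc R).
Implicit Types (z w l a b x y v c : C) (u : C -> option C) (s t : R).
Variables (n k : nat).
Hypothesis k0 : (0 < k)%N.
Hypothesis k2n : (k + 2 <= n)%N.

Let kn : (k < n)%N. Proof. by rewrite (leq_trans _ k2n) // addn2 ltnS leqnSn. Qed.

(* The spherical derivative at 0 of the map x |-> s ^- k * u (z + s ^+ n * x). *)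
Definition rescaled_sder u z s : R := s ^+ (n + k) *
  (if u z is Some v then N (der (fin u) z) / (s ^+ (2 * k) + N v ^+ 2) else N (der (fin (iv u)) z)).

Definition rescale u a s : C -> option C := fun x => scl (s ^- k)%:C u (aff a (s ^+ n)%:C x).

Lemma sder_rescale u a s x : 0 < s -> sholo u (aff a (s ^+ n)%:C x) ->
  sder (rescale u a s) x = rescaled_sder u (aff a (s ^+ n)%:C x) s.
Proof.
move=> s0 h; have sn : 0 < s ^+ n by rewrite exprn_gt0.
have sk : 0 < s ^+ k by rewrite exprn_gt0.
have snn : (s ^+ n)%:C != 0 by rewrite -N_gt0 Nr gtr0_norm.
have skp : 0 < s ^- k by rewrite invr_gt0.
have skn : (s ^- k)%:C != 0 by rewrite -N_gt0 Nr gtr0_norm.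
rewrite /rescale (sder_aff (sholo_scl skn h)) Nr gtr0_norm // sder_scl // /rescaled_sder.
case: (u _) => [v|]; last by rewrite invrK mulrA -exprD.
have -> : s ^+ (2 * k) = s ^+ k ^+ 2 by rewrite mulnC exprM.
rewrite exprD; have vv : 0 <= N v ^+ 2 by rewrite sqr_ge0.
have p1 : s ^+ k ^+ 2 + N v ^+ 2 != 0 by rewrite gt_eqF // ltr_wpDr // exprn_gt0.
have p2 : s ^+ k != 0 by rewrite gt_eqF.
by field; rewrite p2 p1.
Qed.

Lemma sholo_rescale u a s x : 0 < s -> sholo u (aff a (s ^+ n)%:C x) -> sholo (rescale u a s) x.
Proof.
move=> s0 h; have skn : (s ^- k)%:C != 0 by rewrite -N_gt0 Nr normr_gt0 invr_eq0 gt_eqF // exprn_gt0.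
have snn : (s ^+ n)%:C != 0 by rewrite -N_gt0 Nr normr_gt0 gt_eqF // exprn_gt0.
by apply: (sholo_aff snn); exact: sholo_scl.
Qed.

Lemma avoids_rescale u a s x : 0 < s -> sholo u (aff a (s ^+ n)%:C x) ->
  avoids n k u (aff a (s ^+ n)%:C x) -> avoids n k (rescale u a s) x.
Proof.
move=> s0 h av /scl_None uz.
have skn : (s ^- k)%:C != 0 by rewrite -N_gt0 Nr normr_gt0 invr_eq0 gt_eqF // exprn_gt0.
have snn : (s ^+ n)%:C != 0 by rewrite -N_gt0 Nr normr_gt0 gt_eqF // exprn_gt0.
rewrite (Fk_aff n k snn (sholo_scl skn h)); last by apply/scl_None.
rewrite Fk_scl // mulrA -!rmorphXn -rmorphM exprVn -!exprM mulnC mulfV ?mul1r; first exact: av.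
by rewrite gt_eqF // exprn_gt0.
Qed.

(** Shrinking s to t s loses only the prefactor t^(n+k), since the denominator decreases. *)
Lemma rescaled_sder_mono u z s t : 0 < s -> 0 < t -> t <= 1 -> t ^+ (n + k) * rescaled_sder u z s <= rescaled_sder u z (t * s).
Proof.
move=> s0 t0 t1; rewrite /rescaled_sder exprMn -mulrA.
rewrite ler_wpM2l ?exprn_ge0 ?(ltW t0) // ler_wpM2l ?exprn_ge0 ?(ltW s0) //.
case: (u z) => [v|] //; have vv : 0 <= N v ^+ 2 by rewrite sqr_ge0.
rewrite ler_wpM2l ?N_ge0 // lef_pV2 ?posrE ?ltr_wpDr ?exprn_gt0 ?mulr_gt0 // lerD2r.
by rewrite lerXn2r ?nnegrE ?mulr_ge0 ?(ltW s0) ?(ltW t0) // ler_piMl // ltW.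
Qed.

Lemma rescaled_sder_1 u z : rescaled_sder u z 1 = sder u z.
Proof. by rewrite /rescaled_sder /sder !expr1n mul1r. Qed.

(** At a finite value v the claim is s^(n+k) (1 + |v|^2) <= s (s^(2 k) + |v|^2) for s <= 1, where
    the first term uses n + k >= 2 k + 1. *)
Lemma rescaled_sder_le u z s : 0 < s -> s <= 1 -> rescaled_sder u z s <= s * sder u z.
Proof.
move=> s0 s1; rewrite /rescaled_sder /sder; case: (u z) => [v|]; last first.
  by rewrite ler_wpM2r ?N_ge0 // -[leRHS]expr1 ler_wiXn2l ?(ltW s0) // addn_gt0 k0 orbT.
have vv : 0 <= N v ^+ 2 by rewrite sqr_ge0.
have q1 : 0 < s ^+ (2 * k) + N v ^+ 2 by rewrite ltr_wpDr // exprn_gt0.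
have q2 : 0 < 1 + N v ^+ 2 by lra.
rewrite !mulrA ler_pdivrMr // mulrAC ler_pdivlMr // mulrAC [leRHS]mulrAC ler_wpM2r ?N_ge0 //.
rewrite !mulrDr mulr1 lerD // -?exprS.
  by apply: ler_wiXn2l; rewrite ?(ltW s0) //; move: kn; lia.
by rewrite ler_wpM2r // -[leRHS]expr1 ler_wiXn2l ?(ltW s0) // addn_gt0 k0 orbT.
Qed.

(** Hofer's doubling argument. If the bound fails at some x near z, the pair (z, s) is replaced by
    (x, s / 2): by monotonicity the quantity is still at least 1, and |x - z| <= A s^n <= A s is
    paid for by the drop of 2 A s to A s. As the quantity is at most s B, fewer than m halvings are
    possible when s B < 2^m. *)
Lemma hofer u a (r A B : R) : 1 <= A -> 0 <= B ->
  (forall z, N (z - a) <= r -> sder u z <= B) ->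
  forall m z s, 0 < s -> s <= 1 -> s * B < 2 ^+ m -> 1 <= rescaled_sder u z s -> N (z - a) + 2 * A * s <= r ->
  exists z' s', [/\ 0 < s', s' <= 1, 1 <= rescaled_sder u z' s', N (z' - a) + 2 * A * s' <= r &
    forall x, N (x - z') <= A * s' ^+ n -> rescaled_sder u x s' <= 2 ^+ (n + k)].
Proof.
move=> A1 B0 hB; have n0 : (0 < n)%N by exact: leq_ltn_trans kn.
have sB z s : 0 < s -> s <= 1 -> N (z - a) <= r -> rescaled_sder u z s <= s * B.
  by move=> s0 s1 zr; apply: le_trans (rescaled_sder_le u z s0 s1) _; rewrite ler_wpM2l ?(ltW s0) // hB.
elim=> [|m IH] z s s0 s1 sm zs zr; have As : 0 < A * s by rewrite mulr_gt0 //; lra.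
  by have := sB z s s0 s1 ltac:(lra); move: sm; rewrite expr0; lra.
have [good|bad] := pselect (forall x, N (x - z) <= A * s ^+ n -> rescaled_sder u x s <= 2 ^+ (n + k)).
  by exists z, s.
have [x [xz big]] : exists x, N (x - z) <= A * s ^+ n /\ 2 ^+ (n + k) < rescaled_sder u x s.
  apply: contrapT => H; apply: bad => x xz; rewrite leNgt; apply/negP => big.
  by apply: H; exists x.
have sn : A * s ^+ n <= A * s.
  by rewrite ler_wpM2l //; [lra|rewrite -[leRHS]expr1 ler_wiXn2l // ltW].
apply: (IH x (2^-1 * s)); rewrite ?mulr_gt0 ?invr_gt0 //; try lra.
- by rewrite -mulrA mulrC ltr_pdivrMr // -exprSr.
- apply: le_trans (rescaled_sder_mono u x s0 (_ : 0 < 2^-1) (_ : 2^-1 <= 1)); rewrite ?invr_gt0 //; try lra.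
  by rewrite exprVn mulrC ler_pdivlMr ?exprn_gt0 // mul1r ltW.
by have := ND3 z a x; lra.
Qed.

Lemma sder_const u p z : (forall w, u w = p) -> sder u z = 0.
Proof.
move=> h; have fu : fin u = fun=> odflt 0 p by apply/funext => w; rewrite /fin h.
have fi : fin (iv u) = fun=> odflt 0 (sinv p) by apply/funext => w; rewrite /fin /iv h.
rewrite /sder fu fi !(derE (cderiv_cst _ _)) N0.
by case: (u z) => [v|] //; rewrite mul0r.
Qed.

End Zalcman.

(** * Local bounds for the spherical derivatives of the family *)

Section Marty.
Variable R : realType.
Local Notation C := R[i].
Local Notation N := (@normc R).
Implicit Types (z w l a b x y v c : C) (u : C -> option C) (s t : R).
Variables (n k : nat).
Hypothesis k0 : (0 < k)%N.
Hypothesis k2n : (k + 2 <= n)%N.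

Let kn : (k < n)%N. Proof. by rewrite (leq_trans _ k2n) // addn2 ltnS leqnSn. Qed.

(** The pointwise limit along the ultrafilter is tame, avoids 1 and has spherical derivative at
    least 1 at 0, so it is not constant, against [no_tame]. *)
Lemma no_zalcman_limit (g_ : nat -> C -> option C) (K : R) : 0 <= K ->
  (forall j x, N x < j.+1%:R -> [/\ sholo (g_ j) x, sder (g_ j) x <= K & avoids n k (g_ j) x]) ->
  ~ (forall j, 1 <= sder (g_ j) 0).
Proof.
move=> K0 hg h1.
have [tm av] : tame (pointwise_ulim g_) K /\ forall z, avoids n k (pointwise_ulim g_) z.
  apply: limit_tame => // A; apply: UF_S (UF_ge (Num.bound `|A|)) => j /= jA w wA; apply: hg.
  apply: lt_le_trans wA _; apply: le_trans (ler_norm A) _; apply: ltW.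
  apply: lt_le_trans (archi_boundP _) _ => //; rewrite ler_nat; exact: leqW.
apply: (no_tame k0 k2n K0 tm av) => -[p hp].
have hS : sder_bounded g_ 0 1 K.
  apply: UF_all => j /= w; rewrite subr0 => w1.
  by have [] := hg j w => //; apply: lt_le_trans w1 _; rewrite ler1n.
have : 1 <= sder (pointwise_ulim g_) 0 by apply: (limit_sder_ge ltr01 K0 hS); exact: UF_all.
by rewrite (sder_const 0 hp); lra.
Qed.

Lemma sder_locally_bounded a (r : R) (Fam : set (C -> option C)) : 0 < r ->
  (forall f, Fam f -> forall w, N (w - a) < r -> sholo f w /\ avoids n k f w) ->
  exists2 K : R, 0 <= K & forall f, Fam f -> forall w, N (w - a) < r / 2 -> sder f w <= K.
Proof.
move=> r0 hF; apply: contrapT => H.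
pose e := Num.min 1 (r / 16); have e0 : 0 < e by rewrite lt_min; lra.
have e1 : e <= 1 by rewrite ge_min lexx.
have er : e <= r / 16 by rewrite ge_min lexx orbT.
suff /choice[g_ hg] (j : nat) : exists g : C -> option C, (forall x, N x < j.+1%:R ->
    [/\ sholo g x, sder g x <= 2 ^+ (n + k) & avoids n k g x]) /\ 1 <= sder g 0.
  apply: (@no_zalcman_limit g_ (2 ^+ (n + k))); first by rewrite exprn_ge0.
    by move=> j; have [] := hg j.
  by move=> j; have [] := hg j.
pose A : R := j.+1%:R; have A1 : 1 <= A by rewrite ler1n.
have A0 : 0 < A by lra.
(* Then A s <= e <= r / 16, so that r / 2 + 2 A s stays below 3/4 r. A spherical derivative above
   s^-(n+k) makes the rescaled one at least 1, which starts [hofer]. *)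
pose s := e / A ^+ 2; have s0 : 0 < s by rewrite divr_gt0 ?exprn_gt0.
have As : A * s = e / A by rewrite /s; field; rewrite gt_eqF.
have eA : e / A <= e by rewrite ler_pdivrMr // ler_peMr // ltW.
have s1 : s <= 1.
  by apply: le_trans e1; rewrite /s ler_pdivrMr ?exprn_gt0 // ler_peMr ?(ltW e0) // exprn_ege1.
have [f [w [Ff wr big]]] : exists f w, [/\ Fam f, N (w - a) < r / 2 & s ^- (n + k) < sder f w].
  apply: contrapT => H2; apply: H; exists (s ^- (n + k)); first by rewrite invr_ge0 exprn_ge0 // ltW.
  by move=> f Ff w wr; rewrite leNgt; apply/negP => b; apply: H2; exists f, w.
have [B [B0 hB]] : exists B : R, 0 <= B /\ forall z, N (z - a) <= 3 / 4 * r -> sder f z <= B.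
  by apply: sder_bd => z zr; apply: (hF f Ff z _).1; lra.
have [m hm] := @pow_unbounded R 2 (s * B) ltac:(lra).
have zs : 1 <= rescaled_sder n k f w s.
  have := rescaled_sder_mono n k f w ltr01 s0 s1; rewrite rescaled_sder_1 mulr1; apply: le_trans.
  by rewrite mulrC -ler_pdivrMr ?exprn_gt0 // mul1r ltW.
have wr2 : N (w - a) + 2 * A * s <= 3 / 4 * r.
  rewrite (_ : 2 * A * s = 2 * (e / A)); [|by rewrite -As [RHS]mulrA].
  by move: (e / A) eA => q qe; lra.
have [z [t [t0 t1 zt zr good]]] := hofer k0 k2n A1 B0 hB s0 s1 hm zs wr2.
have inside x : N x <= A -> N (aff z (t ^+ n)%:C x - z) <= A * t ^+ n /\ N (aff z (t ^+ n)%:C x - a) < r.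
  move=> xA; have tn : 0 < t ^+ n by rewrite exprn_gt0.
  have d : N (aff z (t ^+ n)%:C x - z) <= A * t ^+ n.
    by rewrite /aff addrAC subrr add0r NM Nr gtr0_norm // mulrC ler_wpM2r // ltW.
  have tt : A * t ^+ n <= A * t.
    rewrite ler_wpM2l ?(ltW A0) // -[leRHS]expr1 ler_wiXn2l ?(ltW t0) //.
    exact: leq_ltn_trans kn.
  have At : 0 < A * t by rewrite mulr_gt0.
  by split=> //; have := ND3 z a (aff z (t ^+ n)%:C x); lra.
exists (rescale n k f z t); split=> [x xA|].
  have [i1 i2] := inside x (ltW xA); have [sh av] := hF f Ff _ i2.
  split; [exact: sholo_rescale|rewrite sder_rescale //; exact: good|exact: avoids_rescale].
have [i1 i2] := inside 0 ltac:(by rewrite N0 ltW); have [sh _] := hF f Ff _ i2.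
by rewrite sder_rescale // /aff mulr0 addr0.
Qed.

End Marty.

(** * Normality *)

Section Bridge.
Variable R : realType.
Local Notation C := (cplx R).
Local Notation N := (@normc R).
Implicit Types (f : C -> C) (z w l h : C).

Lemma cnormE z : `|z| = ((N z)%:C : C).
Proof. by case: z => a b; exact: normc_def. Qed.

Lemma pos_cplx (e : C) : 0 < e -> exists2 d : R, 0 < d & e = (d%:C : C).
Proof.
by case: e => a b; rewrite ltcE /= => /andP[/eqP b0 a0]; exists a => //; rewrite b0.
Qed.

Lemma near_cplx z (P : C -> Prop) :
  (\forall w \near z, P w) <-> exists2 r : R, 0 < r & forall w, N (w - z) < r -> P w.
Proof.
split=> [/nbhs_normP[e /= /pos_cplx[r r0 ->] h]|[r r0 h]].
  by exists r => // w wr; apply: h => /=; rewrite cnormE ltcR NC.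
apply/nbhs_normP; exists (r%:C : C) => /=; first by rewrite ltcR.
by move=> w /=; rewrite cnormE ltcR NC => /h.
Qed.

Lemma dnear_cplx z (P : C -> Prop) :
  (\forall w \near z^', P w) <-> exists2 r : R, 0 < r & forall w, N (w - z) < r -> w != z -> P w.
Proof. exact: near_cplx. Qed.

Lemma cderiv_cvg f z l : cderiv f z l <->
  (fun h => h^-1 *: ((f \o shift z) (h *: 1) - f z)) @ 0^' --> l.
Proof.
have E h : h != 0 -> N (l - h^-1 *: ((f \o shift z) (h *: 1) - f z)) * N h = N (f (z + h) - f z - l * h).
  move=> h0; rewrite -NM -NN; congr N; rewrite /= [h *: 1]mulr1 (addrC h z) mulrBl.
  by rewrite [_ *: _]mulrC mulfVK //; ring.
split=> [d|d e e0].
  apply/cvgrPdist_lt => e /pos_cplx[e' e0 ->]; apply/dnear_cplx.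
  have e2 : 0 < e' / 2 by rewrite divr_gt0.
  have [r r0 hr] := d _ e2; exists r => // h; rewrite subr0 => hh h0.
  have Nh : 0 < N h by rewrite N_gt0.
  have := hr h hh; rewrite cnormE ltcR -(ltr_pM2r Nh) E // => k; apply: le_lt_trans k _.
  by rewrite ltr_pM2r //; lra.
have e0' : 0 < (e%:C : C) by rewrite ltcR.
move/cvgrPdist_lt/(_ _ e0'): d => /dnear_cplx[r r0 hr]; exists r => // h hh.
have [->|h0] := eqVneq h 0; first by rewrite addr0 subrr mulr0 subr0 N0 mulr0.
have Nh : 0 < N h by rewrite N_gt0.
have hh' : N (h - 0) < r by rewrite subr0.
by have := hr h hh' h0; rewrite cnormE ltcR -(E h h0) (ler_pM2r Nh) => /ltW.
Qed.

Lemma derivableP f z : derivable f z 1 <-> cdiff f z.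
Proof.
split=> [/cvg_ex[l hl]|[l hl]]; first by exists l; apply/cderiv_cvg.
by apply/cvg_ex; exists l; apply/cderiv_cvg.
Qed.

Lemma derive1_der f z : cdiff f z -> derive1 f z = der f z.
Proof.
move=> /derP/cderiv_cvg d; rewrite derive1E; exact: (cvg_lim (@norm_hausdorff _ _) d).
Qed.

Lemma derive1n_dern k f a (r : R) : holo f a r ->
  forall z, N (z - a) < r -> derive1n k f z = dern k f z.
Proof.
move=> hf; elim: k => // k IH z zr; rewrite derive1nS.
have hk := @dern_holo _ k _ _ _ hf.
have e : near0 (fun h => dern k f (z + h) = derive1n k f (z + h)).
  by apply: (@near0_eq _ (dern k f) (derive1n k f) a z r zr) => w wr; rewrite IH.
rewrite derive1_der; first by rewrite /= (der_ext e).
exact: cdiff_ext e (hk z zr).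
Qed.

End Bridge.

(** * Meromorphic functions as holomorphic maps to the sphere *)

Section Mero.
Variable R : realType.
Local Notation C := (cplx R).
Local Notation N := (@normc R).
Implicit Types (f u : C -> sphere R) (g : C -> C) (z w l h b : C) (D : set C).

Lemma holomorphic_fholo f z (r : R) : (forall w, N (w - z) < r -> holomorphic_at f w) -> fholo f z r.
Proof. by move=> h; split=> w /h[] // _ /derivableP. Qed.

(** At a pole, 1 / f with value 0 there is continuous because |f| tends to infinity, and
    differentiable off the point, so the singularity is removable. *)
Lemma mero_sholo D f z : meromorphic_on D f -> D z -> sholo f z.
Proof.
move=> hf Dz; have [/dnear_cplx[r r0 hr] [hz|[fz lim]]] := hf z Dz.
  exists r => //; left; apply: holomorphic_fholo => w wr.
  by have [->|wz] := eqVneq w z; [exact: hz|exact: hr].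
move/cvgryPgt: lim => lim.
have big (A : R) : exists2 s : R, 0 < s & forall w, N (w - z) < s -> w != z -> A < N (finite_part f w).
  by have /dnear_cplx := lim A.
have [s s0 hs] := big 0.
pose t := Num.min r s; have t0 : 0 < t by rewrite lt_min r0.
have ivf w : N (w - z) < t -> w != z -> [/\ f w <> None, cdiff (fin f) w, fin f w != 0 & fin (iv f) w = (fin f w)^-1 /\ iv f w <> None].
  rewrite lt_min => /andP[w1 w2] wz; have [f1 /derivableP f2] := hr w w1 wz.
  have nz : fin f w != 0 by rewrite -N_gt0; exact: hs.
  split=> //; have := @fin_neq0 _ (iv f) w; rewrite ivK => /(_ nz) [i1 i2].
  by split=> //; rewrite i2 invrK.
exists t => //; right; split=> [w wt|].
  have [->|wz] := eqVneq w z; first by rewrite /iv fz.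
  by have [_ _ _ []] := ivf w wt wz.
apply: removable => [w wt wz|e e0].
  have tz : 0 < Num.min (t - N (w - z)) (N (w - z)) by rewrite lt_min N_gt0 !subr_eq0 wz subr_gt0 wt.
  have ww : N (w - w) < Num.min (t - N (w - z)) (N (w - z)) by rewrite subrr N0.
  have [_ cf nz _] := ivf w wt wz.
  apply: cdiff_ext (cdiffV nz cf).
  apply: (@near0_eq _ (fun x => (fin f x)^-1) (fin (iv f)) w w _ ww) => x; rewrite lt_min => /andP[x1 x2].
  have xt : N (x - z) < t by have := ND3 w z x; lra.
  have xz : x != z by apply/eqP => e; move: x2; rewrite e NC ltxx.
  by have [_ _ _ [->]] := ivf x xt xz.
have [d d0 hd] := big e^-1; exists (Num.min t d); first by rewrite lt_min t0.
have iz : fin (iv f) z = 0 by rewrite /fin /iv fz.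
move=> h; rewrite lt_min => /andP[h1 h2]; rewrite iz subr0.
have [->|h0] := eqVneq h 0; first by rewrite addr0 iz N0.
have zh : z + h - z = h by rewrite addrAC subrr add0r.
have hz : z + h != z by rewrite -subr_eq0 zh.
have [_ _ nz [-> _]] := ivf (z + h) ltac:(by rewrite zh) hz.
rewrite NV -[ltRHS]invrK ltf_pV2 ?posrE ?invr_gt0 ?N_gt0 //.
by apply: hd => //; rewrite zh.
Qed.

Lemma sholo_dich u z : sholo u z -> u z = None -> ~ near0 (fun h => u (z + h) = None) ->
  exists2 r : R, 0 < r & forall w, N (w - z) < r -> w != z -> fin (iv u) w != 0.
Proof.
move=> hz uz nn; have iz : iv u z = Some 0 by rewrite /iv uz.
have [r r0 [f1 f2]] := sholo_fin (sholo_iv hz) iz.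
have [|d d0 hd] := isolated_zero r0 f2.
  move=> e; apply: nn; exists r => // h hr.
  have zr : N (z + h - z) < r by rewrite addrAC subrr add0r.
  have := f1 _ zr; have := e _ zr; rewrite /fin /iv; case: (u (z + h)) => [v|] //=.
  by case: eqVneq => // v0 /= /eqP; rewrite invr_eq0 (negbTE v0).
exists (Num.min r d) => [|w]; first by rewrite lt_min r0.
by rewrite lt_min => /andP[_ wd] wz; exact: hd.
Qed.

Lemma fholo_holomorphic u z (r : R) w : fholo u z r -> N (w - z) < r -> holomorphic_at u w.
Proof. by move=> [h1 h2] wr; split; [exact: h1|apply/derivableP; exact: h2]. Qed.

Lemma sholo_mero D u : (forall z, D z -> sholo u z) ->
  (forall z, D z -> ~ near0 (fun h => u (z + h) = None)) -> open D -> meromorphic_on D u.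
Proof.
move=> hu nn oD z Dz; case E : (u z) => [v|].
  have [r r0 fh] := sholo_fin (hu z Dz) E; split.
    by apply/dnear_cplx; exists r => // w wr _; exact: fholo_holomorphic fh wr.
  by left; apply: (fholo_holomorphic fh); rewrite subrr N0.
have [r r0 hr] := sholo_dich (hu z Dz) E (nn z Dz).
have [s s0 hs] : exists2 s : R, 0 < s & forall w, N (w - z) < s -> D w.
  by apply/near_cplx; exact: open_nbhs_nbhs.
have fw w : N (w - z) < r -> w != z -> u w <> None /\ fin u w = (fin (iv u) w)^-1.
  by move=> wr wz; exact: fin_neq0 (hr w wr wz).
split.
  apply/dnear_cplx; exists (Num.min r s); first by rewrite lt_min r0.
  move=> w; rewrite lt_min => /andP[wr ws] wz; have [uw _] := fw w wr wz.
  split=> //; apply/derivableP; case F : (u w) uw => [y|] // _.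
  exact: sholo_cdiff (hu w (hs w ws)) F.
right; split=> //; apply/cvgryPgt => A; apply/dnear_cplx.
have iz : iv u z = Some 0 by rewrite /iv E.
have A0 : 0 < (`|A| + 1)^-1 by rewrite invr_gt0 ltr_wpDl.
have [d d0 hd] := cdiff_cont (sholo_cdiff (sholo_iv (hu z Dz)) iz) A0.
exists (Num.min r d) => [|w]; first by rewrite lt_min r0.
rewrite lt_min => /andP[wr wd] wz; have [_ e] := fw w wr wz.
have := hd (w - z) wd; rewrite (finP iz) subr0 subrKC.
have nz := hr w wr wz; rewrite -[finite_part u w]/(fin u w) e NV.
move=> k; have : (`|A| + 1)^-1^-1 < (N (fin (iv u) w))^-1 by rewrite ltf_pV2 ?posrE ?N_gt0.
by rewrite invrK; apply: lt_trans; have := ler_norm A; lra.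
Qed.

(** The set O of points around which u is identically infinite is open. Its complement in D is open
    too, because at any other point infinity is taken at most in isolation. Connectedness
    decides. *)
Lemma mero_or_infinite D u : domain D -> (forall z, D z -> sholo u z) ->
  meromorphic_on D u \/ forall z, D z -> u z = None.
Proof.
move=> [_ oD cD] hu; pose O := [set z : C | near0 (fun h => u (z + h) = None)].
have oO : open O.
  rewrite openE => z [d d0 hd]; apply/near_cplx; exists (d / 2); first by rewrite divr_gt0.
  move=> w wd; exists (d / 2); first by rewrite divr_gt0.
  move=> h hh; rewrite (_ : w + h = z + (w - z + h)); last by rewrite addrA subrKC.
  by apply: hd; have := ND (w - z) h; lra.
have [DO|nO] := pselect (exists z, D z /\ O z); [right|left]; last first.
  by apply: sholo_mero => // z Dz Oz; apply: nO; exists z.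
have oN : open (D `&` ~` O).
  rewrite openE => z [Dz nOz]; apply/near_cplx.
  have [s s0 hs] : exists2 s : R, 0 < s & forall w, N (w - z) < s -> D w.
    by apply/near_cplx; exact: open_nbhs_nbhs.
  have notO w : u w <> None -> ~ O w.
    by move=> uw [d d0 hd]; apply: uw; have := hd 0; rewrite addr0; apply; rewrite N0.
  case E : (u z) => [v|].
    have [r r0 [fh _]] := sholo_fin (hu z Dz) E.
    exists (Num.min r s); first by rewrite lt_min r0.
    by move=> w; rewrite lt_min => /andP[/fh uw /hs Dw]; split=> //; exact: notO.
  have [r r0 hr] := sholo_dich (hu z Dz) E nOz.
  exists (Num.min r s); first by rewrite lt_min r0.
  move=> w; rewrite lt_min => /andP[wr ws]; split; first exact: hs.
  have [->|wz] := eqVneq w z; first exact: nOz.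
  by apply: notO; have [] := fin_neq0 (hr w wr wz).
have DE : D `&` O = D.
  apply: cD; first by have [z [Dz Oz]] := DO; exists z.
    by exists O.
  exists (~` (D `&` ~` O)); first by rewrite closedC.
  by apply/seteqP; split=> z /= [Dz k]; split=> //; [move=> [_]|apply: contrapT => k'; apply: k].
move=> z; rewrite -DE => -[_ [d d0 hd]].
by have := hd 0; rewrite addr0; apply; rewrite N0.
Qed.

Lemma avoids_mderivn n k f z : (0 < n)%N -> sholo f z -> mderivn k (mpow f n) z <> Some 1 -> avoids n k f z.
Proof.
move=> n0 hz hm fz e; apply: hm; case E : (f z) fz => [v|] // _.
have [r r0 [_ h2]] := sholo_fin hz E.
(* At a pole both sides are 0: the default value on the left, 0^n with n > 0 on the right. *)
have fe : finite_part (mpow f n) = fun w => fin f w ^+ n.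
  apply/funext => w; rewrite /finite_part /mpow /fin; case: (f w) => [y|] //=.
  by rewrite expr0n (gtn_eqF n0).
rewrite /mderivn /mpow E /= -/(mpow f n) fe; congr Some; rewrite -e.
apply: (@derive1n_dern _ k _ z r); last by rewrite subrr N0.
by move=> w wr; apply: cdiffX; exact: h2.
Qed.

End Mero.

(** * Convergence in the spherical metric and extraction of a subsequence *)

Section Normal.
Variable R : realType.
Local Notation C := (cplx R).
Local Notation N := (@normc R).
Implicit Types (p q : sphere R) (z w a : C).

Lemma sqrt1_ge1 (x : R) : 1 <= Num.sqrt (1 + x ^+ 2).
Proof. by rewrite -[leLHS]sqrtr1 ler_sqrt ?lerDl ?sqr_ge0 // addr_ge0 ?sqr_ge0. Qed.

Lemma sqrt1_ge (x : R) : 0 <= x -> x <= Num.sqrt (1 + x ^+ 2).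
Proof.
move=> x0; rewrite -{1}[x]ger0_norm // -sqrtr_sqr ler_sqrt ?lerDr //.
by rewrite addr_ge0 ?sqr_ge0.
Qed.

Lemma chordal_ge0 p q : 0 <= chordal_dist p q.
Proof.
have s0 (x : R) : 0 <= Num.sqrt (1 + x ^+ 2) by exact: sqrtr_ge0.
by case: p q => [a|] [b|] //=; rewrite divr_ge0 ?mulr_ge0 ?N_ge0.
Qed.

Lemma chordal_fin p q : p <> None -> q <> None -> chordal_dist p q <= 2 * N (fv p - fv q).
Proof.
case: p q => [a|] [b|] //= _ _; have sa := sqrt1_ge1 (N a); have sb := sqrt1_ge1 (N b).
rewrite ler_pdivrMr ?mulr_gt0 ?(lt_le_trans ltr01) // ler_peMr ?mulr_ge0 ?N_ge0 //.
by rewrite mulr_ege1.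
Qed.

(** Inversion preserves chordal distance; the bound uses |a - b| = |a| |b| |1/a - 1/b| and |a| <=
    sqrt (1 + |a|^2). *)
Lemma chordal_inv p q : sinv p <> None -> sinv q <> None ->
  chordal_dist p q <= 2 * N (fv (sinv p) - fv (sinv q)).
Proof.
have one a : a != 0 -> 2 / Num.sqrt (1 + N a ^+ 2) <= 2 * N a^-1.
  move=> a0; rewrite NV ler_wpM2l // lef_pV2 ?posrE ?N_gt0 //; last exact: lt_le_trans (sqrt1_ge1 _).
  by apply: sqrt1_ge; exact: N_ge0.
case: p q => [a|] [b|] //=; try case: eqVneq => [//|a0]; try case: eqVneq => [//|b0] => _ _ /=.
- have -> : a^-1 - b^-1 = (b - a) / (a * b) by field; rewrite a0 b0.
  rewrite Nf NC NM mulrA ler_wpM2l ?mulr_ge0 ?N_ge0 //.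
  have na : 0 < N a by rewrite N_gt0.
  have nb : 0 < N b by rewrite N_gt0.
  have sa := sqrt1_ge1 (N a); have sb := sqrt1_ge1 (N b).
  have ab : 0 < N a * N b by rewrite mulr_gt0.
  rewrite lef_pV2 ?posrE ?mulr_gt0 ?(lt_le_trans ltr01 sa) ?(lt_le_trans ltr01 sb) //.
  by rewrite ler_pM ?N_ge0 // sqrt1_ge ?N_ge0.
- by move=> _ _; rewrite /= subr0; exact: one.
- by move=> _ _; rewrite /= sub0r NN; exact: one.
by move=> _ _; rewrite /= subrr N0 mulr0.
Qed.

Lemma spherical_small (e : R) : 0 < e ->
  exists2 d : R, 0 < d & forall p q, chordal_dist p q < d -> spherical_dist p q < e.
Proof.
move=> e0; have as0 : asin 0 = 0 :> R.
  rewrite -[in LHS](@sin0 R) sinK // in_itv /= oppr_le0 andbb.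
  by rewrite divr_ge0 // pi_ge0.
have e2 : 0 < e / 2 by rewrite divr_gt0.
have /cvgrPdist_lt/(_ _ e2) := @continuous_asin R 0 ltac:(by rewrite ltrN10 ltr01).
move=> /nbhs_normP[d /= d0 hd]; exists d => // p q pq.
have cq := chordal_ge0 p q.
have := hd (chordal_dist p q / 2); rewrite /= as0 !sub0r !normrN => k.
rewrite /spherical_dist; apply: le_lt_trans (_ : 2 * `|asin (chordal_dist p q / 2)| < _).
  by rewrite ler_wpM2l // ler_norm.
rewrite mulrC -ltr_pdivlMr //; apply: k.
by rewrite ger0_norm ?divr_ge0 //; lra.
Qed.

(** Bad points z_j would have an ultralimit z. Cauchy's estimate gives the f_j a common Lipschitz
    constant near z, so convergence at z and continuity of f contradict the gap e. *)
Lemma unif_limit (f_ : nat -> C -> C) (f : C -> C) a (r B : R) : 0 < r -> bholo f_ a r B ->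
  (forall z, N (z - a) < r -> ucv (fun j => f_ j z) (f z)) ->
  forall e : R, 0 < e -> UF [set j | forall z, N (z - a) < r / 4 -> N (f_ j z - f z) < e].
Proof.
move=> r0 hB cv e e0; have [//|nU] := UF_em [set j | forall z, N (z - a) < r / 4 -> N (f_ j z - f z) < e].
exfalso; have [z_ hz] : exists z_ : nat -> C, UF [set j | N (z_ j - a) < r / 4 /\ e <= N (f_ j (z_ j) - f (z_ j))].
  have /choice[z_ hz] j : exists z, (~ forall z, N (z - a) < r / 4 -> N (f_ j z - f z) < e) ->
      N (z - a) < r / 4 /\ e <= N (f_ j z - f z).
    have [[z h]|H] := pselect (exists z, N (z - a) < r / 4 /\ e <= N (f_ j z - f z)); first by exists z.
    exists a => k; exfalso; apply: k => z zr; rewrite ltNge; apply/negP => b; apply: H; by exists z.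
  by exists z_; apply: UF_S nU => j /=; exact: hz.
have cz : ucv z_ (ulim z_).
  apply: (@ulimP _ _ (r / 4 + N a)); apply: UF_S hz => j /= [h _].
  by have := ND (z_ j - a) a; rewrite subrK; lra.
set z := ulim z_ in cz.
have za : N (z - a) <= r / 4.
  by apply: (ucv_le (ucvB cz (ucv_cst a))); apply: UF_S hz => j /= [/ltW].
have zr : N (z - a) < r by lra.
have [cf _] := ulim_der hB cv zr.
have e3 : 0 < e / 4 by lra.
have [d d0 hd] := cdiff_cont cf e3.
have B0 : 0 <= B.
  have [j [/= h1 h2]] := UF_ex hB; apply: le_trans (h2 a _); rewrite ?N_ge0 // subrr N0 //.
pose L := 4 * B / r; have L0 : 0 <= L by rewrite divr_ge0 ?mulr_ge0 // ltW.
have s0 : 0 < Num.min d (e / 4 / (L + 1)) by rewrite lt_min d0 divr_gt0 //; lra.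
have [j /= [[[h1 h2] [k1 k2]] [k3 k4]]] := UF_ex (UF_I (UF_I hB hz) (UF_I (cz _ s0) (cv z zr _ e3))).
move: k3; rewrite lt_min => /andP[m1 m2].
have l1 : N (f_ j (z_ j) - f_ j z) <= L * N (z_ j - z).
  apply: mean_value => t /andP[t0 t1].
  have xin : N (z + t%:C * (z_ j - z) - a) < r / 2.
    have -> : z + t%:C * (z_ j - z) - a = (1 - t)%:C * (z - a) + t%:C * (z_ j - a).
      by rewrite rmorphB rmorph1; ring.
    apply: le_lt_trans (ND _ _) _; rewrite !NM !Nr !ger0_norm ?subr_ge0 //.
    have p1 : (1 - t) * N (z - a) <= (1 - t) * (r / 4) by rewrite ler_wpM2l // subr_ge0.
    have p2 : t * N (z_ j - a) <= t * (r / 4) by rewrite ler_wpM2l // ltW.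
    by move: p1 p2; move: (_ * N (z - a)) (_ * N (z_ j - a)) => x y; lra.
  exists (der (f_ j) (z + t%:C * (z_ j - z))); first by apply/derP/h1; lra.
  exact: (der_bd r0 h1 h2 xin).
have l2 : L * N (z_ j - z) <= e / 4.
  have : L * N (z_ j - z) <= (L + 1) * N (z_ j - z) by rewrite ler_wpM2r ?N_ge0 //; lra.
  move: m2; rewrite ltr_pdivlMr; last by lra.
  by rewrite mulrC; lra.
have l3 := hd _ m1; rewrite subrKC in l3.
have : N (f_ j (z_ j) - f (z_ j)) <= N (f_ j (z_ j) - f_ j z) + N (f_ j z - f z) + N (f (z_ j) - f z).
  have -> : f_ j (z_ j) - f (z_ j) = (f_ j (z_ j) - f_ j z) + (f_ j z - f z) - (f (z_ j) - f z) by ring.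
  by apply: le_trans (NB _ _) _; rewrite lerD2r; exact: ND.
lra.
Qed.

Lemma good_disc (u_ : nat -> C -> sphere R) a (r K : R) : 0 < r -> 0 <= K -> sder_bounded u_ a r K ->
  exists2 rho : R, 0 < rho & forall e : R, 0 < e ->
    UF [set j | forall z, N (z - a) < rho -> spherical_dist (u_ j z) (pointwise_ulim u_ z) < e].
Proof.
move=> r0 K0 hS; pose rho := Num.min r (chart_radius K 1).
have rho0 : 0 < rho by rewrite lt_min r0 chart_radius_gt0.
exists (rho / 4) => [|e e0]; first by lra.
have [d d0 hd] := spherical_small e0; have d2 : 0 < d / 2 by lra.
have [A|A] := limit_dich u_ a.
  have [B [f1 _] cv _] := limit_chart r0 K0 ler01 hS A; rewrite -/rho in B f1 cv.
  have bh : bholo (fun j => fin (u_ j)) a rho (1 + 1) by apply: UF_S B => j /= [[_ k1] k2].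
  apply: UF_S (UF_I B (unif_limit rho0 bh cv d2)) => j /= [[[k1 _] _] k3] z zr; apply: hd.
  apply: le_lt_trans (chordal_fin (k1 z _) (f1 z _)) _; try lra.
  by have := k3 z zr; rewrite /fin -/(fv _) -/(fv _); lra.
have [B [f1 _] cv _] := limit_chart r0 K0 ler01 (sder_bounded_iv hS) A; rewrite -/rho in B f1 cv.
have bh : bholo (fun j => fin (iv (u_ j))) a rho (1 + 1) by apply: UF_S B => j /= [[_ k1] k2].
apply: UF_S (UF_I B (unif_limit rho0 bh cv d2)) => j /= [[[k1 _] _] k3] z zr; apply: hd.
rewrite pointwise_ulim_iv in f1 k3.
apply: le_lt_trans (chordal_inv (k1 z _) (f1 z _)) _; try lra.
by have := k3 z zr; rewrite /fin /iv -!/(fv _); lra.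
Qed.

(** Return from the ultrafilter to a subsequence: for each m the finitely many conditions with i <=
    m hold on a set of the ultrafilter, which has elements beyond any bound; phi m is one beyond the
    previous choice. *)
Lemma diagonal (I : nat -> Prop) (P : nat -> nat -> nat -> Prop) :
  (forall i m, I i -> UF [set j | P i m j]) ->
  exists phi : nat -> nat, {homo phi : i j / (i < j)%N} /\
    forall i m, I i -> (i <= m)%N -> P i m (phi m).
Proof.
move=> h; have fin_int m b : UF [set j | forall i, (i < b)%N -> I i -> P i m j].
  elim: b => [|b IH]; first exact: UF_all.
  have U : UF [set j | I b -> P b m j].
    have [Ib|nI] := pselect (I b); first by apply: UF_S (h b m Ib) => j Pj _.
    by apply: UF_all => j Ib; case: nI.
  apply: UF_S (UF_I IH U) => j /= [k1 k2] i; rewrite ltnS leq_eqVlt => /orP[/eqP ->|] //.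
  exact: k1.
have /choice[pick hp] (ml : nat * nat) : exists j, (ml.2 < j)%N /\ forall i, (i < ml.1.+1)%N -> I i -> P i ml.1 j.
  by have [j [/= k1 k2]] := UF_ex (UF_I (UF_ge ml.2.+1) (fin_int ml.1 ml.1.+1)); exists j.
pose phi := fix phi m := pick (m, if m is m'.+1 then phi m' else 0%N).
exists phi; split.
  by apply: homo_ltn => [x y z|m]; [exact: ltn_trans|have [] := hp (m.+1, phi m)].
move=> i m Ii im; have E : phi m = pick (m, if m is m'.+1 then phi m' else 0%N) by case: m {im}.
by rewrite E; have [_ /(_ i im Ii)] := hp (m, if m is m'.+1 then phi m' else 0%N).
Qed.

(** A countable base of discs with rational centres and radii 1 / (m + 1), numbered through an
    encoding of the parameters; numbers that encode nothing give the empty set. *)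
Definition qdisc (i : nat) : set C :=
  if @unpickle (rat * rat * nat)%type i is Some (x, y, m)
  then [set z | N (z - (ratr x +i* ratr y)) < m.+1%:R^-1] else set0.

Lemma qdisc_open i : open (qdisc i).
Proof.
rewrite /qdisc; case: unpickle => [[[x y] m]|]; last exact: open0.
rewrite openE => z /= zm; apply/near_cplx.
exists (m.+1%:R^-1 - N (z - (ratr x +i* ratr y))); first by rewrite subr_gt0.
by move=> w; rewrite ltrBrDr => wz /=; apply: le_lt_trans (ND3 z _ _) wz.
Qed.

Lemma qdisc_base a (r : R) : 0 < r -> exists i, qdisc i a /\ forall z, qdisc i z -> N (z - a) < r.
Proof.
move=> r0; have [m hm] : exists m : nat, m.+1%:R^-1 < r / 2.
  have r2 : 0 < r / 2 by lra.
  exact: UF_ex (UF_inv r2).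
pose d : R := m.+1%:R^-1 / 2; have d0 : 0 < d by rewrite divr_gt0 ?invr_gt0.
have near (t : R) : exists x : rat, `|t - ratr x| < d.
  have lt : t - d < t + d by lra.
  have [x] := rat_in_itvoo lt; rewrite in_itv /= => /andP[x1 x2].
  by exists x; rewrite ltr_norml; lra.
have [x hx] := near (complex.Re a); have [y hy] := near (complex.Im a).
exists (@pickle (rat * rat * nat)%type (x, y, m)); rewrite /qdisc pickleK.
have ac : N (a - (ratr x +i* ratr y)) < m.+1%:R^-1.
  apply: le_lt_trans (NReIm _) _; have -> : m.+1%:R^-1 = d + d :> R by rewrite /d; field; rewrite addrC natr1.
  by case: a hx hy => a1 a2 /= hx hy; apply: ltrD.
split=> // z /= zc; apply: le_lt_trans (ND3 (ratr x +i* ratr y) _ _) _.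
rewrite (NC a) in ac; apply: lt_trans (ltrD zc ac) _.
by rewrite [ltRHS]splitr ltrD.
Qed.

End Normal.

Theorem corollary1p4 (R : realType) (n k : nat) (D : set (cplx R))
    (F : set (cplx R -> sphere R)) :
  (0 < n)%N -> (0 < k)%N -> (k + 2 <= n)%N ->
  domain D ->
  (forall f, F f -> meromorphic_on D f) ->
  (forall f, F f -> forall z, D z -> mderivn k (mpow f n) z <> Some 1) ->
  normal_in D F.
Proof.
move=> n0 k0 k2n domD hF avF u Fu; have [_ oD _] := domD.
have ball z : D z -> exists2 s : R, 0 < s & forall w, normc (w - z) < s -> D w.
  by move=> Dz; apply/near_cplx; exact: open_nbhs_nbhs.
have shF f z : F f -> D z -> sholo f z by move=> Ff; exact: mero_sholo (hF f Ff).
have bnd a : D a -> exists r K : R, [/\ 0 < r, 0 <= K & sder_bounded u a r K].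
  move=> /ball[s s0 hs].
  have [|K K0 hK] := @sder_locally_bounded R n k k0 k2n a s F s0.
    move=> f Ff w ws; have sh := shF f w Ff (hs w ws); split=> //.
    by apply: (avoids_mderivn n0 sh); apply: avF => //; exact: hs.
  exists (s / 2), K; split; rewrite ?divr_gt0 //.
  apply: UF_all => j /= w ws; split; last exact: hK.
  by apply: shF => //; apply: hs; lra.
pose g := pointwise_ulim u : cplx R -> sphere R.
have shg z : D z -> sholo g z.
  by move=> /bnd[r [K [r0 K0 hS]]]; exact: (limit_sholo r0 K0 hS).
(* The numbers of the discs on which u tends uniformly to g along the ultrafilter. By [good_disc]
   they cover D, and there are countably many of them, which is what [diagonal] handles. *)
pose I i := forall e : R, 0 < e ->
  UF [set j | forall z, qdisc i z -> spherical_dist (u j z) (g z) < e].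
have [|phi [incr hphi]] := @diagonal I (fun i m j => forall z, qdisc i z -> spherical_dist (u j z) (g z) < m.+1%:R^-1).
  by move=> i m Ii; apply: Ii; rewrite invr_gt0 ltr0n.
exists phi, g; split=> //; first exact: mero_or_infinite.
move=> A cA AD e e0.
have cov : A `<=` cover [set i | I i] (@qdisc R).
  move=> a /AD/bnd[r [K [r0 K0 hS]]].
  have [rho rho0 hrho] := good_disc r0 K0 hS.
  have [i [ia hi]] := qdisc_base a rho0; exists i => // d d0.
  by apply: UF_S (hrho d d0) => j /= h z /hi; exact: h.
move: cA; rewrite compact_cover => /(_ _ _ _ (fun i _ => @qdisc_open R i) cov)[J JI AJ].
have e1 : 0 < e^-1 by rewrite invr_gt0.
(* Beyond every index of the finite subcover, so that [hphi] applies to each of its discs, and large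
   enough for 1 / (m + 1) <= e. *)
pose M := (\max_(i <- finmap.enum_fset J) i + Num.bound e^-1)%N.
exists M => // m /= Mm z /AJ[i /= iJ zi].
have iM : (i <= m)%N.
  apply: leq_trans Mm; apply: leq_trans (leq_addr _ _).
  exact: (@leq_bigmax_seq _ (finmap.enum_fset J) xpredT id i iJ).
apply: lt_le_trans (hphi i m _ iM z zi) _; first exact: (set_mem (JI i iJ)).
rewrite -[leRHS]invrK lef_pV2 ?posrE ?ltr0n // ltW //.
apply: lt_le_trans (archi_boundP (ltW e1)) _; rewrite ler_nat.
by apply: leq_trans (leqW Mm); exact: leq_addl.
Qed.
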